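(* There is an algorithm which, given an operator $T\in\mathbb Q(x,y)[d_x,d_y]$, tests whether $T$ has a first-order factor with coefficients in a universal field $F$, i.e. whether there exist a first-order operator $L\in F[d_x,d_y]$ and $S\in F[d_x,d_y]$ with $T=SL$. The algorithm invokes two subroutines: the elimination of an unknown function in a system of linear partial differential operators (in other words, a parametric Janet base), and a subroutine from the elimination procedure in the theory of ordinary differentially closed fields.
   Context: $F\supset\mathbb Q(x,y)$ is a universal differential field (in the sense of Kolchin) of characteristic $0$ with two commuting derivations $d_x,d_y$ extending the partial derivatives on $\mathbb Q(x,y)$. $F[d_x,d_y]$ is the ring of linear partial differential operators over $F$. Elements of $\mathbb Q(x,y)$ are represented exactly in the usual way. A parametric Janet base computation: given a system of linear partial differential equations in an unknown function $h$ whose coefficients are differential polynomials in a parameter function $f$, it outputs the conditions of solvability in $h$ as a disjunction of systems $p_1=\cdots=p_l=0,\ p_0\ne0$ of differential polynomials in $f$. The elimination subroutine for ordinary differentially closed fields: given a system $\bar p_1=\cdots=\bar p_l=0,\ \bar p_0\neq0$ of ordinary differential polynomials in one unknown, it outputs an equivalent disjunction of systems of the form $r=0,\ r_0\neq0$. *)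

(* Defs.v *)
From HB Require Import structures.
From mathcomp Require Import all_boot all_order all_algebra.
From mathcomp Require Import bigenough ssrcomplements mpoly.

Set Implicit Arguments.
Unset Strict Implicit.
Unset Printing Implicit Defensive.

Import GRing.Theory BigEnough.
Local Open Scope ring_scope.

Structure diffField (n : nat) := DiffField {
  df_sort :> fieldType;
  der : 'I_n -> df_sort -> df_sort;
  derD : forall i, {morph der i : a b / a + b};
  derM : forall i a b, der i (a * b) = der i a * b + a * der i b;
  derC : forall i j a, der i (der j a) = der j (der i a)
}.
Arguments der {n d} i a.

Definition diff_morphism n (G H : diffField n) (u : {rmorphism G -> H}) : Prop :=
  forall i a, u (der i a) = der i (u a).

(* Inverse is total with [0^-1 = 0], so closure under [a / b] needs no
   side condition. *)
Definition diff_subfield n (H : diffField n) (A : H -> Prop) : Prop :=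
  [/\ A 1,
      forall a b, A a -> A b -> A (a - b),
      forall a b, A a -> A b -> A (a / b)
    & forall i a, A a -> A (der i a)].

Definition finitely_generated n (G : diffField n) : Prop :=
  exists s : seq G, forall A : G -> Prop,
    diff_subfield A -> (forall a, a \in s -> A a) -> forall a, A a.

Definition finitely_generated_over n (G H : diffField n)
    (u : {rmorphism G -> H}) : Prop :=
  exists s : seq H, forall A : H -> Prop,
    diff_subfield A -> (forall a, A (u a)) -> (forall a, a \in s -> A a) ->
    forall a, A a.

(* Kolchin's notion: every finitely generated extension [H] of a finitely
   generated differential subfield [G] of [F] embeds into [F] over [G].
   [G] is finitely generated over the prime field; over Q(x,y) the notion would
   be the same, Q(x,y) being itself finitely generated. *)
Definition universal n (F : diffField n) : Prop :=
  forall (G H : diffField n)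
         (i : {rmorphism G -> F}) (j : {rmorphism G -> H}),
    diff_morphism i -> diff_morphism j ->
    finitely_generated G -> finitely_generated_over j ->
    exists k : {rmorphism H -> F},
      diff_morphism k /\ forall a, k (j a) = i a.

(* Blum's axioms: if [p] has order exactly [n] and [g <> 0] has order less than
   [n], then some [z] satisfies [p(z) = 0] and [g(z) <> 0].  The variable of
   index [i] stands for the [i]-th derivative. *)
Definition differentially_closed (K : diffField 1) : Prop :=
  forall (n : nat) (p g : {mpoly K[n.+1]}),
    has (fun m : 'X_{1..n.+1} => m ord_max != 0%N) (msupp p) ->
    g != 0 ->
    all (fun m : 'X_{1..n.+1} => m ord_max == 0%N) (msupp g) ->
    exists z : K, p.@[fun i => iter i (der ord0) z] = 0
               /\ g.@[fun i => iter i (der ord0) z] != 0.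

(* Index [0] is x, index [1] is y. *)
Definition ix : 'I_2 := ord0.
Definition iy : 'I_2 := ord_max.

Definition Qxy : fieldType := {fraction {mpoly rat[2]}}.

(* By the quotient rule, a derivation that agrees with the partial derivative on
   Q[x,y] agrees with it on Q(x,y). *)
Definition extends_partial (K : fieldType) (iota : {rmorphism Qxy -> K})
    (d : K -> K) (i : 'I_2) : Prop :=
  forall p : {mpoly rat[2]}, d (iota (tofrac p)) = iota (tofrac p^`M(i)).

(* An operator is identified with its normal form: the coefficient of the
   monomial [m] of [P : {mpoly F[2]}] is that of [d_x ^ (m ix) d_y ^ (m iy)].
   The commutative product of [{mpoly F[2]}] is not the product of operators;
   the latter is determined by [d_i a = a d_i + d_i(a)]. *)
Section Operators.
Variable F : diffField 2.

Definition opD (i : 'I_2) (P : {mpoly F[2]}) : {mpoly F[2]} :=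
  'X_i * P + \sum_(m <- msupp P) der i P@_m *: 'X_[m].

Definition opM (S L : {mpoly F[2]}) : {mpoly F[2]} :=
  \sum_(m <- msupp S) S@_m *: iter (m ix) (opD ix) (iter (m iy) (opD iy) L).

Definition jet (f : F) (ij : nat * nat) : F :=
  iter ij.1 (der ix) (iter ij.2 (der iy) f).

Definition op_apply (P : {mpoly F[2]}) (f : F) : F :=
  \sum_(m <- msupp P) P@_m * jet f (m ix, m iy).

(* [msize] is the total degree plus one. *)
Definition first_order (L : {mpoly F[2]}) : Prop := msize L = 2%N.

Definition has_first_order_factor (T : {mpoly F[2]}) : Prop :=
  exists S L : {mpoly F[2]}, first_order L /\ T = opM S L.

End Operators.

(* [(c, (i, j))] stands for [c x^i y^j]. *)
Definition zpoly := seq (int * (nat * nat)).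

Definition zpoly_val (p : zpoly) : {mpoly rat[2]} :=
  \sum_(t <- p) (t.1)%:~R *: ('X_ix ^+ t.2.1 * 'X_iy ^+ t.2.2).

(* Numerator and nonzero denominator, not necessarily coprime. *)
Definition ratfun := {nd : zpoly * zpoly | zpoly_val nd.2 != 0}.

Definition ratfun_val (r : ratfun) : Qxy :=
  tofrac (zpoly_val (val r).1) / tofrac (zpoly_val (val r).2).

(* [(c, (i, j))] stands for [c d_x^i d_y^j]. *)
Definition oper := seq (ratfun * (nat * nat)).

Definition oper_val (s : oper) : {mpoly Qxy[2]} :=
  \sum_(t <- s) ratfun_val t.1 *: ('X_ix ^+ t.2.1 * 'X_iy ^+ t.2.2).

(* Differential polynomials over Q(x,y) in one unknown whose derivatives are
   indexed by [I]: [(c, [:: a1; ...; ak])] stands for the monomial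
   [c f_a1 ... f_ak]. *)
Definition dpoly (I : Type) := seq (ratfun * seq I).

Definition dpoly_val (I : Type) (K : fieldType) (iota : Qxy -> K)
    (f : I -> K) (p : dpoly I) : K :=
  \sum_(t <- p) iota (ratfun_val t.1) * \prod_(a <- t.2) f a.

(* [(ps, q)] stands for [p = 0] for all [p] in [ps], and [q <> 0]. *)
Definition dsystem (I : Type) := (seq (dpoly I) * dpoly I)%type.

Definition dsystem_holds (I : Type) (K : fieldType) (iota : Qxy -> K)
    (f : I -> K) (s : dsystem I) : bool :=
  all (fun p => dpoly_val iota f p == 0) s.1 && (dpoly_val iota f s.2 != 0).

(* [(p, (i, j))] stands for [p(f) d_x^i d_y^j h]. *)
Definition lin_eq := seq (dpoly (nat * nat) * (nat * nat)).

Definition lin_eq_val (F : diffField 2) (iota : Qxy -> F) (f h : F)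
    (e : lin_eq) : F :=
  \sum_(t <- e) dpoly_val iota (jet f) t.1 * jet h t.2.

Inductive tree := Leaf | Node of tree & tree.

Inductive subroutine := ParametricJanet | OrdinaryElimination.

(* A point-free form of Jones' WHILE language on binary trees, in which the
   two subroutines may be called.  [While t c] iterates [c] on its argument as
   long as [t] returns a [Node]. *)
Inductive program :=
  | Const_leaf
  | Id
  | Hd
  | Tl
  | Cons of program & program
  | Seq of program & program
  | If of program & program & program
  | While of program & program
  | Call of subroutine.

Definition tree_hd t := if t is Node a _ then a else Leaf.
Definition tree_tl t := if t is Node _ b then b else Leaf.

(* [exec O c t u]: on input [t], [c] halts with output [u], a call to the
   subroutine [s] being answered according to [O s].  *)
Inductive exec (O : subroutine -> tree -> tree -> Prop) :
    program -> tree -> tree -> Prop :=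
  | exec_leaf t : exec O Const_leaf t Leaf
  | exec_id t : exec O Id t t
  | exec_hd t : exec O Hd t (tree_hd t)
  | exec_tl t : exec O Tl t (tree_tl t)
  | exec_cons c d t u v :
      exec O c t u -> exec O d t v -> exec O (Cons c d) t (Node u v)
  | exec_seq c d t u v : exec O c t u -> exec O d u v -> exec O (Seq c d) t v
  | exec_if_node b c d t u1 u2 v :
      exec O b t (Node u1 u2) -> exec O c t v -> exec O (If b c d) t v
  | exec_if_leaf b c d t v :
      exec O b t Leaf -> exec O d t v -> exec O (If b c d) t v
  | exec_while_stop b c t : exec O b t Leaf -> exec O (While b c) t t
  | exec_while_step b c t u1 u2 u v :
      exec O b t (Node u1 u2) -> exec O c t u -> exec O (While b c) u v ->
      exec O (While b c) t v
  | exec_call s t u : O s t u -> exec O (Call s) t u.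

(* Without subroutines, a call never returns. *)
Definition no_subroutine (s : subroutine) (t u : tree) : Prop := False.

Definition subroutines (J E : tree -> tree -> Prop) (s : subroutine) :=
  match s with ParametricJanet => J | OrdinaryElimination => E end.

Fixpoint invokes (s : subroutine) (c : program) : Prop :=
  match c with
  | Const_leaf | Id | Hd | Tl => False
  | Cons c d | Seq c d | While c d => invokes s c \/ invokes s d
  | If b c d => [\/ invokes s b, invokes s c | invokes s d]
  | Call s' => s' = s
  end.

Definition enc_bool (b : bool) : tree := if b then Node Leaf Leaf else Leaf.
Definition enc_nat (n : nat) : tree := iter n (Node Leaf) Leaf.
Definition enc_int (z : int) : tree :=
  match z with
  | Posz n => Node (enc_bool false) (enc_nat n)
  | Negz n => Node (enc_bool true) (enc_nat n)
  end.
Definition enc_pair A B (ea : A -> tree) (eb : B -> tree) (p : A * B) : tree :=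
  Node (ea p.1) (eb p.2).
Definition enc_seq A (ea : A -> tree) (s : seq A) : tree :=
  foldr (fun a => Node (ea a)) Leaf s.

Definition enc_nat2 := enc_pair enc_nat enc_nat.
Definition enc_zpoly := enc_seq (enc_pair enc_int enc_nat2).
Definition enc_ratfun (r : ratfun) := enc_pair enc_zpoly enc_zpoly (val r).
Definition enc_oper := enc_seq (enc_pair enc_ratfun enc_nat2).
Definition enc_dpoly (I : Type) (ei : I -> tree) :=
  enc_seq (enc_pair enc_ratfun (enc_seq ei)).
Definition enc_dsystem (I : Type) (ei : I -> tree) :=
  enc_pair (enc_seq (enc_dpoly ei)) (enc_dpoly ei).
Definition enc_lin_eq := enc_seq (enc_pair (enc_dpoly enc_nat2) enc_nat2).

Definition functional (R : tree -> tree -> Prop) : Prop :=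
  forall t u v, R t u -> R t v -> u = v.

(* Linear homogeneous equations are always solved by [h = 0]; solvability means
   having a solution [h <> 0]. *)
Definition parametric_janet_base (F : diffField 2) (iota : Qxy -> F)
    (J : tree -> tree -> Prop) : Prop :=
  functional J /\
  forall sys : seq lin_eq, exists out : seq (dsystem (nat * nat)),
    J (enc_seq enc_lin_eq sys) (enc_seq (enc_dsystem enc_nat2) out) /\
    forall f : F,
      (exists2 h : F, h != 0 & all (fun e => lin_eq_val iota f h e == 0) sys)
      <-> has (dsystem_holds iota (jet f)) out.

(* Each [(r, r0)] in the output stands for [r = 0], [r0 <> 0].  The derivation
   of the ordinary field [K] extends the partial derivative in x. *)
Definition ordinary_elimination (E : tree -> tree -> Prop) : Prop :=
  functional E /\
  forall sys : dsystem nat, exists out : seq (dpoly nat * dpoly nat),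
    E (enc_dsystem enc_nat sys)
      (enc_seq (enc_pair (enc_dpoly enc_nat) (enc_dpoly enc_nat)) out) /\
    forall (K : diffField 1) (iota : {rmorphism Qxy -> K}),
      extends_partial iota (der ord0) ix -> differentially_closed K ->
      forall z : K, let f := fun k : nat => iter k (der ord0) z in
        dsystem_holds iota f sys =
        has (fun r => dsystem_holds iota f ([:: r.1], r.2)) out.

(* The answer must be correct for every representation of [T]. *)
Definition decides (O : subroutine -> tree -> tree -> Prop) (c : program)
    (P : {mpoly Qxy[2]} -> Prop) : Prop :=
  forall (T : {mpoly Qxy[2]}) (s : oper), oper_val s = T ->
    exists b : bool, exec O c (enc_oper s) (enc_bool b) /\ (b <-> P T).

Lemma exec_functional O c :
  (forall s, functional (O s)) -> functional (exec O c).
Proof.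
intros HO t u v H; revert v.
induction H; intros w Hw; inversion Hw; subst; clear Hw; try reflexivity;
  repeat match goal with
  | IH : forall v, exec ?O ?c ?t v -> ?u = v, X : exec ?O ?c ?t ?w |- _ =>
      let e := fresh in have e := IH _ X; clear X;
      first [discriminate e | subst | injection e; intros; subst]; clear IH
  end; eauto.
by apply: HO; eassumption.
Qed.

Lemma monomialE (R : comNzRingType) (m : 'X_{1..2}) :
  'X_[R, m] = 'X_ix ^+ m ix * 'X_iy ^+ m iy.
Proof.
by rewrite mpolyXE_id big_ord_recl big_ord1; congr (_ * 'X__ ^+ m _); apply: val_inj.
Qed.

Lemma zpoly_val_surj (p : {mpoly rat[2]}) :
  exists2 D : int, D != 0 & exists q : zpoly, zpoly_val q = D%:~R *: p.
Proof.
rewrite [p]mpolyE; elim: (msupp p) => [|m s [D D0 [q qE]]].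
  by exists 1 => //; exists [::]; rewrite /zpoly_val !big_nil scaler0.
exists (denq p@_m * D); first by rewrite mulf_neq0 ?denq_neq0.
exists ((numq p@_m * D, (m ix, m iy)) ::
        [seq (denq p@_m * t.1, t.2) | t <- q]).
rewrite /zpoly_val !big_cons big_map scalerDr; congr (_ + _).
  rewrite -monomialE scalerA !intrM numqE /=; congr (_ *: _).
  by rewrite -[LHS]mulrA [LHS]mulrC; congr (_ * _); apply: mulrC.
rewrite intrM -scalerA -qE scaler_sumr; apply: eq_bigr => t _ /=.
by rewrite scalerA intrM.
Qed.

Lemma fracE (R : idomainType) (r : {fraction R}) :
  exists a b : R, b != 0 /\ r = tofrac a / tofrac b.
Proof.
elim/quotW: r => x; exists x.1, x.2; split; first exact: denom_ratioP.
have d0 : tofrac x.2 != 0 by rewrite tofrac_eq0 denom_ratioP.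
apply: (mulIf d0); rewrite divfK //.
unlock tofrac; rewrite -[LHS]FracField.pi_mul.
apply/eqmodP; rewrite /= FracField.equivfE /FracField.mulf.
by rewrite !numden_Ratio ?mulr1 ?oner_neq0 ?denom_ratioP // mulrC.
Qed.

Lemma ratfun_val_surj (r : Qxy) : exists s : ratfun, ratfun_val s = r.
Proof.
have [a [b [b0 ->]]] := fracE r.
have [D D0 [p pE]] := zpoly_val_surj a.
have [D' D'0 [q qE]] := zpoly_val_surj b.
have cK (c : int) : c != 0 -> (c%:~R : rat) != 0 by rewrite intr_eq0.
pose p' : zpoly := [seq (D' * t.1, t.2) | t <- p].
pose q' : zpoly := [seq (D * t.1, t.2) | t <- q].
have scE (c : int) (u : zpoly) :
    zpoly_val [seq (c * t.1, t.2) | t <- u] = c%:~R *: zpoly_val u.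
  rewrite /zpoly_val big_map scaler_sumr; apply: eq_bigr => t _.
  by rewrite scalerA intrM.
have q'E : zpoly_val q' = (D * D')%:~R%:MP * b.
  by rewrite scE qE scalerA -intrM mul_mpolyC.
have DD0 : ((D * D')%:~R%:MP : {mpoly rat[2]}) != 0.
  by rewrite mpolyC_eq0 cK // mulf_neq0.
have q'0 : zpoly_val q' != 0 by rewrite q'E mulf_neq0.
exists (exist _ (p', q') q'0); rewrite /ratfun_val /= q'E.
rewrite scE pE scalerA -intrM [D' * D]mulrC -mul_mpolyC !tofracM.
by rewrite invfM mulrACA mulfV ?mul1r // tofrac_eq0.
Qed.

Lemma oper_val_surj (T : {mpoly Qxy[2]}) : exists s : oper, oper_val s = T.
Proof.
rewrite [T]mpolyE; elim: (msupp T) => [|m s [t IH]].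
  by exists [::]; rewrite /oper_val !big_nil.
have [r rE] := ratfun_val_surj T@_m.
exists ((r, (m ix, m iy)) :: t).
by rewrite big_cons -IH /oper_val big_cons /= rE -monomialE.
Qed.

Section Action.
Variables (F : diffField 2) (f : F).
Implicit Types (P S L : {mpoly F[2]}) (i : 'I_2).

Lemma op_applywE k P : (msize P <= k)%N ->
  op_apply P f = \sum_(m : 'X_{1..2 < k}) P@_m * jet f (m ix, m iy).
Proof.
pose I : subFinType _ := 'X_{1..2 < k}.
move=> le_pk; rewrite /op_apply (big_mksub I) /=; first last.
  by move=> x /msize_mdeg_lt/leq_trans/(_ le_pk).
  by rewrite msupp_uniq.
by rewrite big_rmcond //= => j /memN_msupp_eq0 ->; rewrite mul0r.
Qed.

Lemma op_apply_linear c P L :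
  op_apply (c *: P + L) f = c * op_apply P f + op_apply L f.
Proof.
pose_big_enough k; first rewrite !(op_applywE (k := k)) //.
  rewrite mulr_sumr -big_split /=; apply: eq_bigr => m _.
  by rewrite mcoeffD mcoeffZ mulrDl mulrA.
by close.
Qed.

Lemma op_apply0 : op_apply (0 : {mpoly F[2]}) f = 0.
Proof. by rewrite /op_apply msupp0 big_nil. Qed.

Lemma op_applyD P L : op_apply (P + L) f = op_apply P f + op_apply L f.
Proof. by rewrite -{1}[P]scale1r op_apply_linear mul1r. Qed.

Lemma op_applyZ c P : op_apply (c *: P) f = c * op_apply P f.
Proof. by rewrite -[_ *: _]addr0 op_apply_linear op_apply0 addr0. Qed.

Lemma op_apply_sum (I : Type) (r : seq I) (G : I -> {mpoly F[2]}) :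
  op_apply (\sum_(a <- r) G a) f = \sum_(a <- r) op_apply (G a) f.
Proof.
elim: r => [|a r IH]; first by rewrite !big_nil op_apply0.
by rewrite !big_cons op_applyD IH.
Qed.

Lemma op_applyX (m : 'X_{1..2}) : op_apply 'X_[m] f = jet f (m ix, m iy).
Proof. by rewrite /op_apply msuppX big_seq1 mcoeffX eqxx mul1r. Qed.

Lemma der_jet i (m : 'X_{1..2}) :
  der i (jet f (m ix, m iy)) = jet f ((m + U_(i))%MM ix, (m + U_(i))%MM iy).
Proof.
have iterC (j : 'I_2) n (a : F) :
    der i (iter n (der j) a) = iter n (der j) (der i a).
  by elim: n => //= n IH; rewrite derC IH.
rewrite /jet /= !mnmDE !mnm1E.
case: i iterC => [[|[|//]] lti] iterC.
  have -> : Ordinal lti = ix by apply: val_inj.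
  by rewrite eqxx /= addn0 addn1.
have -> : Ordinal lti = iy by apply: val_inj.
have <- : Ordinal lti = iy by apply: val_inj.
rewrite !iterC; have -> : Ordinal lti = iy by apply: val_inj.
by rewrite eqxx /= addn0 addn1 iterSr.
Qed.

Lemma op_apply_opD i P : op_apply (opD i P) f = der i (op_apply P f).
Proof.
rewrite /opD op_applyD op_apply_sum {1}[P]mpolyE mulr_sumr op_apply_sum.
have der0 : der i (0 : F) = 0.
  by apply: (addrI (der i 0)); rewrite -derD !addr0.
rewrite [in RHS]/op_apply.
have -> : der i (\sum_(m <- msupp P) P@_m * jet f (m ix, m iy)) =
    \sum_(m <- msupp P) der i (P@_m * jet f (m ix, m iy)).
  elim: (msupp P) => [|m s IH]; first by rewrite !big_nil.
  by rewrite !big_cons derD IH.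
rewrite -big_split; apply: eq_bigr => m _ /=.
rewrite derM addrC op_applyZ op_applyX; congr (_ + _).
by rewrite -scalerAr -mpolyXD op_applyZ op_applyX addmC der_jet.
Qed.

End Action.

(* The product of operators is the composition of their actions. *)
Lemma op_applyM (F : diffField 2) (S L : {mpoly F[2]}) (f : F) :
  op_apply (opM S L) f = op_apply S (op_apply L f).
Proof.
rewrite /opM op_apply_sum [in RHS]/op_apply; apply: eq_bigr => m _.
rewrite op_applyZ; congr (_ * _); rewrite /jet /=.
elim: (m ix) => [|n IH] /=; last by rewrite op_apply_opD IH.
by elim: (m iy) => [|n IH] //=; rewrite op_apply_opD IH.
Qed.

(* Main.v *)
(* Let [i] be a direction and [j] the other one.  Up to a left factor, a
   first-order operator that involves [d_i] is [h (d_i + u d_j) h^-1], because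
   over a universal field every first-order operator kills some [h <> 0].
   Hence [T] is right divisible by such an operator iff the image of [T h]
   vanishes in the quotient of the ring of operators by the left ideal of
   [d_i + u d_j].  This quotient is free on the powers of [d_j], so that its
   vanishing is a system that is linear in [h] with coefficients differential
   polynomials in [u]: the parametric Janet base eliminates [h].  The
   equation of highest degree is [P(u) h = 0], where [P] comes from the symbol
   of [T] and does not vanish identically; so [u] is algebraic over Q(x,y),
   the derivatives of [u] are reduced modulo [P], splitting on the multiplicity
   of the root, and there remains a system [r(u) = 0, q(u) <> 0] over Q(x,y),
   solvable iff [r] does not divide [q ^ deg r].

   Formal solutions of linear systems are Hurwitz series: the Taylor expansion
   embeds [F] into the series over [F], a domain with two commuting derivations
   in which the formal solution lives, and universality brings it back to [F]. *)

From HB Require Import structures.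
Require Import Defs.
From mathcomp Require Import all_boot all_order all_algebra.
From mathcomp Require Import mpoly.
From mathcomp Require Import all_field ssrcomplements boolp zify ring.
Set Implicit Arguments.
Unset Strict Implicit.
Unset Printing Implicit Defensive.
Import GRing.Theory.

(** * Programs *)

(** The lists handled by the programs never merge equal monomials, so a degree or a leading term
    read off a list is only an upper bound. Vanishing can be tested only for coefficients in Q[x,y]
    ([iszero]); on a coefficient that involves the parameter the computation branches instead. Two
    features of the proof follow. Terms meant to cancel are removed by hand, since otherwise no rank
    would drop. And elimination and completion are proved correct pointwise: at each fixed value of
    the parameter, a state holds iff one of its outputs or successors holds, so that no theory of
    differential ideals enters. The power of [q] comes from the roots that universality provides:
    [r] has a root in [F] outside those of [q] as soon as a nonconstant factor of [r] is coprime to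
    [q]. Formal solutions of linear systems are treated as linear forms on operators. Buchberger's
    criterion is phrased through the forms that kill all smaller multiples of the generators, which
    replaces the bookkeeping of standard representations. *)

Class encodable (A : Type) := encode : A -> tree.
#[global] Instance enc_bool_inst : encodable bool := enc_bool.
#[global] Instance enc_nat_inst : encodable nat := enc_nat.
#[global] Instance enc_int_inst : encodable int := enc_int.
#[global] Instance enc_pair_inst A B (a : encodable A) (b : encodable B) :
  encodable (A * B) := enc_pair a b.
#[global] Instance enc_seq_inst A (a : encodable A) : encodable (seq A) :=
  enc_seq a.

Definition oracle := subroutine -> tree -> tree -> Prop.

(** The program is fixed before the oracle, so the same code serves inside the decision program,
    which calls the subroutines, and in the subroutines themselves, which run under
    [no_subroutine]. *)
Definition computable (A B : Type) (a : encodable A) (b : encodable B)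
    (f : A -> B) : Prop :=
  exists c, forall (O : oracle) x, exec O c (encode x) (encode (f x)).
Arguments computable {A B a b} f.

Create HintDb comp.
#[global] Hint Constants Opaque : comp.

Section Combinators.
Context {G A B C : Type} {g : encodable G} {ea : encodable A}
  {eb : encodable B} {ec : encodable C}.

Lemma c_id : computable (fun x : G => x).
Proof. by exists Id => O x; constructor. Qed.

Lemma exec_tree t : exists c, forall O u, exec O c u t.
Proof.
elim: t => [|t [c cP] u [d dP]]; first by exists Const_leaf => O u; constructor.
by exists (Defs.Cons c d) => O v; constructor.
Qed.

Lemma c_const (k : A) : computable (fun _ : G => k).
Proof. by have [c cP] := exec_tree (encode k); exists c => O x. Qed.

Lemma c_comp (f : G -> A) (h : A -> B) :
  computable f -> computable h -> computable (fun x => h (f x)).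
Proof.
move=> [c cP] [d dP]; exists (Seq c d) => O x.
by apply: exec_seq; [apply: cP | apply: dP].
Qed.

Lemma c_pair (f : G -> A) (h : G -> B) :
  computable f -> computable h -> computable (fun x => (f x, h x)).
Proof. by move=> [c cP] [d dP]; exists (Defs.Cons c d) => O x; constructor. Qed.

End Combinators.

Section Combinators.
Context {G A B C : Type} {g : encodable G} {ea : encodable A}
  {eb : encodable B} {ec : encodable C}.

Lemma c_fst (f : G -> A * B) : computable f -> computable (fun x => (f x).1).
Proof.
move=> [c cP]; exists (Seq c Hd) => O x; apply: exec_seq; first exact: cP.
by have := exec_hd O (encode (f x)); case: (f x).
Qed.

Lemma c_snd (f : G -> A * B) : computable f -> computable (fun x => (f x).2).
Proof.
move=> [c cP]; exists (Seq c Tl) => O x; apply: exec_seq; first exact: cP.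
by have := exec_tl O (encode (f x)); case: (f x).
Qed.

End Combinators.

Section Combinators.
Context {G A B C : Type} {g : encodable G} {ea : encodable A}
  {eb : encodable B} {ec : encodable C}.

Lemma c_lift2 (h : A -> B -> C) :
  computable (fun p : A * B => h p.1 p.2) ->
  forall (f : G -> A) (k : G -> B), computable f -> computable k ->
  computable (fun x => h (f x) (k x)).
Proof. by move=> hP f k fP kP; exact: c_comp (c_pair fP kP) hP. Qed.

Lemma c_if (b : G -> bool) (f h : G -> A) :
  computable b -> computable f -> computable h ->
  computable (fun x => if b x then f x else h x).
Proof.
move=> [t tP] [c cP] [d dP]; exists (If t c d) => O x.
have := tP O x; case: (b x) => e; first exact: exec_if_node e (cP _ _).
exact: exec_if_leaf e (dP _ _).
Qed.

Lemma c_cons (f : G -> A) (l : G -> seq A) :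
  computable f -> computable l -> computable (fun x => f x :: l x).
Proof. by move=> [c cP] [d dP]; exists (Defs.Cons c d) => O x; constructor. Qed.

End Combinators.

Section Combinators.
Context {G A B C : Type} {g : encodable G} {ea : encodable A}
  {eb : encodable B} {ec : encodable C}.

(* The loop runs on [Node x (Node l acc)], with [l] the part of the list that
   is still to be read. *)
Lemma c_foldl (s : G -> B -> A -> B) (z : G -> B) (l : G -> seq A) :
  computable (fun p : G * B * A => s p.1.1 p.1.2 p.2) ->
  computable z -> computable l ->
  computable (fun x => foldl (s x) (z x) (l x)).
Proof.
move=> [c cP] [d dP] [e eP].
pose body := Defs.Cons Hd (Defs.Cons (Seq Tl (Seq Hd Tl))
  (Seq (Defs.Cons (Defs.Cons Hd (Seq Tl Tl)) (Seq Tl (Seq Hd Hd))) c)).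
exists (Seq (Seq (Defs.Cons Id (Defs.Cons e d)) (While (Seq Tl Hd) body)) (Seq Tl Tl)).
move=> O x; apply: (@exec_seq _ _ _ _
  (Node (encode x) (Node Leaf (encode (foldl (s x) (z x) (l x)))))).
  apply: (@exec_seq _ _ _ _
    (Node (encode x) (Node (encode (l x)) (encode (z x))))).
    by repeat constructor.
  elim: (l x) (z x) => [|a r IH] y /=.
    by apply: exec_while_stop; econstructor; constructor.
  have ee : exec O (Seq Tl Hd) (Node (encode x) (Node (encode (a :: r)) (encode y)))
     (Node (encode a) (encode r)) by econstructor; constructor.
  apply: exec_while_step ee _ (IH _).
  constructor; first exact: exec_hd.
  constructor; first by repeat (econstructor; try constructor).
  apply: (@exec_seq _ _ _ _ (encode ((x, y), a))); last exact: cP.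
  by constructor; first constructor; repeat (econstructor; try constructor).
by econstructor; constructor.
Qed.

End Combinators.

Section Combinators.
Context {G A B C : Type} {g : encodable G} {ea : encodable A}
  {eb : encodable B} {ec : encodable C}.

(** A natural number has the same tree as a list of that many [false], so iterating is folding over
    such a list while ignoring its entries. *)
Lemma c_iter (s : G -> A -> A) (z : G -> A) (n : G -> nat) :
  computable (fun p : G * A => s p.1 p.2) -> computable z -> computable n ->
  computable (fun x => iter (n x) (s x) (z x)).
Proof.
move=> sP zP [c cP].
have -> : (fun x => iter (n x) (s x) (z x)) =
    (fun x => foldl (fun y _ => s x y) (z x) (nseq (n x) false)).
  apply: funext => x; elim: (n x) (z x) => //= k IH y.
  by rewrite -IH -iterSr.
apply: c_foldl zP _; first exact: (c_comp (c_fst c_id) sP).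
exists c => O x; have := cP O x.
suff E : enc_nat (n x) = enc_seq enc_bool (nseq (n x) false).
  by rewrite /encode /enc_nat_inst E.
by elim: (n x) => [//|k IH]; exact: (congr1 (Node Leaf) IH).
Qed.

Lemma c_pred (n : G -> nat) : computable n -> computable (fun x => (n x).-1).
Proof.
move=> [c cP]; exists (Seq c Tl) => O x; apply: exec_seq (cP O x) _.
by have := exec_tl O (encode (n x)); case: (n x).
Qed.

Lemma c_succ (n : G -> nat) : computable n -> computable (fun x => (n x).+1).
Proof.
move=> [c cP]; exists (Defs.Cons Const_leaf c) => O x.
by apply: exec_cons (cP O x); constructor.
Qed.

Lemma c_posn (n : G -> nat) : computable n -> computable (fun x => 0 < n x).
Proof.
move=> [c cP]; exists (If c (Defs.Cons Const_leaf Const_leaf) Const_leaf) => O x.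
have := cP O x; case: (n x) => [|k] e.
  by apply: exec_if_leaf e _; constructor.
by apply: exec_if_node e _; repeat constructor.
Qed.

Lemma c_nilp (l : G -> seq A) : computable l -> computable (fun x => nilp (l x)).
Proof.
move=> [c cP]; exists (If c Const_leaf (Defs.Cons Const_leaf Const_leaf)) => O x.
have := cP O x; case: (l x) => [|k l'] e.
  by apply: exec_if_leaf e _; repeat constructor.
by apply: exec_if_node e _; repeat constructor.
Qed.

Lemma c_behead (l : G -> seq A) :
  computable l -> computable (fun x => behead (l x)).
Proof.
move=> [c cP]; exists (Seq c Tl) => O x; apply: exec_seq (cP O x) _.
by have := exec_tl O (encode (l x)); case: (l x).
Qed.

Lemma c_head (d : G -> A) (l : G -> seq A) :
  computable d -> computable l -> computable (fun x => head (d x) (l x)).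
Proof.
move=> [k kP] [c cP]; exists (If c (Seq c Hd) k) => O x; have := cP O x.
case: (l x) => [|a r] e; first exact: exec_if_leaf e (kP _ _).
apply: exec_if_node (e) _; apply: exec_seq e _.
exact: (exec_hd O (Node (encode a) (encode r))).
Qed.

(** Unary form of an integer: the monomials of [pol] carry only signs, so a coefficient becomes a
    repetition. [Negz n] is -(n+1), whence the successor. *)
Definition int_signs (c : int) : seq bool :=
  match c with Posz n => nseq n false | Negz n => nseq n.+1 true end.

End Combinators.

Ltac comp_tac := solve [eauto 200 with comp nocore].
#[global] Hint Extern 1 (computable ?F) =>
  match F with (fun x => pair (@?f x) (@?h x)) => eapply c_pair end : comp.
#[global] Hint Resolve c_id c_fst c_snd c_cons c_foldl c_iter c_if : comp.
#[global] Hint Resolve c_pred c_succ c_posn c_nilp c_behead c_head : comp.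
#[global] Hint Extern 0 (computable (fun _ => ?k)) => apply c_const : comp.

#[global] Hint Extern 1 (computable _) =>
  match goal with
  | H : computable ?h |- computable (fun x => ?h (@?f x)) =>
      simple refine (c_comp (f := f) (h := h) _ H)
  | H : computable (fun p => ?h (fst p) (snd p))
    |- computable (fun x => ?h (@?f x) (@?k x)) =>
      simple refine (c_lift2 (h := h) H (f := f) (k := k) _ _)
  end : comp.

Section Derived.
Context {G A B C : Type} {g : encodable G} {ea : encodable A}
  {eb : encodable B} {ec : encodable C}.

Lemma c_negb (b : G -> bool) : computable b -> computable (fun x => ~~ b x).
Proof.
move=> bP; rewrite (_ : (fun x => _) = fun x => if b x then false else true).
  comp_tac.
by apply: funext => x; case: (b x).
Qed.

Lemma c_andb (b c : G -> bool) :
  computable b -> computable c -> computable (fun x => b x && c x).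
Proof. move=> bP cP; rewrite (_ : (fun x => _) = fun x => if b x then c x else false); first comp_tac.
by apply: funext => x; case: (b x). Qed.

Lemma c_orb (b c : G -> bool) :
  computable b -> computable c -> computable (fun x => b x || c x).
Proof. move=> bP cP; rewrite (_ : (fun x => _) = fun x => if b x then true else c x); first comp_tac.
by apply: funext => x; case: (b x). Qed.

End Derived.
#[global] Hint Resolve c_andb c_orb c_negb : comp.

Section Derived.
Context {G A B C : Type} {g : encodable G} {ea : encodable A}
  {eb : encodable B} {ec : encodable C}.

Lemma c_addb (b c : G -> bool) :
  computable b -> computable c -> computable (fun x => b x (+) c x).
Proof. move=> bP cP; rewrite (_ : (fun x => _) = fun x => if b x then ~~ c x else c x); first comp_tac.
by apply: funext => x; case: (b x). Qed.

Lemma c_addn (m n : G -> nat) :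
  computable m -> computable n -> computable (fun x => m x + n x).
Proof.
move=> mP nP; rewrite (_ : (fun x => _) = fun x => iter (m x) S (n x)).
  comp_tac.
by apply: funext => x; elim: (m x) => //= k <-.
Qed.

Lemma c_subn (m n : G -> nat) :
  computable m -> computable n -> computable (fun x => m x - n x).
Proof.
move=> mP nP; rewrite (_ : (fun x => _) = fun x => iter (n x) predn (m x)).
  comp_tac.
by apply: funext => x; elim: (n x) => [|k IH] /=; rewrite ?subn0 // subnS IH.
Qed.

End Derived.
#[global] Hint Resolve c_addb c_addn c_subn : comp.

Section Derived.
Context {G A B C : Type} {g : encodable G} {ea : encodable A}
  {eb : encodable B} {ec : encodable C}.

Lemma c_leq (m n : G -> nat) :
  computable m -> computable n -> computable (fun x => m x <= n x).
Proof.
move=> mP nP; rewrite (_ : (fun x => _) = fun x => ~~ (0 < m x - n x)).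
  comp_tac.
by apply: funext => x; rewrite subn_gt0 -leqNgt.
Qed.

Lemma c_muln (m n : G -> nat) :
  computable m -> computable n -> computable (fun x => m x * n x).
Proof.
move=> mP nP; rewrite (_ : (fun x => _) = fun x => iter (m x) (addn (n x)) 0).
  comp_tac.
by apply: funext => x; rewrite iter_addn_0 mulnC.
Qed.

End Derived.
#[global] Hint Resolve c_leq c_muln : comp.

Section Derived.
Context {G A B C : Type} {g : encodable G} {ea : encodable A}
  {eb : encodable B} {ec : encodable C}.

Lemma c_eqn (m n : G -> nat) :
  computable m -> computable n -> computable (fun x => m x == n x).
Proof.
move=> mP nP; rewrite (_ : (fun x => _) = fun x => (m x <= n x) && (n x <= m x)).
  comp_tac.
by apply: funext => x; rewrite eqn_leq.
Qed.

Lemma c_maxn (m n : G -> nat) :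
  computable m -> computable n -> computable (fun x => maxn (m x) (n x)).
Proof. by move=> mP nP; rewrite /maxn; comp_tac. Qed.

Lemma c_rev (l : G -> seq A) : computable l -> computable (fun x => rev (l x)).
Proof.
move=> lP; rewrite (_ : (fun x => _) =
    fun x => foldl (fun r a => a :: r) [::] (l x)); first by comp_tac.
by apply: funext => x; rewrite -[in RHS](revK (l x)) foldl_rev; elim: (rev _) => //= a r <-.
Qed.

Lemma c_foldr (s : G -> A -> B -> B) (z : G -> B) (l : G -> seq A) :
  computable (fun p : G * A * B => s p.1.1 p.1.2 p.2) ->
  computable z -> computable l ->
  computable (fun x => foldr (s x) (z x) (l x)).
Proof.
move=> sP zP lP; rewrite (_ : (fun x => _) =
    fun x => foldl (fun b a => s x a b) (z x) (rev (l x))).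
  apply: c_foldl => //; last exact: c_rev.
  by apply: (c_comp (f := fun p : G * B * A => (p.1.1, p.2, p.1.2)) _ sP); comp_tac.
by apply: funext => x; rewrite foldl_rev.
Qed.
End Derived.
#[global] Hint Resolve c_eqn c_maxn c_rev c_foldr : comp.

Section Derived.
Context {G A B C : Type} {g : encodable G} {ea : encodable A}
  {eb : encodable B} {ec : encodable C}.

Lemma c_map (s : G -> A -> B) (l : G -> seq A) :
  computable (fun p : G * A => s p.1 p.2) -> computable l ->
  computable (fun x => map (s x) (l x)).
Proof.
move=> sP lP; rewrite (_ : (fun x => _) =
  fun x => foldr (fun a r => s x a :: r) [::] (l x)); last first.
  by apply: funext => x; elim: (l x) => //= a r ->.
comp_tac.
Qed.

Lemma c_filter (s : G -> A -> bool) (l : G -> seq A) :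
  computable (fun p : G * A => s p.1 p.2) -> computable l ->
  computable (fun x => filter (s x) (l x)).
Proof.
move=> sP lP; rewrite (_ : (fun x => _) =
  fun x => foldr (fun a r => if s x a then a :: r else r) [::] (l x)); last first.
  by apply: funext => x; elim: (l x) => //= a r ->.
comp_tac.
Qed.

Lemma c_cat (l r : G -> seq A) :
  computable l -> computable r -> computable (fun x => l x ++ r x).
Proof.
move=> lP rP; rewrite (_ : (fun x => _) =
  fun x => foldr (fun a r => a :: r) (r x) (l x)); last first.
  by apply: funext => x; elim: (l x) => //= a l' ->.
comp_tac.
Qed.

Lemma c_has (s : G -> A -> bool) (l : G -> seq A) :
  computable (fun p : G * A => s p.1 p.2) -> computable l ->
  computable (fun x => has (s x) (l x)).
Proof.
move=> sP lP; rewrite (_ : (fun x => _) =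
  fun x => foldr (fun a r => s x a || r) false (l x)); last first.
  by apply: funext => x; elim: (l x) => //= a r ->.
comp_tac.
Qed.

Lemma c_all (s : G -> A -> bool) (l : G -> seq A) :
  computable (fun p : G * A => s p.1 p.2) -> computable l ->
  computable (fun x => all (s x) (l x)).
Proof.
move=> sP lP; rewrite (_ : (fun x => _) =
  fun x => foldr (fun a r => s x a && r) true (l x)); last first.
  by apply: funext => x; elim: (l x) => //= a r ->.
comp_tac.
Qed.

Lemma c_count (s : G -> A -> bool) (l : G -> seq A) :
  computable (fun p : G * A => s p.1 p.2) -> computable l ->
  computable (fun x => count (s x) (l x)).
Proof.
move=> sP lP; rewrite (_ : (fun x => _) =
  fun x => foldr (fun a r => if s x a then r.+1 else r) 0 (l x)); last first.
  by apply: funext => x; elim: (l x) => //= a r ->; case: (s x a).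
comp_tac.
Qed.

Lemma c_nseq (n : G -> nat) (a : G -> A) :
  computable n -> computable a -> computable (fun x => nseq (n x) (a x)).
Proof.
move=> nP aP; rewrite (_ : (fun x => _) =
  fun x => iter (n x) (fun r => a x :: r) [::]) //; comp_tac.
Qed.

End Derived.
#[global] Hint Resolve c_map c_filter c_cat c_has c_all c_count c_nseq : comp.

Section Derived.
Context {G A B C : Type} {g : encodable G} {ea : encodable A}
  {eb : encodable B} {ec : encodable C}.
Lemma c_int_signs (n : G -> int) :
  computable n -> computable (fun x => int_signs (n x)).
Proof.
move=> [c cP].
(* An integer has the same tree as the pair of its sign bit and the argument of its constructor. *)
pose dec (p : bool * nat) := if p.1 then true :: nseq p.2 true else nseq p.2 false.
have [d dP] : computable dec by rewrite /dec; comp_tac.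
exists (Seq c d) => O x; apply: exec_seq (cP O x) _.
by case: (n x) => k; [have := dP O (false, k) | have := dP O (true, k)].
Qed.

Lemma c_flatten (l : G -> seq (seq A)) :
  computable l -> computable (fun x => flatten (l x)).
Proof. move=> lP; rewrite /flatten; comp_tac. Qed.

End Derived.
#[global] Hint Resolve c_int_signs c_flatten : comp.

(* Depth-first run of a branching process whose state [s] has the outputs
   [(step s).1] and the successor states [(step s).2]. *)
Inductive runs (S O : Type) (step : S -> seq O * seq S) :
    seq S -> seq O -> Prop :=
  | runs_nil : runs step [::] [::]
  | runs_cons s l o : runs step ((step s).2 ++ l) o ->
      runs step (s :: l) ((step s).1 ++ o).

Definition child_of (S O : Type) (step : S -> seq O * seq S) (t s : S) : Prop :=
  List.In t (step s).2.

(** Pushing an accessible state onto a stack that has a run gives a stack that has a run: by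
    well-founded induction its successors can be pushed one after the other. The stack [l] is then
    built from the bottom. *)
Lemma runs_total (S O : Type) (step : S -> seq O * seq S) (l : seq S) :
  (forall s, List.In s l -> Acc (child_of step) s) -> exists o, runs step l o.
Proof.
suff H : forall s, Acc (child_of step) s -> forall l,
    (exists o, runs step l o) -> exists o, runs step (s :: l) o.
  elim: l => [|s l IH] lP; first by exists [::]; constructor.
  apply: H; first by apply: (lP); left.
  by apply: IH => t tl; apply: lP; right.
move=> s; elim=> {}s _ IH {}l lP.
suff [o oP] : exists o, runs step ((step s).2 ++ l) o.
  by exists ((step s).1 ++ o); constructor.
move: IH; rewrite /child_of; elim: (step s).2 => [_ //|t r IHr IH] /=.
apply: (IH); first by left.
by apply: IHr => u ur; apply: IH; right.
Qed.

(* The loop runs on [Node l acc], where [acc] collects the outputs in reverse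
   order. *)
Lemma exec_runs (S O : Type) (es : encodable S) (eo : encodable O)
    (step : S -> seq O * seq S) : computable step ->
  exists c, forall (Or : oracle) l o, runs step l o ->
    exec Or c (encode l) (encode o).
Proof.
move=> [st stP].
have [c cP] : computable (fun p : seq S * seq O * (seq O * seq S) =>
    (p.2.2 ++ behead p.1.1, rev p.2.1 ++ p.1.2)) by comp_tac.
have [d dP] : computable (fun p : seq S * seq O => rev p.2) by comp_tac.
pose body := Seq (Defs.Cons Id (Seq (Seq Hd Hd) st)) c.
exists (Seq (Seq (Defs.Cons Id Const_leaf) (While Hd body)) d) => Or l o lo.
apply: (@exec_seq _ _ _ _ (encode ([::] : seq S, rev o))); last first.
  by have := dP Or ([::] : seq S, rev o); rewrite /= revK.
apply: (@exec_seq _ _ _ _ (encode (l, [::] : seq O))).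
  by repeat constructor.
rewrite -[rev o]cats0.
elim: lo ([::] : seq O) => [|s r o' _ IH] acc.
  by apply: exec_while_stop; constructor.
have e : exec Or Hd (encode (s :: r, acc)) (Node (encode s) (encode r)).
  exact: (exec_hd _ (Node (encode (s :: r)) (encode acc))).
apply: exec_while_step e _ _; last by rewrite rev_cat -catA; exact: IH.
apply: (@exec_seq _ _ _ _ (encode ((s :: r, acc), step s))); last first.
  exact: (cP Or ((s :: r, acc), step s)).
constructor; first exact: exec_id.
apply: exec_seq; last exact: stP.
by apply: exec_seq; [exact: (exec_hd _ (Node (encode (s :: r)) (encode acc)))
  | exact: (exec_hd _ (Node (encode s) (encode r)))].
Qed.

Lemma runs_inv (S O : Type) (step : S -> seq O * seq S) (P : S -> Prop) (Q : O -> Prop) :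
  (forall s, P s -> (forall o, List.In o (step s).1 -> Q o) /\
                    (forall s', List.In s' (step s).2 -> P s')) ->
  forall l o, runs step l o -> (forall s, List.In s l -> P s) ->
  forall x, List.In x o -> Q x.
Proof.
move=> H l o; elim=> [|s {}l {}o _ IH] inv x //.
have [h1 h2] := H s (inv s (or_introl (erefl _))).
move=> /List.in_app_iff[|xo]; first exact: h1.
apply: IH xo => s' /List.in_app_iff[|s'l]; first exact: h2.
by apply: inv; right.
Qed.

(** * Differential polynomials *)

(* [(true, (a, b))] stands for the derivative of the unknown by [d_x^a d_y^b],
   [(false, (0, _))] for x and [(false, (a.+1, _))] for y. *)
Definition var := (bool * (nat * nat))%type.

(* Lists of signed monomials in x, y and the derivatives of the unknown; equal
   monomials are never merged. *)
Definition pol := seq (bool * seq var).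

Definition pone : pol := [:: (false, [::])].
Definition pvar (v : var) : pol := [:: (false, [:: v])].
Definition pneg (p : pol) : pol := [seq (~~ m.1, m.2) | m <- p].
Definition pmul (p q : pol) : pol :=
  flatten [seq [seq (m.1 (+) n.1, m.2 ++ n.2) | n <- q] | m <- p].
Definition pmulv (v : var) (e : nat) (p : pol) : pol :=
  [seq (m.1, nseq e v ++ m.2) | m <- p].

(** Leibniz rule in a single fold: the derivative of the head is multiplied by the tail, so the tail
    is rebuilt alongside its derivative. *)
Definition dmon (dv : var -> pol) (vs : seq var) : seq var * pol :=
  foldr (fun v acc => (v :: acc.1,
    [seq (m.1, m.2 ++ acc.1) | m <- dv v] ++
    [seq (m.1, v :: m.2) | m <- acc.2])) ([::], [::]) vs.
(** The derivation with prescribed values on the variables; it yields d_x and d_y, the separant, and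
    the part of d_x or d_y that ignores one variable. *)
Definition pder (dv : var -> pol) (p : pol) : pol :=
  flatten [seq [seq (m.1 (+) n.1, n.2) | n <- (dmon dv m.2).2] | m <- p].

(* [false] is the direction x, [true] is y. *)
Definition bump (i : bool) (t : nat * nat) : nat * nat :=
  if i then (t.1, t.2.+1) else (t.1.+1, t.2).
Definition dvar (i : bool) (v : var) : pol :=
  if v.1 then pvar (true, bump i v.2)
  else if i (+) (0 < v.2.1) then [::] else pone.
Definition pD (i : bool) (p : pol) : pol := pder (dvar i) p.

(* An injective numbering of the derivatives compatible with differentiation. *)
Definition pos (t : nat * nat) : nat := (t.1 + t.2) * (t.1 + t.2) + t.1.
(** Rank 0 is shared by x and y, which count as constants; the unknown itself has rank 1. *)
Definition rk (v : var) : nat := if v.1 then (pos v.2).+1 else 0.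
Definition deg (v : var) (vs : seq var) : nat := count (fun w => rk w == rk v) vs.

Definition coefp (v : var) (e : nat) (p : pol) : pol :=
  [seq (m.1, [seq w <- m.2 | rk w != rk v]) | m <- [seq m <- p | deg v m.2 == e]].
Definition tailp (v : var) (e : nat) (p : pol) : pol :=
  [seq m <- p | deg v m.2 != e].
Definition sep (v : var) (p : pol) : pol :=
  pder (fun w => if rk w == rk v then pone else [::]) p.
(* The derivative in direction [i] that treats [v] as a constant. *)
Definition pDpart (v : var) (i : bool) (p : pol) : pol :=
  pder (fun w => if rk w == rk v then [::] else dvar i w) p.
(** Euler's combination [e * p - v * dp/dv], written without its cancelling terms. Where the
    separant vanishes it equals [e * p], yet its degree in [v] is lower: it replaces [p] in that
    case. *)
Definition euler (v : var) (e : nat) (p : pol) : pol :=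
  flatten [seq nseq (e - deg v m.2) m | m <- p].

Definition x0 : var := (false, (0, 0)).
Definition lvar (p : pol) : var :=
  foldr (fun m b => foldr (fun v b => if rk b < rk v then v else b) b m.2) x0 p.
(** A syntactic degree: the monomials that attain it may cancel. *)
Definition pdeg (v : var) (p : pol) : nat :=
  foldr (fun m b => maxn (deg v m.2) b) 0 p.

(** With s the total order, [pos] lies between s^2 and s^2 + s, hence below (s+1)^2: the numbering
    is graded. *)
Lemma pos_sum t u : pos t <= pos u -> t.1 + t.2 <= u.1 + u.2.
Proof.
move=> e; rewrite leqNgt; apply/negP => h; have := leq_mul h h.
by move: e; rewrite /pos mulSn mulnS; lia.
Qed.

Lemma pos_inj : injective pos.
Proof.
move=> t u e; have st : t.1 + t.2 = u.1 + u.2.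
  by apply/eqP; rewrite eqn_leq !pos_sum ?e.
have ac : t.1 = u.1 by move: e; rewrite /pos st; lia.
by case: t u st ac {e} => [a b] [c d] /= st ac; congr pair; lia.
Qed.

Lemma pos_bump i t u : pos t < pos u -> pos (bump i t) < pos (bump i u).
Proof.
move=> e; have := pos_sum (ltnW e); move: e.
case: t u => [a b] [c d]; rewrite /pos /bump; case: i => /=; nia.
Qed.

Lemma ltn_pos_bump i t : pos t < pos (bump i t).
Proof. by case: t i => [a b] [] /=; rewrite /pos /=; nia. Qed.

Lemma rk_jet v w : 0 < rk v -> rk w = rk v -> w = v.
Proof.
case: v w => [[] t] [[] u] //= _ []; rewrite /rk /=.
by move=> [] /pos_inj ->.
Qed.

Definition allv (P : pred var) (p : pol) : bool := all (fun m => all P m.2) p.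

Lemma allv_cat P p q : allv P (p ++ q) = allv P p && allv P q.
Proof. exact: all_cat. Qed.

Lemma allv_sub (P Q : pred var) p :
  (forall v, P v -> Q v) -> allv P p -> allv Q p.
Proof. by move=> PQ; apply: sub_all => m; apply: sub_all. Qed.

Lemma allv_neg P p : allv P (pneg p) = allv P p.
Proof. by rewrite /allv all_map. Qed.

Lemma all_flatten T (a : pred T) (s : seq (seq T)) :
  all a (flatten s) = all (all a) s.
Proof. by elim: s => //= x s IH; rewrite all_cat IH. Qed.

Lemma allv_mul P p q : allv P p -> allv P q -> allv P (pmul p q).
Proof.
move=> hp hq; rewrite /allv all_flatten all_map.
apply: sub_all hp => m hm /=; rewrite all_map; apply: sub_all hq => n hn /=.
by rewrite all_cat hm.
Qed.

Lemma allv_mulv (P : pred var) v e p : P v -> allv P p -> allv P (pmulv v e p).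
Proof.
move=> hv; rewrite /allv all_map; apply: sub_all => m hm /=.
by rewrite all_cat hm all_nseq hv orbT.
Qed.

Lemma allv_coef P v e p : allv P p -> allv P (coefp v e p).
Proof.
move=> hp; rewrite /allv all_map; apply/allP => m; rewrite mem_filter => /andP[_ mp] /=.
by rewrite all_filter; apply: sub_all (allP hp _ mp) => w wP; apply/implyP => _.
Qed.

Lemma allv_tail P v e p : allv P p -> allv P (tailp v e p).
Proof. by move=> hp; rewrite /allv all_filter; apply: sub_all hp => m mP; apply/implyP => _. Qed.

Lemma allv_euler P v e p : allv P p -> allv P (euler v e p).
Proof.
move=> hp; rewrite /allv all_flatten all_map; apply: sub_all hp => m hm /=.
by rewrite all_nseq hm orbT.
Qed.

Lemma dmon1 dv vs : (dmon dv vs).1 = vs.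
Proof. by elim: vs => //= v vs ->. Qed.

Lemma allv_der (P Q : pred var) dv p :
  (forall v, P v -> allv Q (dv v)) -> (forall v, P v -> Q v) ->
  allv P p -> allv Q (pder dv p).
Proof.
move=> hdv PQ hp; rewrite /allv all_flatten all_map; apply: sub_all hp => m /= hm.
rewrite all_map (eq_all (a2 := fun n => all Q n.2)) //.
elim: m.2 hm => //= v vs IH /andP[hv hvs]; rewrite all_cat !all_map dmon1.
apply/andP; split.
  apply: sub_all (hdv _ hv) => n hn /=; rewrite all_cat hn.
  by apply: sub_all hvs.
by apply: sub_all (IH hvs) => n hn /=; rewrite PQ.
Qed.

Lemma lvar_max p : allv (fun w => rk w <= rk (lvar p)) p.
Proof.
have F vs b : all (fun w => rk w <= rk (foldr (fun v b => if rk b < rk v then v else b) b vs)) vs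
   && (rk b <= rk (foldr (fun v b => if rk b < rk v then v else b) b vs)).
  elim: vs => [|v vs /andP[/allP IH IHb]] /=; first by rewrite leqnn.
  set u := foldr _ _ _ in IH IHb *; case: ltnP => uv /=.
    rewrite leqnn (leq_trans IHb (ltnW uv)) /= andbT.
    by apply/allP => w /IH wu; apply: leq_trans wu (ltnW uv).
  by rewrite uv IHb andbT; apply/allP.
elim: p => //= m p IH; rewrite [lvar _]/= -/(lvar p).
have /andP[-> h] := F m.2 (lvar p); apply: allv_sub IH => v hv /=.
exact: leq_trans hv h.
Qed.

Lemma pdegP v p : all (fun m => deg v m.2 <= pdeg v p) p.
Proof.
elim: p => //= m p /allP IH; rewrite leq_maxl.
by apply/allP => n /IH /leq_trans; apply; rewrite leq_maxr.
Qed.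

Lemma pdeg_lvar p : 0 < rk (lvar p) -> 0 < pdeg (lvar p) p.
Proof.
move=> h; rewrite lt0n; apply/negP => /eqP e.
suff F (q : pol) (b : var) : (forall m, m \in q -> deg (lvar p) m.2 = 0) -> rk b != rk (lvar p) ->
  rk (foldr (fun m b => foldr (fun v b => if rk b < rk v then v else b) b m.2) b q)
     != rk (lvar p).
  have : rk (lvar p) != rk (lvar p); last by rewrite eqxx.
  apply: (F p x0) => [m /(allP (pdegP (lvar p) p))|]; last by rewrite neq_ltn h.
  by rewrite e leqn0 => /eqP.
set k := rk (lvar p) => hq hb; elim: q hq => //= m q IH hq.
have := hq m (mem_head _ _); rewrite /deg -/k.
have {}IH := IH (fun n nq => hq n (mem_behead (s := m :: q) nq)).
elim: m.2 => //= v vs IHv; case: eqP => // /eqP vk; rewrite add0n => /IHv {}IHv.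
by case: ifP.
Qed.

(* [bd k e p]: the rank of [p], as a pair (leading variable, degree in it), is
   at most [(k, e)]. *)
Definition bd (k e : nat) (p : pol) : bool :=
  all (fun m => all (fun w => rk w <= k) m.2 &&
                (count (fun w => rk w == k) m.2 <= e)) p.
Definition prk (p : pol) : nat * nat := (rk (lvar p), pdeg (lvar p) p).
Definition ltp (a b : nat * nat) : bool :=
  (a.1 < b.1) || ((a.1 == b.1) && (a.2 < b.2)).

Lemma ltp_wf : well_founded (fun a b : nat * nat => ltp a b).
Proof.
move=> [k e]; elim/ltn_ind: k e => k IHk; elim/ltn_ind => e IHe.
constructor=> -[k' e']; rewrite /ltp /= => /orP[lk|/andP[/eqP -> le]].
  exact: IHk.
exact: IHe.
Qed.

Lemma bd_ltp k e p : 0 < k -> bd k e p -> ltp (prk p) (k, e.+1).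
Proof.
move=> k0 hp; rewrite /ltp /prk /=.
have lk : rk (lvar p) <= k.
  have : allv (fun w => rk w <= k) p by apply: sub_all hp => m /andP[].
  rewrite /lvar; elim: p {hp} => //= m p IH /andP[hm {}/IH IH].
  elim: m.2 hm => //= v vs IHv /andP[hv /IHv {}IHv].
  by case: ltnP.
rewrite ltn_neqAle lk andbT; case: eqP => //= e1.
rewrite ltnS -/(pdeg (lvar p) p) /pdeg /deg e1.
elim: {lk e1} p hp => //= m p IH /andP[/andP[_ hm] /IH hp].
by rewrite geq_max hm.
Qed.

Lemma bd_cat k e p q : bd k e (p ++ q) = bd k e p && bd k e q.
Proof. exact: all_cat. Qed.

Lemma bd_neg k e p : bd k e (pneg p) = bd k e p.
Proof. by rewrite /bd all_map. Qed.

Lemma bd_mul k e e' p q : bd k e p -> bd k e' q -> bd k (e + e') (pmul p q).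
Proof.
move=> hp hq; rewrite /bd all_flatten all_map.
apply: sub_all hp => m /andP[m1 m2] /=; rewrite all_map.
apply: sub_all hq => n /andP[n1 n2] /=.
by rewrite all_cat m1 n1 count_cat leq_add.
Qed.

Lemma bd_mulv v e e' p : bd (rk v) e' p -> bd (rk v) (e + e') (pmulv v e p).
Proof.
rewrite /bd all_map; apply: sub_all => m /andP[m1 m2] /=.
by rewrite all_cat all_nseq leqnn orbT m1 count_cat count_nseq eqxx mul1n leq_add2l.
Qed.

Lemma bd_lt k p : allv (fun w => rk w < k) p -> bd k 0 p.
Proof.
apply: sub_all => m hm; apply/andP; split; first by apply: sub_all hm => w /ltnW.
rewrite leqn0 -[_ == 0]negbK -lt0n -has_count; apply/hasPn => w /(allP hm) h.
by rewrite neq_ltn h.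
Qed.

Lemma bdW k e e' p : e <= e' -> bd k e p -> bd k e' p.
Proof. by move=> h; apply: sub_all => m /andP[-> /leq_trans ->]. Qed.

Section Lead.
Variables (p : pol) (e : nat).
Hypothesis pe : pdeg (lvar p) p = e.+1.
Let v := lvar p.

Lemma bd_coef d : bd (rk v) 0 (coefp v d p).
Proof.
rewrite /bd all_map; apply/allP => m; rewrite mem_filter => /andP[_ mp] /=.
rewrite all_filter count_filter leqn0; apply/andP; split.
  by apply: sub_all (allP (lvar_max p) _ mp) => w wP; apply/implyP => _.
by rewrite -[_ == 0]negbK -lt0n -has_count; apply/hasPn => w _ /=; rewrite andbN.
Qed.

Lemma bd_tail : bd (rk v) e (tailp v e.+1 p).
Proof.
rewrite /bd all_filter; apply/allP => m mp; apply/implyP => h.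
rewrite (allP (lvar_max p) _ mp) -ltnS -/(deg v m.2) ltn_neqAle h.
by rewrite -pe (allP (pdegP _ _)).
Qed.

Lemma bd_euler : bd (rk v) e (euler v e.+1 p).
Proof.
rewrite /bd all_flatten all_map; apply/allP => m mp; rewrite /= all_nseq.
rewrite subn_eq0 (allP (lvar_max p) _ mp) /= -/(deg v m.2).
by case: ltnP => //=; rewrite ltnS => ->.
Qed.

Lemma bd_sep : bd (rk v) e (sep v p).
Proof.
rewrite /bd all_flatten all_map; apply/allP => m mp /=; rewrite all_map.
have := allP (lvar_max p) _ mp; have := allP (pdegP v p) _ mp; rewrite pe /deg -/v.
elim: m.2 e => //= w vs IH d; rewrite dmon1 all_cat !all_map => hd /andP[hw hvs].
case: eqVneq hd => [ew|ne] /= hd.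
  have {}hd : count (fun w0 => rk w0 == rk v) vs <= d by rewrite -ltnS.
  rewrite hvs hd /=; case: d hd => [|d] hd.
    (* The tail no longer contains [v]; its formal derivative must be the empty list and not just
       have value 0, since each of its monomials would get the factor [v] back. *)
    suff -> : (dmon (fun w0 => if rk w0 == rk v then pone else [::]) vs).2 = [::] by [].
    elim: vs hd {IH hvs} => //= u us IHu; case: eqP => //= _ h.
    by rewrite IHu.
  apply: sub_all (IH d hd hvs) => n /andP[/= n1 n2].
  by rewrite hw n1 ew eqxx.
apply: sub_all (IH d hd hvs) => n /andP[/= n1 n2].
by rewrite hw n1 (negPf ne).
Qed.

End Lead.

Local Open Scope ring_scope.

(** * Derivations and values of differential polynomials *)

Definition derivation (R : pzRingType) (d : R -> R) : Prop :=
  {morph d : a b / a + b} /\ forall a b, d (a * b) = d a * b + a * d b.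

Section Derivation.
Variables (R : pzRingType) (d : R -> R).
Hypothesis dP : derivation d.

Lemma derivD : {morph d : a b / a + b}. Proof. by case: dP. Qed.
Lemma derivM a b : d (a * b) = d a * b + a * d b. Proof. by case: dP. Qed.
Lemma deriv0 : d 0 = 0.
Proof. by apply: (addrI (d 0)); rewrite -derivD !addr0. Qed.
Lemma derivN : {morph d : a / - a}.
Proof. by move=> a; apply: (addrI (d a)); rewrite -derivD !subrr deriv0. Qed.
Lemma deriv1 : d 1 = 0.
Proof. by apply: (addrI (d 1)); rewrite addr0 -[in RHS](mulr1 1) derivM mulr1 mul1r. Qed.
Lemma deriv_sign (b : bool) : d ((-1) ^+ b) = 0.
Proof. by case: b; rewrite ?expr1 ?derivN deriv1 ?oppr0. Qed.
Lemma deriv_sum (I : Type) (r : seq I) (F : I -> R) :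
  d (\sum_(i <- r) F i) = \sum_(i <- r) d (F i).
Proof. exact: (big_morph d derivD deriv0). Qed.
End Derivation.

Section Value.
Variables (R : comNzRingType) (rho : var -> R).

Definition mval (m : bool * seq var) : R :=
  (-1) ^+ m.1 * \prod_(v <- m.2) rho v.
Definition pval (p : pol) : R := \sum_(m <- p) mval m.

Lemma pval_nil : pval [::] = 0. Proof. exact: big_nil. Qed.
Lemma pval_cat p q : pval (p ++ q) = pval p + pval q.
Proof. exact: big_cat. Qed.
Lemma pval_one : pval pone = 1.
Proof. by rewrite /pval big_seq1 /mval big_nil mulr1. Qed.
Lemma pval_var v : pval (pvar v) = rho v.
Proof. by rewrite /pval big_seq1 /mval big_seq1 mul1r. Qed.
Lemma pval_neg p : pval (pneg p) = - pval p.
Proof.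
rewrite /pval big_map -sumrN; apply: eq_bigr => m _; rewrite /mval /= signrN.
by rewrite mulNr.
Qed.
Lemma pval_flatten (l : seq pol) : pval (flatten l) = \sum_(p <- l) pval p.
Proof.
by elim: l => [|p l IH]; rewrite ?big_nil ?pval_nil // big_cons -IH -pval_cat.
Qed.
Lemma pval_mul p q : pval (pmul p q) = pval p * pval q.
Proof.
rewrite pval_flatten big_map /pval mulr_suml; apply: eq_bigr => m _.
rewrite big_map mulr_sumr; apply: eq_bigr => n _.
by rewrite /mval /= signr_addb big_cat mulrACA.
Qed.
Lemma pval_mulv v e p : pval (pmulv v e p) = rho v ^+ e * pval p.
Proof.
rewrite /pval big_map mulr_sumr; apply: eq_bigr => m _.
by rewrite /mval /= big_cat big_nseq iter_mulr_1 /= mulrCA.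
Qed.

(** Value of the derivative of a monomial when the derivatives of the variables have the values [f].
    Formal derivation followed by evaluation and evaluation followed by derivation both take this
    form ([pval_der], [der_pval]), so they need only be compared on variables. *)
Fixpoint dlist (f : var -> R) (vs : seq var) : R :=
  if vs is v :: vs' then f v * \prod_(w <- vs') rho w + rho v * dlist f vs'
  else 0.
Definition dsem (f : var -> R) (p : pol) : R :=
  \sum_(m <- p) (-1) ^+ m.1 * dlist f m.2.

Lemma pval_der dv p : pval (pder dv p) = dsem (fun v => pval (dv v)) p.
Proof.
rewrite pval_flatten big_map; apply: eq_bigr => m _.
rewrite -[X in _ = _ * X](_ : pval (dmon dv m.2).2 = _).
  rewrite /pval big_map mulr_sumr; apply: eq_bigr => n _.
  by rewrite /mval /= signr_addb mulrA.
elim: m.2 => [|v vs IH]; first exact: pval_nil.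
rewrite /= dmon1 pval_cat -IH; congr (_ + _).
  rewrite /pval big_map mulr_suml; apply: eq_bigr => n _.
  by rewrite /mval big_cat mulrA.
rewrite /pval big_map mulr_sumr; apply: eq_bigr => n _.
by rewrite /mval big_cons mulrCA.
Qed.

Lemma der_pval d p : derivation d -> d (pval p) = dsem (fun v => d (rho v)) p.
Proof.
move=> dP; rewrite deriv_sum //; apply: eq_bigr => m _.
rewrite derivM // deriv_sign // mul0r add0r; congr (_ * _).
elim: m.2 => [|v vs IH] /=; first by rewrite big_nil deriv1.
by rewrite big_cons derivM // IH.
Qed.

(** With [h] the indicator of [v] and [c] the derivative of [v], this linearity is the chain rule
    that isolates the separant in [pval_Dpart]. *)
Lemma dsem_lin (P : pred var) f g h c p :
  (forall v, P v -> f v = g v + h v * c) -> allv P p ->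
  dsem f p = dsem g p + dsem h p * c.
Proof.
move=> E; elim: p => [|m p IH] /=; first by rewrite /dsem !big_nil mul0r addr0.
move=> /andP[mP /IH {}IH].
rewrite /dsem !big_cons -![\sum_(i <- p) _]/(dsem _ p) IH.
suff -> : dlist f m.2 = dlist g m.2 + dlist h m.2 * c by ring.
elim: m.2 mP => /= [_|v vs IHv /andP[/E -> /IHv ->]]; first by ring.
by ring.
Qed.

Lemma dsem_ext (P : pred var) f g p :
  (forall v, P v -> f v = g v) -> allv P p -> dsem f p = dsem g p.
Proof.
move=> E pP; rewrite (@dsem_lin P f g (fun _ => 0) 0 p) //.
  by rewrite mulr0 addr0.
by move=> v /E ->; rewrite mulr0 addr0.
Qed.

(** Positive rank matters: [deg] counts by rank, and rank 0 would confuse x with y. *)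
Lemma pval_coef_tail v e p : (0 < rk v)%N ->
  pval p = pval (coefp v e p) * rho v ^+ e + pval (tailp v e p).
Proof.
move=> v0; rewrite /pval big_map /tailp !big_filter (bigID (fun m => deg v m.2 == e)) /=.
congr (_ + _); rewrite mulr_suml; apply: eq_bigr => m /eqP <-.
rewrite /mval -mulrA; congr (_ * _); rewrite /deg /= big_filter.
elim: m.2 => [|w vs IH] /=; first by rewrite !big_nil mulr1.
rewrite !big_cons IH; case: eqP => [/(rk_jet v0) ->|_] /=.
  by rewrite add1n exprS mulrCA.
by rewrite add0n mulrA.
Qed.

Lemma pval_sep v p : (0 < rk v)%N ->
  pval (sep v p) = dsem (fun w => (w == v)%:R) p.
Proof.
move=> v0; rewrite pval_der; apply: (@dsem_ext predT) => [w _|]; last first.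
  by apply/allP => m _; apply/allP.
case: eqP => [/(rk_jet v0) ->|ne]; first by rewrite eqxx pval_one.
by case: eqP ne => [-> //|_ _]; rewrite pval_nil.
Qed.

Lemma pval_euler v e p : (0 < rk v)%N -> all (fun m => deg v m.2 <= e)%N p ->
  pval (euler v e p) = e%:R * pval p - rho v * pval (sep v p).
Proof.
move=> v0 he; rewrite pval_sep // pval_flatten big_map /pval /dsem !mulr_sumr -sumrB.
rewrite !big_seq; apply: eq_bigr => m /(allP he) {}he.
rewrite -/(pval _) /pval big_nseq iter_addr_0 -[LHS]mulr_natl natrB // mulrBl.
congr (_ - _); rewrite /mval mulrCA [RHS]mulrCA; congr (_ * _).
rewrite /deg {he}; elim: m.2 => [|w vs IH] /=; first by rewrite mul0r mulr0.
rewrite natrD mulrDl big_cons [X in _ + X = _]mulrCA IH mulrDr.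
case: (eqVneq w v) => [->|ne]; first by rewrite eqxx; ring.
by case: (rk w =P rk v) ne => [/(rk_jet v0) ->|_ _]; [rewrite eqxx | rewrite /=; ring].
Qed.

Lemma pval_D i d p : derivation d -> (forall v, d (rho v) = pval (dvar i v)) ->
  pval (pD i p) = d (pval p).
Proof.
move=> dP E; rewrite pval_der der_pval //; apply: (@dsem_ext predT) => //.
by apply/allP => m _; apply/allP.
Qed.

Lemma pval_Dpart v i d p : derivation d -> (0 < rk v)%N ->
  (forall v, d (rho v) = pval (dvar i v)) ->
  d (pval p) = pval (sep v p) * rho (true, bump i v.2) + pval (pDpart v i p).
Proof.
move=> dP v0 E; rewrite pval_sep // pval_der der_pval // addrC.
apply: (@dsem_lin predT) => [w _|]; last by apply/allP => m _; apply/allP.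
case: eqP => [/(rk_jet v0) ->|ne].
  rewrite eqxx pval_nil add0r mul1r E /dvar.
  by case: (v) v0 => [[] ?] //= _; rewrite pval_var.
by case: eqP ne => [-> //|_ _]; rewrite E mul0r addr0.
Qed.

End Value.

Lemma pval_morph (R S : comNzRingType) (u : {rmorphism R -> S}) (rho : var -> R) p :
  u (pval rho p) = pval (u \o rho) p.
Proof.
rewrite rmorph_sum; apply: eq_bigr => m _; rewrite rmorphM rmorph_sign.
by rewrite rmorph_prod.
Qed.

(** * Elimination of one unknown *)

Local Close Scope ring_scope.

Definition xdeg (vs : seq var) : nat := count (fun v => ~~ v.1 && ~~ (0 < v.2.1)) vs.
Definition ydeg (vs : seq var) : nat := count (fun v => ~~ v.1 && (0 < v.2.1)) vs.
Definition same_xy (vs ws : seq var) : bool :=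
  (xdeg vs == xdeg ws) && (ydeg vs == ydeg ws).

(* Meaningful only if no derivative of the unknown occurs in [p]. *)
Definition iszero (p : pol) : bool :=
  all (fun m => count (fun n => same_xy m.2 n.2 && n.1) p ==
                count (fun n => same_xy m.2 n.2 && ~~ n.1) p) p.

(** Differentiates the relation [s * u_w + t = 0]: the new remainder is [s' * u_w + t'] and the
    index [w] moves one step. *)
Definition dstep (s : pol) (i : bool) (tw : pol * (nat * nat)) : pol * (nat * nat) :=
  (pmulv (true, tw.2) 1 (pD i s) ++ pD i tw.1, bump i tw.2).

(* The pair [(t, w)] such that the derivative of [r] of order [d <> 0] is
   [sep v r * w + t], where [v] is the leading variable of [r]. *)
Definition dshift (r : pol) (v : var) (d : nat * nat) : pol * (nat * nat) :=
  if 0 < d.1 then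
    iter d.2 (dstep (sep v r) true)
      (iter d.1.-1 (dstep (sep v r) false) (pDpart v false r, bump false v.2))
  else iter d.2.-1 (dstep (sep v r) true) (pDpart v true r, bump true v.2).

Definition reducible (r p : pol) : bool :=
  (0 < rk (lvar r)) && ~~ ltp (prk p) (prk r).

(** For [p = c * v^(d+e) + t] and [r = s * v^d + t'] this is [s * p - c * v^e * r] with the two
    leading products left out. Kept in the list, they would cancel in value but the rank would not
    drop. *)
Definition cancel (s c t t' : pol) (v : var) (e : nat) : pol :=
  pmul s t ++ pneg (pmul c (pmulv v e t')).

(* One step of pseudo-reduction of the leading monomials of [p] by [r] or by a
   proper derivative of [r]. *)
Definition red (r p : pol) : pol :=
  let v := lvar r in let w := lvar p in let d := pdeg v r in let e := pdeg w p in
  if rk v == rk w then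
    cancel (coefp v d r) (coefp w e p) (tailp w e p) (tailp v d r) w (e - d)
  else if (v.2.1 <= w.2.1) && (v.2.2 <= w.2.2) then
    cancel (sep v r) (coefp w e p) (tailp w e p)
      (dshift r v (w.2.1 - v.2.1, w.2.2 - v.2.2)).1 w e.-1
  else [::].

(* [(r, (l, q))] stands for [r = 0], [p = 0] for [p] in [l], [q <> 0]; if [r]
   involves the unknown, then its initial and its separant divide [q]. *)
Definition estate := (pol * (seq pol * pol))%type.

(** An irreducible [p] that involves the unknown is split in three: its initial vanishes, its
    separant vanishes, or neither does. In the last case [p] becomes the pivot, and the old pivot,
    of higher rank, returns to the list to be reduced by it. *)
Definition estep (s : estate) : seq (pol * pol) * seq estate :=
  let p := head [::] s.2.1 in let l := behead s.2.1 in let q := s.2.2 in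
  let v := lvar p in let e := pdeg v p in
  if nilp s.2.1 then ([:: (s.1, q)], [::])
  else if ~~ (0 < rk v) then ([::], if iszero p then [:: (s.1, (l, q))] else [::])
  else if reducible s.1 p then ([::], [:: (s.1, (red s.1 p :: l, q))])
  else ([::],
    [:: (s.1, (coefp v e p :: tailp v e p :: l, q));
        (s.1, (sep v p :: euler v e p :: l, q));
        (p, (s.1 :: l, pmul q (pmul (coefp v e p) (sep v p))))]).

(* A polynomial with a flag telling whether it has been raised to the power. *)
Definition nstate := ((pol * pol) * bool)%type.

Definition pexp (p : pol) (n : nat) : pol := iter n (pmul p) pone.

(* Normal forms modulo [r]: reduce [q], raise the result to the power [deg r],
   and reduce again. *)
Definition nstep (s : nstate) : seq (pol * pol) * seq nstate :=
  let r := s.1.1 in let q := s.1.2 in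
  if reducible r q then ([::], [:: ((r, red r q), s.2)])
  else if s.2 then ([:: s.1], [::])
  else ([::], [:: ((r, pexp q (pdeg (lvar r) r)), true)]).

Lemma bd_cancel k a b c d s t c' t' v :
  rk v = k -> bd k a s -> bd k b t -> bd k 0 c' -> bd k c t' ->
  a + b <= d -> forall e, e + c <= d -> bd k d (cancel s c' t t' v e).
Proof.
move=> <- hs ht hc ht' ab e ec; rewrite bd_cat bd_neg; apply/andP; split.
  exact: bdW ab (bd_mul hs ht).
by apply: (bdW ec); rewrite -[e + c]add0n; apply/bd_mul/bd_mulv.
Qed.

Lemma allv_dvar i t v : rk v < rk (true, t) ->
  allv (fun w => rk w < rk (true, bump i t)) (dvar i v).
Proof.
case: v => [[] u]; rewrite /rk /dvar /=; last by case: ifP.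
by rewrite ltnS => h; rewrite /allv /= /rk /= ltnS pos_bump.
Qed.

Lemma allv_D i t p : allv (fun w => rk w < rk (true, t)) p ->
  allv (fun w => rk w < rk (true, bump i t)) (pD i p).
Proof.
apply: allv_der => v; first exact: allv_dvar.
move=> /leq_trans; apply; rewrite /rk /= ltnS ltnW //; exact: ltn_pos_bump.
Qed.

Definition dbelow (tw : pol * (nat * nat)) : bool :=
  allv (fun w => rk w < rk (true, tw.2)) tw.1.

Lemma dstep_below s i tw : allv (fun w => rk w < rk (true, tw.2)) s ->
  dbelow tw -> dbelow (dstep s i tw).
Proof.
move=> hs ht; rewrite /dbelow /dstep /= allv_cat allv_D // andbT.
by apply: allv_mulv; [exact: ltn_pos_bump | exact: allv_D].
Qed.

Lemma iter_bump i n t :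
  iter n (bump i) t = if i then (t.1, n + t.2) else (n + t.1, t.2).
Proof. by case: t => a b; case: i; elim: n => //= n ->. Qed.

Lemma iter_dstep s i n tw : allv (fun w => rk w < rk (true, tw.2)) s ->
  dbelow tw -> dbelow (iter n (dstep s i) tw) /\
  (iter n (dstep s i) tw).2 = iter n (bump i) tw.2 /\
  allv (fun w => rk w < rk (true, (iter n (dstep s i) tw).2)) s.
Proof.
move=> hs ht; elim: n => //= n [h1 [h2 h3]]; split; first exact: dstep_below.
split; first by rewrite h2.
apply: allv_sub h3 => v /leq_trans; apply; rewrite /rk /= ltnS ltnW //.
exact: ltn_pos_bump.
Qed.

(** A proper derivative of [r] is linear in its leading variable, with the separant as coefficient:
    every other variable has smaller rank, because differentiation preserves the order of ranks. *)
Lemma dshiftP r d : 0 < rk (lvar r) -> d != (0, 0) ->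
  let tw := dshift r (lvar r) d in
  dbelow tw /\ tw.2 = ((lvar r).2.1 + d.1, (lvar r).2.2 + d.2).
Proof.
move: (lvar_max r) => hr; move: (lvar r) hr => [[] v] hr // _ d0 /=.
have lt i w : rk w <= rk (true, v) -> rk w < rk (true, bump i v).
  by move=> /leq_ltn_trans; apply; rewrite /rk /= ltnS; exact: ltn_pos_bump.
have hs i : allv (fun w => rk w < rk (true, bump i v)) (sep (true, v) r).
  apply: allv_der hr => w; last exact: lt.
  by case: ifP.
have hp i : dbelow (pDpart (true, v) i r, bump i v).
  apply: allv_der hr => w; last exact: lt.
  case: ifP => // /eqP ne hw; apply: allv_dvar.
  by rewrite ltn_neqAle hw andbT; apply/eqP.
rewrite /dshift; case: ifP => d1.
  have [h1 [h2 h3]] := iter_dstep false d.1.-1 (tw := (_, bump false v)) (hs false) (hp false).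
  have [k1 [k2 _]] := iter_dstep true d.2 h3 h1.
  split => //; rewrite k2 h2 !iter_bump /=.
  by congr pair; lia.
have [k1 [k2 _]] := iter_dstep true d.2.-1 (tw := (_, bump true v)) (hs true) (hp true).
split => //; rewrite k2 iter_bump /=; move: d0 d1; clear.
by case: d => [[|//] [|n]] //= _ _; congr pair; lia.
Qed.

(** If the leading variables agree, the degree drops. Otherwise the derivative of [r] used is linear
    in the leading variable of [p], and its multiple by the power [e.-1] removes the top degree. The
    remaining branch of [red] returns 0. *)
Lemma red_lt r p : reducible r p -> ltp (prk (red r p)) (prk p).
Proof.
move=> /andP[r0]; rewrite {1}/ltp negb_or -leqNgt negb_and => /andP[le he].
have p0 : 0 < rk (lvar p) by exact: leq_trans le.
have := pdeg_lvar p0; rewrite {2}/prk; case E : pdeg => [//|e] _.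
have := pdeg_lvar r0; case D : pdeg => [//|d] _.
rewrite /red E D; case: eqP => [ev|ne].
  have vw : lvar p = lvar r by apply: rk_jet.
  move: he; rewrite /= -ev eqxx -leqNgt /prk /= E D ltnS => de.
  apply: bd_ltp => //; apply: (@bd_cancel _ 0 e d e) => //.
  - exact: bd_coef.
  - by rewrite ev; apply: bd_tail.
  - by rewrite ev; apply: bd_coef.
  - exact: bd_tail.
  - by rewrite subSS subnK.
have lt : rk (lvar r) < rk (lvar p) by rewrite ltn_neqAle; move/eqP: ne => ->.
case: ifP => [/andP[h1 h2]|_]; last by rewrite /ltp p0.
have [] := dshiftP r0 (d := ((lvar p).2.1 - (lvar r).2.1, (lvar p).2.2 - (lvar r).2.2)).
  apply/eqP => -[/eqP k1 /eqP k2]; apply: ne; move: k1 k2 h1 h2 lt r0.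
  case: (lvar p) (lvar r) => [[] [a b]] [[] [a' b']] //=; rewrite !subn_eq0.
  move=> k1 k2 k3 k4 _ _; rewrite /rk /=; congr (pos _).+1; congr pair; lia.
rewrite /= !subnKC // => db ew.
have {ew}ew : (true, (dshift r (lvar r) ((lvar p).2.1 - (lvar r).2.1,
    (lvar p).2.2 - (lvar r).2.2)).2) = lvar p.
  by rewrite ew; case: (lvar p) p0 => [[] []].
apply: bd_ltp => //; apply: (@bd_cancel _ 0 e 0 e) => //.
- apply: bd_lt; apply: allv_der (lvar_max r) => w; last by move=> /leq_ltn_trans; apply.
  by case: ifP.
- exact: bd_tail.
- exact: bd_coef.
- by apply: bd_lt; move: db; rewrite /dbelow ew.
- by rewrite addn0.
Qed.

Lemma split_lt p : 0 < rk (lvar p) -> let v := lvar p in let e := pdeg v p in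
  [/\ ltp (prk (coefp v e p)) (prk p), ltp (prk (tailp v e p)) (prk p),
      ltp (prk (sep v p)) (prk p) & ltp (prk (euler v e p)) (prk p)].
Proof.
move=> p0 /=; have := pdeg_lvar p0; rewrite {2 4 6 8}/prk.
case E : pdeg => [//|e] _; split; apply: bd_ltp => //.
- exact: bdW (bd_coef _ _).
- exact: bd_tail.
- exact: bd_sep.
- exact: bd_euler.
Qed.

(** Three nested inductions: on the rank of the pivot, which drops at each replacement once
    positive; for a fixed pivot on the list; for a fixed tail on the rank of the head. Splitting may
    put two polynomials in place of the head, but both have smaller rank. A pivot without the
    unknown is replaced at most once before the first induction applies. *)
Lemma estep_acc s : Acc (child_of estep) s.
Proof.
have inner r :
    (forall p l q, 0 < rk (lvar p) -> ~~ reducible r p -> Acc (child_of estep) (p, (l, q))) ->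
    forall l q, Acc (child_of estep) (r, (l, q)).
  move=> H; elim=> [|p l IH] q; first by constructor=> s'.
  elim/(well_founded_ind ltp_wf): {p}(prk p) {-2}p (erefl (prk p)) l IH q
    => k IHp p ek l IH q.
  have {}IHp p' : ltp (prk p') (prk p) -> forall l,
      (forall q, Acc (child_of estep) (r, (l, q))) ->
      forall q, Acc (child_of estep) (r, (p' :: l, q)).
    by rewrite ek => lt; apply: IHp lt _ (erefl _).
  constructor=> s'; rewrite /child_of /estep /=.
  case: ifP => [_|/negbFE p0].
    case: (iszero p); last by case.
    case=> [<-|[]]; exact: IH.
  have [hc ht hs he] := split_lt p0.
  case: (boolP (reducible r p)) => rp.
    case=> [<-|[]]; exact: (IHp _ (red_lt rp) _ IH).
  case=> [<-|[<-|[<-|[]]]].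
  - exact: (IHp _ hc _ (IHp _ ht _ IH)).
  - exact: (IHp _ hs _ (IHp _ he _ IH)).
  - exact: H.
have some r : 0 < rk (lvar r) -> forall l q, Acc (child_of estep) (r, (l, q)).
  elim/(well_founded_ind ltp_wf): {r}(prk r) {-2}r (erefl (prk r)) => k IH r ek r0.
  apply: inner => p l q p0; rewrite /reducible r0 /= negbK => lt.
  by apply: (IH (prk p)) => //; rewrite -ek.
case: s => r [l q]; have [r0|r0] := ltnP 0 (rk (lvar r)); first exact: some.
by apply: inner => p l' q' p0 _; apply: some.
Qed.

(** The flag is raised only once, and between two values of the flag each reduction lowers the rank
    of [q]. *)
Lemma nstep_acc s : Acc (child_of nstep) s.
Proof.
have H r b q : (~~ b -> forall q, Acc (child_of nstep) ((r, q), true)) ->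
    Acc (child_of nstep) ((r, q), b).
  move=> Hb; elim/(well_founded_ind ltp_wf): {q}(prk q) {-2}q (erefl (prk q)) => k IH q ek.
  constructor=> s'; rewrite /child_of /nstep /=.
  case: ifP => [rq|_] /=.
    by case=> [<-|[]]; apply: (IH (prk (red r q))) (erefl _); rewrite -ek red_lt.
  case: b Hb {IH} => [_ []|Hb [<-|[]]]; exact: Hb.
by case: s => [[r q] b]; apply: (H) => _ q'; apply: (H).
Qed.

Local Open Scope ring_scope.

Section ElimSem.
Variables (K : fieldType) (rho : var -> K) (dl : bool -> K -> K) (oky : bool).
Hypothesis dlP : forall i, i ==> oky ->
  derivation (dl i) /\ forall v, dl i (rho v) = pval rho (dvar i v).
Hypothesis char0 : forall n, (n.+1)%:R != 0 :> K.
Hypothesis iszeroP : forall p, rk (lvar p) = 0%N -> iszero p = (pval rho p == 0).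

Let val := pval rho.

Definition onlyx (v : var) : bool := ~~ v.1 || (v.2.2 == 0)%N.
(** Two situations in which every leading variable of rank at least that of the pivot is a
    derivative of the pivot's leading variable, so that the default branch of [red] is never met:
    only x-derivatives occur (ordinary elimination), or the pivot is algebraic in the unknown. The
    second may differentiate in y, which [oky] allows. *)
Definition dirs (r : pol) (l : seq pol) : bool :=
  (allv onlyx r && all (allv onlyx) l) || ((rk (lvar r) == 1)%N && oky).
Definition lead_ok (r q : pol) : Prop :=
  (0 < rk (lvar r))%N -> val q != 0 ->
  val (coefp (lvar r) (pdeg (lvar r) r) r) != 0 /\ val (sep (lvar r) r) != 0.
Definition einv (s : estate) : Prop := dirs s.1 s.2.1 /\ lead_ok s.1 s.2.2.
Definition eholds (s : estate) : bool :=
  [&& val s.1 == 0, all (fun p => val p == 0) s.2.1 & val s.2.2 != 0].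
Definition oholds (o : pol * pol) : bool := (val o.1 == 0) && (val o.2 != 0).

Lemma val_cancel s c t t' v e :
  val (cancel s c t t' v e) = val s * val t - val c * (rho v ^+ e * val t').
Proof. by rewrite /val /cancel pval_cat pval_neg !pval_mul pval_mulv. Qed.

Lemma val_dstep s i tw : i ==> oky -> val s * rho (true, tw.2) + val tw.1 = 0 ->
  let tw' := dstep s i tw in val s * rho (true, tw'.2) + val tw'.1 = 0.
Proof.
move=> /dlP[dP vP] /(congr1 (dl i)); rewrite derivD // derivM // deriv0 //.
rewrite /val /= pval_cat pval_mulv expr1 !(pval_D _ dP vP) vP pval_var /= => <-.
by ring.
Qed.

Lemma val_iter_dstep s i n tw : i ==> oky -> val s * rho (true, tw.2) + val tw.1 = 0 ->
  let tw' := iter n (dstep s i) tw in val s * rho (true, tw'.2) + val tw'.1 = 0.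
Proof. by move=> ok E; elim: n => //= n IH; apply: val_dstep. Qed.

Lemma val_dshift r d : (0 < rk (lvar r))%N -> d != (0, 0)%N ->
  (0 < d.2)%N ==> oky -> val r = 0 ->
  let tw := dshift r (lvar r) d in
  val (sep (lvar r) r) * rho (true, tw.2) + val tw.1 = 0.
Proof.
move=> r0 d0 oy rv /=.
have st i : i ==> oky -> val (sep (lvar r) r) * rho (true, bump i (lvar r).2)
    + val (pDpart (lvar r) i r) = 0.
  move=> /dlP[dP vP]; have := congr1 (dl i) rv.
  by rewrite deriv0 // (pval_Dpart _ dP r0 vP).
rewrite /dshift; case: ifP => d1.
  have E := @val_iter_dstep _ false d.1.-1 (_, _) isT (st false isT).
  case: (d.2) oy => [_|n oy]; first exact: E.
  exact: (@val_iter_dstep _ true n.+1 _ oy E).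
case: d d0 oy d1 => [[|//] [|n]] //= _ oy _.
exact: (@val_iter_dstep _ true n (_, _) oy (st true oy)).
Qed.

Lemma val_split p : (0 < rk (lvar p))%N -> let v := lvar p in let e := pdeg v p in
  val p = val (coefp v e p) * rho v ^+ e + val (tailp v e p).
Proof. by move=> p0; apply: pval_coef_tail. Qed.

Lemma onlyx_lvar q : (0 < rk (lvar q))%N -> allv onlyx q -> (lvar q).2.2 = 0%N.
Proof.
move=> q0 qx; have := pdeg_lvar q0; rewrite lt0n => /eqP; apply: contra_notP => /eqP ne.
have : all (fun m => deg (lvar q) m.2 == 0)%N q.
  apply: sub_all qx => m mx; rewrite -leqn0 leqNgt -has_count; apply/hasPn => w.
  move=> /(allP mx); rewrite /onlyx; apply: contraL => /eqP /(rk_jet q0) ->.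
  by rewrite negb_or negbK ne andbT; case: (lvar q) q0 => [[]].
clear; move: (lvar q) => v; rewrite /pdeg; elim: q => //= m q IH.
by case/andP => /eqP -> /IH ->.
Qed.

Lemma onlyx_dirs r l p : dirs r (p :: l) -> (0 < rk (lvar r))%N ->
  ~~ ltp (prk p) (prk r) -> ((lvar r).2.1 <= (lvar p).2.1)%N /\
  ((lvar r).2.2 <= (lvar p).2.2)%N /\ ((0 < (lvar p).2.2 - (lvar r).2.2)%N ==> oky).
Proof.
case/orP=> [/andP[rx /andP[px _]]|/andP[/eqP r1 oky']] r0 np.
  have p0 : (0 < rk (lvar p))%N.
    by apply: leq_trans r0 _; rewrite leqNgt; apply: contra np; rewrite /ltp => ->.
  rewrite !onlyx_lvar //; split=> //.
  have : (rk (lvar r) <= rk (lvar p))%N.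
    by rewrite leqNgt; apply: contra np; rewrite /ltp => ->.
  have lr := onlyx_lvar r0 rx; have lp := onlyx_lvar p0 px; move: lr lp r0 p0; rewrite /rk.
  case: (lvar r) (lvar p) => [[] [a b]] [[] [c d]] //= -> -> _ _.
  by rewrite ltnS /pos /= !addn0 => h; nia.
have -> : lvar r = (true, (0, 0)%N) by apply/esym/rk_jet; rewrite ?r1.
by rewrite oky' implybT.
Qed.

(** Where [r] vanishes, reduction multiplies [p] by the initial of [r] or, if a proper derivative of
    [r] is used, by its separant. This is why both must divide the inequation [q]. *)
Lemma val_red r p l : dirs r (p :: l) -> reducible r p -> val r = 0 ->
  exists2 c, (val (coefp (lvar r) (pdeg (lvar r) r) r) != 0 ->
              val (sep (lvar r) r) != 0 -> c != 0) &
             val (red r p) = c * val p.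
Proof.
move=> dir /andP[r0 np] rv.
have [h1 [h2 h3]] := onlyx_dirs dir r0 np.
have le : (rk (lvar r) <= rk (lvar p))%N.
  by rewrite leqNgt; apply: contra np; rewrite /ltp => ->.
have p0 : (0 < rk (lvar p))%N := leq_trans r0 le.
have := val_split p0; have := pdeg_lvar p0.
rewrite /red; set e := pdeg (lvar p) p => e0 /= ->.
case: (eqVneq (rk (lvar r)) (rk (lvar p))) => [er|/eqP ne].
  have lvE : lvar p = lvar r by apply: rk_jet.
  have := val_split r0; rewrite rv /= -lvE.
  set d := pdeg _ r => /esym/eqP; rewrite addr_eq0 => /eqP tr.
  have de : (d <= e)%N.
    by move: np; rewrite /ltp /= er eqxx ltnn /= -leqNgt -lvE.
  exists (val (coefp (lvar r) (pdeg (lvar r) r) r)); first by rewrite -lvE.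
  rewrite val_cancel -lvE -/d (_ : val (tailp _ d r) = - (val (coefp (lvar p) d r)
    * rho (lvar p) ^+ d)); last by rewrite tr opprK.
  have -> : rho (lvar p) ^+ e = rho (lvar p) ^+ (e - d) * rho (lvar p) ^+ d.
    by rewrite -exprD subnK.
  by ring.
exists (val (sep (lvar r) r)) => //; rewrite h1 h2 val_cancel.
have dne : ((lvar p).2.1 - (lvar r).2.1, (lvar p).2.2 - (lvar r).2.2)%N != (0, 0)%N.
  apply/eqP => -[/eqP k1 /eqP k2]; apply: ne; move: k1 k2 h1 h2 le r0 p0.
  case: (lvar p) (lvar r) => [[] [a b]] [[] [a' b']] //=; rewrite !subn_eq0.
  move=> k1 k2 k3 k4 _ _ _; rewrite /rk /=; congr (pos _).+1; congr pair; lia.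
have [_ w2] := dshiftP r0 dne.
have := val_dshift r0 dne h3 rv; rewrite /= w2 /= !subnKC //.
rewrite (_ : (true, _) = lvar p); last by case: (lvar p) p0 => [[] []].
move/eqP; rewrite addrC addr_eq0 => /eqP ->.
have -> : rho (lvar p) ^+ e = rho (lvar p) * rho (lvar p) ^+ e.-1.
  by rewrite -exprS prednK.
by ring.
Qed.

Lemma onlyx_red r p : reducible r p -> allv onlyx r -> allv onlyx p ->
  allv onlyx (red r p).
Proof.
move=> /andP[r0 np] rx px; have rv := onlyx_lvar r0 rx.
have le : (rk (lvar r) <= rk (lvar p))%N.
  by rewrite leqNgt; apply: contra np; rewrite /ltp => ->.
have p0 : (0 < rk (lvar p))%N := leq_trans r0 le.
have pv := onlyx_lvar p0 px.
have canc a b c d w e : onlyx w -> allv onlyx a -> allv onlyx b -> allv onlyx c ->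
    allv onlyx d -> allv onlyx (cancel a b c d w e).
  move=> hw ha hb hc hd; rewrite allv_cat allv_neg !allv_mul //; exact: allv_mulv.
have lx : onlyx (lvar p) by rewrite /onlyx pv orbT.
have sx v : allv onlyx (sep v r).
  by apply: allv_der rx => // w _; case: ifP.
have dx w : onlyx w -> allv onlyx (dvar false w).
  by case: w => [[] [a b]]; rewrite /dvar /= ?andbT //= => _; case: ifP.
rewrite /red; case: eqP => [_|ne].
  by apply: canc => //; (exact: allv_coef || exact: allv_tail).
case: ifP => [/andP[h1 _]|//].
apply: canc; [by [] | exact: sx | exact: allv_coef | exact: allv_tail |].
have d1 : (0 < (lvar p).2.1 - (lvar r).2.1)%N.
  rewrite subn_gt0 ltn_neqAle h1 andbT; apply/eqP => e; apply: ne.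
  move: e rv pv r0 p0; case: (lvar p) (lvar r) => [[] [a b]] [[] [a' b']] //=.
  by move=> -> -> ->.
have H n tw : allv onlyx tw.1 -> tw.2.2 = 0%N ->
    let tw' := iter n (dstep (sep (lvar r) r) false) tw in
    allv onlyx tw'.1 /\ tw'.2.2 = 0%N.
  move=> h1' h2; elim: n => [|n [IH1 IH2]] //=.
  split=> //; rewrite allv_cat; apply/andP; split; last exact: allv_der IH1.
  by apply: allv_mulv; [rewrite /onlyx /= IH2 | exact: allv_der (sx _)].
rewrite /dshift /= d1 pv rv subnn; apply: (proj1 (H _ (_, _) _ _)) => //=.
by apply: allv_der rx => // w hw; case: ifP => // _; exact: dx.
Qed.

(** At a point where the initial vanishes, [p] has the value of its tail; where the separant
    vanishes, the Euler polynomial has the value [e * p], and [e] is invertible in characteristic 0.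
    Elsewhere [p] qualifies as a pivot. The cases may overlap, which a disjunction allows. *)
Lemma estep_holds s : einv s ->
  eholds s = has oholds (estep s).1 || has eholds (estep s).2.
Proof.
case: s => r [[|p l] q] [dir lok]; rewrite /eholds /estep /=.
  by rewrite /oholds /= !orbF.
case: ifP => [|/negbFE p0] /=.
  rewrite -eqn0Ngt => /eqP /iszeroP ->; rewrite -/(val p).
  by case: (val p == 0); rewrite /= ?orbF ?andbF.
case: (boolP (reducible r p)) => rp /=.
  rewrite orbF; case: eqP => //= rv; case: (eqVneq (val q) 0) => [|qv]; first by rewrite !andbF.
  have [iv sv] : val (coefp (lvar r) (pdeg (lvar r) r) r) != 0 /\ val (sep (lvar r) r) != 0.
    by apply: lok => //; case/andP: rp.
  have [c /(_ iv sv) c0 ->] := val_red dir rp rv.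
  by rewrite mulf_eq0 (negPf c0).
have := pval_euler rho p0 (pdegP (lvar p) p); have := val_split p0.
have := pdeg_lvar p0; set e := pdeg _ p => e0.
move=> /= pE eE.
have e1 : e%:R != 0 :> K by case: (e) e0 => // n _; exact: char0.
have -> : val (pmul q (pmul (coefp (lvar p) e p) (sep (lvar p) p))) =
  val q * (val (coefp (lvar p) e p) * val (sep (lvar p) p)).
  by rewrite /val !pval_mul.
move: pE eE; rewrite -/val; rewrite !mulf_eq0 !negb_or orbF.
case: (eqVneq (val (coefp _ _ p)) 0) => [->|c0] /=.
  rewrite mul0r add0r => pE; case: (eqVneq (val (sep _ p)) 0) => [->|s0] /=.
    rewrite mulr0 subr0 => ->; rewrite mulf_eq0 (negPf e1) /= -pE.
    by case: (val p == 0); case: (val r == 0); case: (all _ _); case: (val q == 0).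
  by move=> _; rewrite -pE; case: (val r == 0); rewrite /= ?andbF ?orbF.
move=> _; case: (eqVneq (val (sep _ p)) 0) => [->|s0] /=.
  rewrite mulr0 subr0 => ->; rewrite mulf_eq0 (negPf e1) /=.
  by case: (val r == 0); case: (val p == 0); case: (all _ _); case: (val q == 0).
by move=> _; case: (val r == 0); case: (val p == 0); rewrite /= ?andbF ?andbT ?orbF.
Qed.

Lemma estep_inv s : einv s ->
  (forall o, List.In o (estep s).1 -> lead_ok o.1 o.2) /\
  (forall s', List.In s' (estep s).2 -> einv s').
Proof.
case: s => r [[|p l] q] [dir lok]; rewrite /estep /=.
  by split=> // o [<-|[]].
case: ifP => [_|/negbFE p0] /=.
  split=> // s'; case: (iszero p) => [[<-|[]]|[]]; split=> //=.
  by case/orP: dir => /= [/and3P[h _ h']|h]; apply/orP; [left; rewrite h | right].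
case: (boolP (reducible r p)) => rp.
  split=> // s' [<-|[]]; split=> //=.
  case/orP: dir => /= [/and3P[h h1 h']|h]; apply/orP; [left | by right].
  by rewrite /= h h' onlyx_red.
split=> // s' [<-|[<-|[<-|[]]]]; split=> //=.
- case/orP: dir => /= [/and3P[h h1 h']|h]; apply/orP; [left | by right].
  by rewrite /= h h' allv_coef ?allv_tail.
- case/orP: dir => /= [/and3P[h h1 h']|h]; apply/orP; [left | by right].
  have sx : allv onlyx (sep (lvar p) p) by apply: allv_der h1 => // v _; case: ifP.
  by rewrite /= h h' sx allv_euler.
- case/orP: dir => /= [/and3P[h h1 h']|/andP[/eqP h oky']]; apply/orP; [left | right].
    by rewrite /= h h' h1.
  (* A polynomial that involves the unknown and ranks below a pivot of rank 1 is again led by the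
     unknown itself. *)
  move: rp; rewrite /reducible h /= negbK /ltp /= h oky' andbT ltnS leqn0.
  by rewrite eqn0Ngt p0 /= => /andP[].
- move=> _; rewrite /val !pval_mul !mulf_eq0 !negb_or => /and3P[_ h1 h2].
  by split.
Qed.

Lemma runs_estep l o : runs estep l o -> (forall s, List.In s l -> einv s) ->
  has eholds l = has oholds o /\ forall x, List.In x o -> lead_ok x.1 x.2.
Proof.
elim=> [|s {}l {}o _ IH] inv //.
have sI := inv s (or_introl (erefl _)).
have [h1 h2] := estep_inv sI.
have [|e1 e2] := IH.
  move=> s' /List.in_app_iff[|s'l]; first exact: h2.
  by apply: inv; right.
split; first by rewrite /= estep_holds // has_cat -e1 has_cat orbA.
by move=> x /List.in_app_iff[]; [exact: h1 | exact: e2].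
Qed.

End ElimSem.

(** * Janet bases *)

Local Close Scope ring_scope.

(* [(c, (a, b))] stands for [c d_x^a d_y^b]. *)
Definition op := seq (pol * (nat * nat)).

Definition oD (i : bool) (A : op) : op :=
  [seq (pD i c.1, c.2) | c <- A] ++ [seq (c.1, bump i c.2) | c <- A].
Definition oshift (s : nat * nat) (A : op) : op :=
  iter s.1 (oD false) (iter s.2 (oD true) A).
Definition oscale (p : pol) (A : op) : op := [seq (pmul p c.1, c.2) | c <- A].
Definition oneg (A : op) : op := [seq (pneg c.1, c.2) | c <- A].

Definition lmon (A : op) : nat * nat :=
  foldr (fun c b => if pos b < pos c.2 then c.2 else b) (0, 0) A.
Definition ocoef (t : nat * nat) (A : op) : pol :=
  flatten [seq c.1 | c <- [seq c <- A | pos c.2 == pos t]].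
Definition otail (t : nat * nat) (A : op) : op :=
  [seq c <- A | pos c.2 < pos t].

Definition divm (t u : nat * nat) : bool := (t.1 <= u.1) && (t.2 <= u.2).
Definition subm (u t : nat * nat) : nat * nat := (u.1 - t.1, u.2 - t.2).
Definition addm (u t : nat * nat) : nat * nat := (u.1 + t.1, u.2 + t.2).
Definition lcmm (t u : nat * nat) : nat * nat := (maxn t.1 u.1, maxn t.2 u.2).

(* An operator whose leading term is set apart. *)
Definition gen := ((pol * (nat * nat)) * op)%type.
Definition gop (g : gen) : op := g.1 :: g.2.

(** As in [cancel], the terms at the common leading monomial are dropped from both operators before
    subtracting, so that the leading monomial decreases as a list. *)
Definition ored (g : gen) (t : nat * nat) (A : op) : op :=
  oscale g.1.1 (otail t A) ++
  oneg (oscale (ocoef t A) (otail t (oshift (subm t g.1.2) (gop g)))).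
Definition spair (g h : gen) : op :=
  let l := lcmm g.1.2 h.1.2 in
  oscale h.1.1 (otail l (oshift (subm l g.1.2) (gop g))) ++
  oneg (oscale g.1.1 (otail l (oshift (subm l h.1.2) (gop h)))).

(* [(G, (l, (ps, q)))]: generators [G], operators [l] still to be reduced,
   conditions [p = 0] for [p] in [ps] and [q <> 0] on the parameter. *)
Definition jstate := (seq gen * (seq op * (seq pol * pol)))%type.

(** Parametric Buchberger completion. An irreducible operator either loses its leading coefficient,
    which becomes an equation on the parameter, or keeps it, which becomes an inequation; then it
    joins the generators and its S-pairs are queued. At the end only a generator with leading
    monomial 1, an equation forcing the value at order 0 to vanish, excludes solutions. *)
Definition jstep (s : jstate) : seq (seq pol * pol) * seq jstate :=
  let A := head [::] s.2.1 in let l := behead s.2.1 in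
  let t := lmon A in
  let D := [seq g <- s.1 | divm g.1.2 t] in
  let g := ((ocoef t A, t), otail t A) in
  if nilp s.2.1 then
    (if has (fun g => pos g.1.2 == 0) s.1 then [::] else [:: s.2.2], [::])
  else if nilp A then ([::], [:: (s.1, (l, s.2.2))])
  else if ~~ nilp D then
    ([::], [:: (s.1, (ored (head g D) t A :: l, s.2.2))])
  else ([::],
    [:: (s.1, (otail t A :: l, (ocoef t A :: s.2.2.1, s.2.2.2)));
        (g :: s.1, ([seq spair g h | h <- s.1] ++ l,
                    (s.2.2.1, pmul s.2.2.2 (ocoef t A))))]).

Section Dickson.

(** Height of the staircase of [G] above column [i] (or row, with [f] and [h] exchanged), [None] if
    there is none yet. *)
Definition colmin (f h : nat * nat -> nat) (i : nat) (G : seq (nat * nat)) : option nat :=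
  foldr (fun g m => if f g <= i then Some (if m is Some k then minn (h g) k else h g)
                    else m) None G.
(** A [None] may turn into an arbitrarily large number, so the count of [None] comes first in the
    lexicographic order and the sum of the heights second. *)
Definition omeas (s : seq (option nat)) : nat * nat :=
  (count (fun m => m == None) s, sumn [seq odflt 0 m | m <- s]).
Definition ole (n m : option nat) : bool :=
  if m is Some k then (if n is Some k' then k' <= k else false) else true.

Lemma omeas_lt s s' : all2 ole s s' -> s != s' -> ltp (omeas s) (omeas s').
Proof.
elim: s s' => [|n s IH] [|m s'] //= /andP[nm /IH {}IH].
rewrite eqseq_cons negb_and => ne.
have le : (s == s') || ltp (omeas s) (omeas s').
  by case: eqP IH => //= _ ->.
move: nm ne le; rewrite /ltp /omeas /=.
set a := count _ s; set b := count _ s'; set c := sumn _; set d := sumn _.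
case: (eqVneq s s') => [es|_].
  have -> : a = b by rewrite /a es.
  have -> : c = d by rewrite /c es.
  rewrite orbF => nm ne _; case: m n nm ne => [k|] [k'|] //=.
    by move=> le; rewrite (inj_eq (@Some_inj _)) => ne; lia.
  by move=> _ _; lia.
by case: m n => [k|] [k'|] //=; lia.
Qed.

Lemma colmin_cons f h i t G :
  ole (colmin f h i (t :: G)) (colmin f h i G).
Proof.
rewrite /=; case: ifP => _; last by case: (colmin _ _ _ _) => /=.
by case: (colmin _ _ _ _) => //= k; rewrite geq_minr.
Qed.

Lemma colmin_lt f h t G : (forall g, g \in G -> f g <= f t -> h t < h g) ->
  colmin f h (f t) (t :: G) != colmin f h (f t) G.
Proof.
rewrite /= leqnn => H.
have : if colmin f h (f t) G is Some k then h t < k else true.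
  elim: G H => //= g G IH H.
  have {}IH := IH (fun g' gG => H g' (mem_behead (s := g :: G) gG)).
  have Hg := H g (mem_head _ _); case: (leqP (f g) (f t)) => [/Hg lt|_ //].
  by move: IH; rewrite /colmin; case: (foldr _ _ _) => // k; rewrite leq_min lt.
by case: (colmin _ _ _ _) => // k lt; rewrite (inj_eq (@Some_inj _)); lia.
Qed.

Definition badext (G' G : seq (nat * nat)) : Prop :=
  exists2 t, G' = t :: G & ~~ has (fun g => divm g t) G.

(** Fix an element [g] of the list. A new monomial that [g] does not divide lies in one of finitely
    many columns or rows, and since no other element divides it, it lowers the staircase there; the
    others do not rise. An empty list acquires such a [g] at its first extension. *)
Lemma dickson : well_founded badext.
Proof.
have some g G : g \in G -> Acc badext G.
  pose vec G := [seq colmin fst snd i G | i <- iota 0 g.1] ++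
                [seq colmin snd fst i G | i <- iota 0 g.2].
  elim/(well_founded_ind ltp_wf): {G}(omeas (vec G)) {-2}G (erefl (omeas (vec G)))
    => k IH G ek gG; constructor=> _ [t -> /hasPn nd].
  apply: (IH (omeas (vec (t :: G)))) (erefl _) _; last by rewrite inE gG orbT.
  rewrite -ek; apply: omeas_lt.
    have A2 F H (s : seq nat) : (forall i, ole (F i) (H i)) ->
        all2 ole (map F s) (map H s) by move=> FH; elim: s => //= i s ->; rewrite FH.
    have AC (a b c d : seq (option nat)) : all2 ole a b -> all2 ole c d ->
        all2 ole (a ++ c) (b ++ d).
      by elim: a b => [|x a IHa] [|y b] //= /andP[-> h] /(IHa _ h).
    by apply: AC; apply: A2 => i; apply: colmin_cons.
  rewrite eqseq_cat ?size_map // negb_and.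
  have := nd g gG; rewrite /divm negb_and -!ltnNge.
  case/orP => lt; apply/orP; [left | right].
    apply/eqP => /eq_in_map /(_ t.1); rewrite mem_iota lt => /(_ isT)/eqP.
    apply/negP/colmin_lt => u uG ut; rewrite ltnNge; apply/negP => ut'.
    by have := nd u uG; rewrite /divm ut ut'.
  apply/eqP => /eq_in_map /(_ t.2); rewrite mem_iota lt => /(_ isT)/eqP.
  apply/negP/colmin_lt => u uG ut; rewrite ltnNge; apply/negP => ut'.
  by have := nd u uG; rewrite /divm ut ut'.
by case=> [|g G]; [constructor=> _ [t -> _]; apply: (some t) | apply: (some g)];
  rewrite mem_head.
Qed.

End Dickson.

Definition olt (n : nat) (A : op) : bool := all (fun c => pos c.2 < n) A.

Lemma lmon_max A : olt (pos (lmon A)).+1 A.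
Proof.
elim: A => //= c A IH; rewrite [lmon _]/= -/(lmon A).
case: (ltnP (pos (lmon A)) (pos c.2)) => h.
  rewrite leqnn /=; apply: sub_all IH => d; rewrite !ltnS => /leq_trans -> //.
  exact: ltnW.
by rewrite ltnS h.
Qed.

Lemma olt_lmon n A : ~~ nilp A -> olt n A -> pos (lmon A) < n.
Proof.
elim: A => //= c A IH _ /andP[h hA]; rewrite [lmon _]/= -/(lmon A).
case: A IH hA => [|d A] IH hA; first by case: ifP => // _; apply: leq_ltn_trans h.
by case: ifP => // _; apply: IH.
Qed.

Lemma olt_tail t A : olt (pos t) (otail t A).
Proof. exact: filter_all. Qed.

Lemma olt_cat n A B : olt n (A ++ B) = olt n A && olt n B.
Proof. exact: all_cat. Qed.

Lemma olt_scale n p A : olt n (oscale p A) = olt n A.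
Proof. by rewrite /olt all_map. Qed.

Lemma olt_neg n A : olt n (oneg A) = olt n A.
Proof. by rewrite /olt all_map. Qed.

Lemma olt_ored g t A : olt (pos t) (ored g t A).
Proof. by rewrite olt_cat olt_neg !olt_scale !olt_tail. Qed.

(** Nested inductions: Dickson's lemma on the leading monomials of the generators, then the queue,
    then the leading monomial of its head. Queuing S-pairs is harmless, since it happens only when a
    generator is added. *)
Lemma jstep_acc s : Acc (child_of jstep) s.
Proof.
case: s => G; elim/(well_founded_ind dickson): {G}(map (fun g : gen => g.1.2) G)
  {-2}G (erefl (map (fun g : gen => g.1.2) G)) => M IHM G EM [l].
elim: l => [|A l IH] c; first by constructor=> s'; rewrite /child_of /jstep /=; case.
(* The successor separates the empty operator from operators whose leading monomial is 1. *)
pose om (A : op) := if nilp A then 0 else (pos (lmon A)).+1.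
elim/ltn_ind: {A}(om A) {-2}A (erefl (om A)) l IH c => k IHA A eA l IH c.
have {}IHA B : ~~ nilp A -> olt (pos (lmon A)) B -> forall c,
    Acc (child_of jstep) (G, (B :: l, c)).
  move=> nA lt; apply: (IHA (om B)) (erefl _) _ IH; rewrite -eA /om (negPf nA) ltnS.
  by case: ifP => // /negbT nB; apply: olt_lmon.
constructor=> s'; rewrite /child_of /jstep /=; case: (boolP (nilp A)) => nA.
  case=> [<-|[]]; exact: IH.
case: (boolP (nilp [seq g <- G | divm g.1.2 (lmon A)])) => nD /=.
  case=> [<-|[<-|[]]]; first exact: (IHA (otail (lmon A) A) nA (olt_tail (lmon A) A)).
  apply: (IHM (lmon A :: M)); last by rewrite -EM.
  exists (lmon A) => //; rewrite -EM has_map -[has _ _]negbK -all_predC.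
  move: nD; rewrite /nilp size_filter -leqn0 leqNgt -has_count => /hasPn nD.
  by rewrite negbK; apply/allP => g gG /=; apply: nD.
case=> [<-|[]]; exact: (IHA (ored _ (lmon A) A) nA (olt_ored _ (lmon A) A)).
Qed.

Local Open Scope ring_scope.

Lemma bump_ind (P : nat * nat -> Prop) :
  P (0, 0)%N -> (forall i t, P t -> P (bump i t)) -> forall t, P t.
Proof.
move=> P0 PS [a b]; elim: a => [|a IH]; last exact: (PS false (a, b)).
by elim: b => [|b IH] //; exact: (PS true (0%N, b)).
Qed.

Lemma addm_bump i s t : addm (bump i s) t = bump i (addm s t).
Proof. by case: i. Qed.

Lemma add0m t : addm (0, 0)%N t = t. Proof. by case: t. Qed.

Lemma leq_pos_bump i t u : (pos t <= pos u)%N -> (pos (bump i t) <= pos (bump i u))%N.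
Proof.
rewrite leq_eqVlt => /orP[/eqP/pos_inj -> //|]; by move/(pos_bump i)/ltnW.
Qed.

Lemma pos0 t : pos t = 0%N -> t = (0, 0)%N.
Proof. by move=> e; apply: pos_inj. Qed.

Lemma lmon_gop g : olt (pos g.1.2) g.2 -> lmon (gop g) = g.1.2.
Proof.
move=> h; rewrite /gop [lmon _]/= -/(lmon g.2); case: ltnP => // le.
case: (boolP (nilp g.2)) => [/nilP e|n]; last first.
  by have := leq_trans (olt_lmon n h) le; rewrite ltnn.
by move: le; rewrite e leqn0 => /eqP/pos0 ->.
Qed.

Lemma hasIn (T : Type) (a : pred T) (l : seq T) :
  has a l <-> exists2 x, List.In x l & a x.
Proof.
elim: l => [|y l IH] /=; first by split=> // -[].
split=> [/orP[ay|/IH[x xl ax]]|[x [->|xl] ax]].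
- by exists y => //; left.
- by exists x => //; right.
- by rewrite ax.
- by apply/orP; right; apply/IH; exists x.
Qed.

(** * Formal solutions as linear forms on operators *)

Section JanetSem.
Variables (K : fieldType) (rho : var -> K) (dl : bool -> K -> K).
Hypothesis dP : forall i, derivation (dl i).
Hypothesis vP : forall i v, dl i (rho v) = pval rho (dvar i v).
Hypothesis dC : forall a, dl false (dl true a) = dl true (dl false a).

Let val := pval rho.
Implicit Types (A B : op) (f : nat * nat -> K) (L : seq op) (g h : gen).

(** Here [f] is any linear form on operators, given by its values on the monomials; the jet of a
    function is a special case. A formal solution at the given parameter is a form that kills a
    whole left ideal. *)
Definition pr A f : K := \sum_(c <- A) val c.1 * f c.2.

Lemma pr_cat A B f : pr (A ++ B) f = pr A f + pr B f.
Proof. exact: big_cat. Qed.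
Lemma pr_scale p A f : pr (oscale p A) f = val p * pr A f.
Proof.
rewrite /pr big_map mulr_sumr; apply: eq_bigr => c _.
by rewrite /val pval_mul mulrA.
Qed.
Lemma pr_neg A f : pr (oneg A) f = - pr A f.
Proof.
rewrite /pr big_map -sumrN; apply: eq_bigr => c _.
by rewrite /val pval_neg mulNr.
Qed.
Lemma pr_nil A f : nilp A -> pr A f = 0.
Proof. by move/nilP->; apply: big_nil. Qed.

(* The deviation of [f] from being the jet of a function. *)
Definition tw i f t : K := f (bump i t) - dl i (f t).

(** Moves a derivation from the operator to the form. Statements about all derivatives of [A] thus
    reduce, by induction, to statements about [A] for all forms at once. *)
Lemma pr_D i A f : pr (oD i A) f = dl i (pr A f) + pr A (tw i f).
Proof.
rewrite pr_cat /pr !big_map (deriv_sum (dP i)).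
transitivity (\sum_(c <- A)
    (val (pD i c.1) * f c.2 + val c.1 * f (bump i c.2))); first by rewrite big_split.
transitivity (\sum_(c <- A)
    (dl i (val c.1 * f c.2) + val c.1 * tw i f c.2)); last by rewrite big_split.
apply: eq_bigr => c _.
by rewrite (derivM (dP i)) /tw /val (pval_D _ (dP i) (vP i)); ring.
Qed.

(** The two lists differ; they agree only under pairing, because the twists commute as the
    derivations do. *)
Lemma pr_DC A f : pr (oD false (oD true A)) f = pr (oD true (oD false A)) f.
Proof.
have twC : tw true (tw false f) = tw false (tw true f).
  apply: funext => t; rewrite /tw /= !(derivD (dP _)) !(derivN (dP _)) dC; ring.
rewrite !pr_D !(derivD (dP _)) dC twC; ring.
Qed.

Lemma pr_shift_bump i s A f : pr (oshift (bump i s) A) f = pr (oD i (oshift s A)) f.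
Proof.
case: i => //; rewrite /oshift /=; move: (iter s.2 _ A) f => {}A f.
elim: s.1 f => //= n IH f.
by rewrite -pr_DC !pr_D !IH -?pr_D // [in RHS]pr_D.
Qed.

Lemma pr_shiftS i s A f :
  pr (oshift (bump i s) A) f = dl i (pr (oshift s A) f) + pr (oshift s A) (tw i f).
Proof. by rewrite pr_shift_bump pr_D. Qed.

Lemma eq_pr n A f f' : olt n A -> (forall t, (pos t < n)%N -> f t = f' t) ->
  pr A f = pr A f'.
Proof.
move=> nA ff; rewrite /pr !big_seq; apply: eq_bigr => c /(allP nA) h.
by rewrite ff.
Qed.

Lemma pr_split t A f : olt (pos t).+1 A ->
  pr A f = val (ocoef t A) * f t + pr (otail t A) f.
Proof.
elim: A => [|c A IH] /=; first by rewrite /pr !big_nil /val pval_nil mul0r addr0.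
move=> /andP[ct /IH {}IH]; rewrite {1}/pr big_cons -/(pr A f) IH.
rewrite /ocoef /otail /=; case: eqP => [/pos_inj e|ne] /=.
  by rewrite e ltnn /val pval_cat; ring.
have -> : (pos c.2 < pos t)%N by rewrite ltn_neqAle -ltnS ct andbT; apply/eqP.
by rewrite [in RHS]/pr big_cons -/(pr _ f); ring.
Qed.

Lemma olt_D i t A : olt (pos t).+1 A -> olt (pos (bump i t)).+1 (oD i A).
Proof.
move=> h; rewrite olt_cat /olt !all_map; apply/andP; split; apply: sub_all h => c /=.
  by rewrite !ltnS => /leq_trans; apply; rewrite ltnW // ltn_pos_bump.
by rewrite !ltnS; exact: leq_pos_bump.
Qed.

Lemma olt_shift s t A : olt (pos t).+1 A -> olt (pos (addm s t)).+1 (oshift s A).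
Proof.
case: s => a b h; rewrite /oshift /=.
have {}h : olt (pos (t.1, b + t.2)%N).+1 (iter b (oD true) A).
  by elim: b => [|b IH] /=; [case: t h | exact: (olt_D true IH)].
by elim: a => [|a IH] //=; exact: (olt_D false IH).
Qed.

(** Differentiating an operator shifts its leading monomial and leaves the leading coefficient
    unchanged: derivatives of coefficients come with smaller monomials. *)
Lemma pr_lead s g f : olt (pos g.1.2) g.2 -> let t := addm s g.1.2 in
  pr (oshift s (gop g)) f =
  val g.1.1 * f t + pr (otail t (oshift s (gop g))) f.
Proof.
move=> hg /=; have g1 : olt (pos g.1.2).+1 (gop g).
  by rewrite /gop /= ltnS leqnn /=; apply: sub_all hg => c /= /ltnW.
rewrite (pr_split f (olt_shift s g1)); congr (_ * _ + _).
have H t A : olt (pos t).+1 A -> forall i,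
    val (ocoef (bump i t) (oD i A)) = val (ocoef t A).
  move=> h i; rewrite /ocoef /oD filter_cat map_cat flatten_cat /val pval_cat.
  rewrite filter_map (eq_in_filter (a2 := pred0)); last first.
    move=> c /(allP h) /= ct; apply/eqP => e.
    by have := ltn_pos_bump i t; rewrite -e ltnNge -ltnS ct.
  rewrite filter_pred0 /= pval_nil add0r filter_map -map_comp.
  rewrite (eq_filter (a2 := fun c => pos c.2 == pos t)) // => c /=.
  apply/eqP/eqP => [/pos_inj e|/pos_inj -> //]; congr pos.
  by case: i e => -[] => [e1 e2|e1 e2]; rewrite [c.2]surjective_pairing [t]surjective_pairing e1 e2.
case: s => a b; rewrite /oshift /addm /=.
set B := iter b _ _; have [hB eB] : olt (pos (g.1.2.1, b + g.1.2.2)%N).+1 B /\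
    val (ocoef (g.1.2.1, b + g.1.2.2)%N B) = val g.1.1.
  rewrite /B; elim: b {B} => [|b [IH1 IH2]] /=.
    split; first by rewrite -surjective_pairing.
    rewrite /ocoef -surjective_pairing /gop /= eqxx /=.
    rewrite (eq_in_filter (a2 := pred0)) ?filter_pred0 ?cats0 // => c /(allP hg) /=.
    by rewrite ltn_neqAle => /andP[/negPf].
  by split; [exact: (olt_D true IH1) | rewrite -IH2 -(H _ _ IH1 true)].
suff [] : olt (pos (a + g.1.2.1, b + g.1.2.2)%N).+1 (iter a (oD false) B) /\
    val (ocoef (a + g.1.2.1, b + g.1.2.2)%N (iter a (oD false) B)) = val g.1.1 by [].
elim: a => [|a [IH1 IH2]] //=.
by split; [exact: (olt_D false IH1) | rewrite -IH2 -(H _ _ IH1 false)].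
Qed.

(** The truncation of [annih] to multiples whose leading monomial lies below [n]. An operator that
    vanishes on all such forms is, by duality, a linear combination of those multiples; this stands
    in for a standard representation. *)
Definition kills f L n : Prop :=
  forall A s, List.In A L -> (pos (addm s (lmon A)) < n)%N -> pr (oshift s A) f = 0.
Definition annih f L : Prop :=
  forall A s, List.In A L -> pr (oshift s A) f = 0.

(** The boolean treats strict ([false]) and large ([true]) bounds together. The bound passes from a
    derivative of [t] down to [t] because differentiation is monotone for [pos]. *)
Lemma kills_tw (b : bool) f L t i :
  kills f L (pos (bump i t) + b)%N -> kills (tw i f) L (pos t + b)%N.
Proof.
move=> kf A s AL lt.
have : pr (oshift (bump i s) A) f = 0.
  apply: kf => //; rewrite addm_bump; case: b lt => /=.
    by rewrite !addn1 !ltnS; exact: leq_pos_bump.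
  by rewrite !addn0; exact: pos_bump.
rewrite pr_shiftS kf ?(deriv0 (dP i)) ?add0r //.
by apply: leq_trans lt _; rewrite leq_add2r ltnW // ltn_pos_bump.
Qed.

Lemma annih_tw f L i : annih f L -> annih (tw i f) L.
Proof.
move=> kf A s AL; have := kf A (bump i s) AL.
by rewrite pr_shiftS kf // (deriv0 (dP i)) add0r.
Qed.

Lemma killsW f L m n : (m <= n)%N -> kills f L n -> kills f L m.
Proof. by move=> mn kf A s AL lt; apply: kf AL (leq_trans lt mn). Qed.

Lemma kills_shift A L : (forall f, kills f L (pos (lmon A)).+1 -> pr A f = 0) ->
  forall s f, kills f L (pos (addm s (lmon A))).+1 -> pr (oshift s A) f = 0.
Proof.
move=> H; apply: bump_ind => [f|i s IH f]; first by rewrite add0m; apply: H.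
rewrite addm_bump -addn1 => kf; rewrite pr_shiftS !IH ?(deriv0 (dP i)) ?addr0 //.
  by rewrite -addn1; exact: (kills_tw (b := true) kf).
by apply: killsW kf; rewrite addn1 ltnS ltnW // ltn_pos_bump.
Qed.

Lemma kills_sub L L' :
  (forall A, List.In A L -> forall f, kills f L' (pos (lmon A)).+1 -> pr A f = 0) ->
  forall f n, kills f L' n -> kills f L n.
Proof.
move=> H f n kf A s AL lt; apply: (kills_shift (H A AL)).
exact: killsW kf.
Qed.

Lemma annih_sub L L' :
  (forall A, List.In A L -> forall f, annih f L' -> pr A f = 0) ->
  forall f, annih f L' -> annih f L.
Proof.
move=> H f kf A s AL; move: s f kf; apply: bump_ind => [f|i s IH f] kf.
  exact: H kf.
by rewrite pr_shiftS !IH ?(deriv0 (dP i)) ?addr0 //; apply: annih_tw.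
Qed.

Lemma annih_kills f L n : annih f L -> kills f L n.
Proof. by move=> h A s AL _; apply: h. Qed.

Definition jcond (c : seq pol * pol) : bool :=
  all (fun p => val p == 0) c.1 && (val c.2 != 0).
Definition gok g : Prop := olt (pos g.1.2) g.2 /\ val g.1.1 != 0.
(** Dual form of the condition that the S-pair of [g] and [h] has a representation by multiples
    smaller than the least common multiple. *)
Definition pair_ok L g h : Prop :=
  forall f, kills f L (pos (lcmm g.1.2 h.1.2)) ->
    val h.1.1 * pr (oshift (subm (lcmm g.1.2 h.1.2) g.1.2) (gop g)) f =
    val g.1.1 * pr (oshift (subm (lcmm g.1.2 h.1.2) h.1.2) (gop h)) f.
Definition ops (s : jstate) : seq op := map gop s.1 ++ s.2.1.
(** Asked only at parameters that meet the conditions gathered so far: elsewhere the leading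
    coefficients of the generators may vanish. *)
Definition jinv (s : jstate) : Prop := jcond s.2.2 ->
  (forall g, List.In g s.1 -> gok g) /\
  (forall g h, List.In g s.1 -> List.In h s.1 -> pair_ok (ops s) g h).
Definition jsol (s : jstate) : Prop :=
  jcond s.2.2 /\ exists2 f, f (0, 0)%N != 0 & annih f (ops s).

Lemma subm_add t u : divm t u -> addm (subm u t) t = u.
Proof. by case: t u => [a b] [c d] /andP[/= ac bd]; rewrite /addm /= !subnK. Qed.

Lemma divm_lcm t u v : divm t v -> divm u v -> divm (lcmm t u) v.
Proof. by move=> /andP[a b] /andP[c d]; rewrite /divm !geq_max a b c d. Qed.

Lemma divm_lcml t u : divm t (lcmm t u).
Proof. by rewrite /divm !leq_maxl. Qed.

Lemma divm_lcmr t u : divm u (lcmm t u).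
Proof. by rewrite /divm !leq_maxr. Qed.

Lemma lcmmC t u : lcmm t u = lcmm u t.
Proof. by rewrite /lcmm maxnC [maxn t.2 _]maxnC. Qed.

(* Buchberger's criterion: the critical relation propagates to all common
   multiples of the two leading monomials. *)
Lemma pair_shift L g h : List.In (gop g) L -> List.In (gop h) L ->
  gok g -> gok h -> pair_ok L g h -> let l := lcmm g.1.2 h.1.2 in
  forall s f, kills f L (pos (addm s l)) ->
    val h.1.1 * pr (oshift (addm s (subm l g.1.2)) (gop g)) f =
    val g.1.1 * pr (oshift (addm s (subm l h.1.2)) (gop h)) f.
Proof.
move=> gL hL [g1 _] [h1 _] p l; apply: bump_ind => [f|i s IH f].
  by rewrite !add0m; apply: p.
rewrite !addm_bump => kf; rewrite !pr_shiftS.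
have z k : List.In (gop k) L -> olt (pos k.1.2) k.2 -> divm k.1.2 l ->
    pr (oshift (addm s (subm l k.1.2)) (gop k)) f = 0.
  move=> kL k1 kl; apply: (kf _ _ kL); rewrite lmon_gop //.
  suff -> : addm (addm s (subm l k.1.2)) k.1.2 = addm s l by apply: ltn_pos_bump.
  by rewrite -[in RHS](subm_add kl) /addm /= !addnA.
rewrite !z ?divm_lcml ?divm_lcmr // !(deriv0 (dP i)) !add0r; apply: IH.
by have := @kills_tw false f L (addm s l) i; rewrite !addn0; apply.
Qed.

Section Solution.
Variable G : seq gen.
Hypothesis Gok : forall g, List.In g G -> gok g.
Hypothesis Gpair : forall g h, List.In g G -> List.In h G -> pair_ok (map gop G) g h.

(** At a monomial divisible by some leading monomial the value is forced by the first such
    generator; at the free monomials it is chosen, 1 at order 0 and 0 elsewhere. *)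
Definition next (f : nat * nat -> K) (t : nat * nat) : K :=
  if [seq g <- G | divm g.1.2 t] is g :: _ then
    - (pr (otail t (oshift (subm t g.1.2) (gop g))) f / val g.1.1)
  else (pos t == 0)%N%:R.
Fixpoint approx n : nat * nat -> K :=
  if n is n'.+1 then fun t => if (pos t == n')%N then next (approx n') t
                              else approx n' t
  else fun _ => 0.
Definition sol (t : nat * nat) : K := approx (pos t).+1 t.

Lemma approxE n t : (pos t < n)%N -> approx n t = sol t.
Proof.
elim: n => // n IH; rewrite ltnS leq_eqVlt => /orP[/eqP <- //|lt].
by rewrite /= (ltn_eqF lt) IH.
Qed.

Lemma solE t : sol t = next sol t.
Proof.
rewrite {1}/sol /= eqxx /next; case: [seq _ <- _ | _] => // g _.
by rewrite (eq_pr (olt_tail _ _) (@approxE (pos t))).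
Qed.

Lemma in_filter_In (T : Type) (a : pred T) (l : seq T) x :
  List.In x [seq y <- l | a y] -> List.In x l /\ a x.
Proof.
elim: l => //= y l IH; case: ifP => ay /=; last by move=> /IH[]; split=> //; right.
by case=> [<-|/IH[]]; split=> //; [left | right].
Qed.

Lemma filter_In (T : Type) (a : pred T) (l : seq T) x :
  List.In x l -> a x -> List.In x [seq y <- l | a y].
Proof.
elim: l => //= y l IH [-> ->|xl ax]; first by left.
by case: ifP => _; [right|]; apply: IH.
Qed.

Lemma gop_In g : List.In g G -> List.In (gop g) (map gop G).
Proof. exact: List.in_map. Qed.

(** By construction the solution satisfies, at each [t], the equation of the first generator [h]
    that divides [t]. For another generator [g] with a multiple led by [t], all smaller multiples
    are already killed by induction, so the propagated critical relation carries the equation from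
    [h] to [g]. *)
Lemma sol_annih : annih sol (map gop G).
Proof.
suff H n : kills sol (map gop G) n.
  by move=> A s AL; apply: (H (pos (addm s (lmon A))).+1).
elim: n => // n IH A s /List.in_map_iff[g [<- gG]].
have [g1 g0] := Gok gG; rewrite lmon_gop // ltnS leq_eqVlt => /orP[/eqP e|lt]; last first.
  by apply: IH; [exact: gop_In | rewrite lmon_gop].
set t := addm s g.1.2 in e.
have gt : divm g.1.2 t by rewrite /divm /t /= !leq_addl.
have : List.In g [seq h <- G | divm h.1.2 t] by apply: filter_In.
have := solE t; rewrite /next; case E : [seq _ <- _ | _] => [//|h D] st _.
have [hG ht] : List.In h G /\ divm h.1.2 t.
  by apply: (@in_filter_In _ (fun h => divm h.1.2 t)); rewrite E; left.
have [h1 h0] := Gok hG.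
have hz : pr (oshift (subm t h.1.2) (gop h)) sol = 0.
  rewrite (pr_lead _ _ h1) subm_add // st mulrN mulrC divfK ?addNr //.
have := @pair_shift _ g h (gop_In gG) (gop_In hG) (Gok gG) (Gok hG) (Gpair gG hG)
  (subm t (lcmm g.1.2 h.1.2)) sol.
rewrite subm_add ?divm_lcm // e => /(_ IH).
have E2 k : divm k.1.2 t -> divm k.1.2 (lcmm g.1.2 h.1.2) ->
    addm (subm t (lcmm g.1.2 h.1.2)) (subm (lcmm g.1.2 h.1.2) k.1.2) = subm t k.1.2.
  move=> kt; have := divm_lcm gt ht; case: (lcmm _ _) => l1 l2.
  rewrite /divm /addm /subm /= => /andP[a b] /andP[c d].
  by congr pair; lia.
rewrite !E2 ?divm_lcml ?divm_lcmr // hz mulr0 => /eqP; rewrite mulf_eq0 (negPf h0) /=.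
suff -> : subm t g.1.2 = s by move/eqP.
by rewrite /subm /t /addm /= !addnK; case: (s).
Qed.

End Solution.

Definition cover L' L : Prop := forall A, List.In A L ->
  forall f, kills f L' (pos (lmon A)).+1 -> pr A f = 0.

Lemma kills_in L A f : List.In A L -> kills f L (pos (lmon A)).+1 -> pr A f = 0.
Proof. by move=> AL kf; apply: (kf A (0, 0)%N AL); rewrite add0m. Qed.

Lemma cover_annih L' L f : cover L' L -> annih f L' -> annih f L.
Proof.
move=> c; apply: annih_sub => A AL {}f h; apply: (c A AL); exact: annih_kills.
Qed.

Lemma cover_pair L' L g h : cover L' L -> pair_ok L g h -> pair_ok L' g h.
Proof. by move=> c p f kf; apply: p; apply: kills_sub kf. Qed.

Lemma pair_refl L g : pair_ok L g g.
Proof. by move=> f _. Qed.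

Lemma pair_sym L g h : pair_ok L g h -> pair_ok L h g.
Proof. by move=> p f kf; rewrite lcmmC; apply/esym/p; rewrite lcmmC. Qed.

Lemma pr_spair g h f : gok g -> gok h -> let l := lcmm g.1.2 h.1.2 in
  pr (spair g h) f = val h.1.1 * pr (oshift (subm l g.1.2) (gop g)) f -
                     val g.1.1 * pr (oshift (subm l h.1.2) (gop h)) f.
Proof.
move=> [g1 _] [h1 _] l; rewrite pr_cat pr_neg !pr_scale -/l (pr_lead _ _ g1).
by rewrite (pr_lead _ _ h1) !subm_add ?divm_lcml ?divm_lcmr //; ring.
Qed.

Lemma olt_spair g h : olt (pos (lcmm g.1.2 h.1.2)) (spair g h).
Proof. by rewrite olt_cat olt_neg !olt_scale !olt_tail. Qed.

Lemma pr_ored g t A f : gok g -> divm g.1.2 t -> olt (pos t).+1 A ->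
  pr (ored g t A) f = val g.1.1 * pr A f -
                      val (ocoef t A) * pr (oshift (subm t g.1.2) (gop g)) f.
Proof.
move=> [g1 _] gt At; rewrite pr_cat pr_neg !pr_scale (pr_lead _ _ g1) subm_add //.
by rewrite (pr_split f At); ring.
Qed.

Lemma kills_low L B f n : List.In B L -> olt n B -> kills f L n -> pr B f = 0.
Proof.
move=> BL nB kf; case: (boolP (nilp B)) => [/pr_nil -> //|nn].
by apply: (kf B (0, 0)%N BL); rewrite add0m; apply: olt_lmon.
Qed.

(** Common pattern of the steps that only touch the queue. Two inclusions are asked for: a bounded
    one from old to new, which keeps the critical relations, and a plain one from new to old, which
    keeps the solutions. *)
Lemma same_gens G l l' c c' : jinv (G, (l, c)) -> (jcond c' -> jcond c) ->
  (jcond c' -> (forall g, List.In g G -> gok g) ->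
     cover (map gop G ++ l') l /\ forall B f, List.In B l' ->
        annih f (map gop G ++ l) -> pr B f = 0) ->
  jinv (G, (l', c')) /\ (jcond c' -> (jsol (G, (l, c)) <-> jsol (G, (l', c')))).
Proof.
move=> inv cc H; have Hc : jcond c' -> cover (map gop G ++ l') (map gop G ++ l) /\
    forall f, annih f (map gop G ++ l) -> annih f (map gop G ++ l').
  move=> c1; have [Gok _] := inv (cc c1); have [H1 H2] := H c1 Gok; split.
    move=> A /List.in_app_iff[AG|Al]; last exact: H1.
    by move=> f; apply: kills_in; apply/List.in_app_iff; left.
  move=> f; apply: annih_sub => A /List.in_app_iff[AG|Al] {}f kf; last exact: H2 kf.
  by apply: (kf A (0, 0)%N); apply/List.in_app_iff; left.
split=> [c1|c1]; have [h1 h2] := Hc c1.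
  have [Gok Gp] := inv (cc c1); split=> // g h gG hG.
  exact: (cover_pair h1 (Gp g h gG hG)).
split=> -[_ [f f0 kf]]; split=> //=; try exact: cc; exists f => //.
  exact: h2.
exact: cover_annih kf.
Qed.

(** A generator led by 1 has no tail and a nonzero coefficient, so it forces the value 0 at order 0.
    Otherwise 1 is a free monomial and [sol] takes the value 1 there. *)
Lemma jstep_end G c : jinv (G, ([::], c)) ->
  (jsol (G, ([::], c)) <->
   ~~ has (fun g => pos g.1.2 == 0)%N G /\ jcond c).
Proof.
move=> inv; split.
  case=> [cc [f f0 kf]]; split=> //; apply/negP => /hasIn[g gG /eqP/pos0 g0].
  case/negP: f0; have [[g1 gv] _] := ((inv cc).1 g gG, I).
  have : pr (oshift (0, 0)%N (gop g)) f = 0.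
    by apply: kf; apply/List.in_app_iff; left; apply: List.in_map.
  rewrite pr_lead // add0m g0 pr_nil.
    by move/eqP; rewrite addr0 mulf_eq0 (negPf gv).
  by rewrite /otail; elim: (oshift _ _).
case=> nu cc; split=> //; have [Gok Gp] := inv cc.
have E : ops (G, ([::], c)) = map gop G by apply: cats0.
rewrite E in Gp *; exists (sol G); last exact: sol_annih.
rewrite solE /next; case D : [seq _ <- _ | _] => [|g D'].
  by rewrite eqxx oner_eq0.
have [gG] : List.In g G /\ divm g.1.2 (0, 0)%N.
  by apply: (@in_filter_In _ (fun h => divm h.1.2 (0, 0)%N)); rewrite D; left.
rewrite /divm !leqn0 => /andP[/eqP g1 /eqP g2]; case/negP: nu; apply/hasIn.
by exists g => //; rewrite /pos g1 g2.
Qed.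

(** Generating the same ideal, the new state keeps the solutions. Old critical relations survive
    since [A] and the new generator agree on every form. New ones hold because each S-pair sits in
    the queue and lies strictly below its least common multiple. *)
Lemma jstep_new G A l ps q : let t := lmon A in let c := ocoef t A in
  let g := ((c, t), otail t A) in
  let s' := (g :: G, ([seq spair g h | h <- G] ++ l, (ps, pmul q c))) in
  jinv (G, (A :: l, (ps, q))) -> jinv s' /\
  (jcond s'.2.2 -> (jsol (G, (A :: l, (ps, q))) <-> jsol s')).
Proof.
move=> t c g s' inv; have cc : jcond s'.2.2 -> jcond (ps, q) /\ val c != 0.
  rewrite /jcond /= /val pval_mul mulf_eq0 negb_or => /and3P[-> -> ->].
  by [].
have prA f : pr (gop g) f = pr A f.
  by rewrite (pr_split f (lmon_max A)) /pr big_cons.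
have Hc : jcond s'.2.2 -> [/\ gok g, (forall h, List.In h G -> gok h),
   cover (ops s') (map gop G ++ A :: l) &
   forall f, annih f (map gop G ++ A :: l) -> annih f (ops s')].
  move=> c1; have [c0 cv] := cc c1; have [Gok _] := inv c0.
  have gO : gok g by split; first exact: olt_tail.
  split=> //.
    move=> B /List.in_app_iff[BG|[<-|Bl]] f.
    - by apply: kills_in; right; apply/List.in_app_iff; left.
    - have <- : lmon (gop g) = lmon A by apply: lmon_gop; apply: olt_tail.
      by rewrite -prA; apply: kills_in; left.
    - by apply: kills_in; right; do 2 (apply/List.in_app_iff; right).
  move=> f; apply: annih_sub => B BL {}f kf.
  have k0 D : List.In D (map gop G ++ A :: l) -> pr D f = 0 by move=> DL; apply: (kf D (0, 0)%N).
  have Al : List.In A (map gop G ++ A :: l) by apply/List.in_app_iff; right; left.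
  case: BL => [<-|/List.in_app_iff[BG|/List.in_app_iff[|Bl]]].
  - by rewrite prA k0.
  - by apply: k0; apply/List.in_app_iff; left.
  - case/List.in_map_iff => h [<- hG]; rewrite pr_spair //; last exact: Gok.
    have -> : pr (oshift (subm (lcmm g.1.2 h.1.2) h.1.2) (gop h)) f = 0.
      by apply: kf; apply/List.in_app_iff; left; apply: List.in_map.
    suff -> : pr (oshift (subm (lcmm g.1.2 h.1.2) g.1.2) (gop g)) f = 0.
      by rewrite !mulr0 subrr.
    move: (subm _ _) => s; have : annih f [:: gop g]; last by apply; left.
    apply: (@annih_sub [:: gop g] (map gop G ++ A :: l)) kf => D [<-|[]] f' kf'.
    by rewrite prA; apply: (kf' A (0, 0)%N).
  - by apply: k0; apply/List.in_app_iff; right; right.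
split=> c1; have [gO Gok h1 h2] := Hc c1; have [c0 cv] := cc c1.
  have [_ Gp] := inv c0; split=> [h [<-|hG]|]; [exact: gO | exact: Gok |].
  have new h : List.In h G -> pair_ok (ops s') g h.
    move=> hG f kf; have := kills_low (B := spair g h) _ (olt_spair g h) kf.
    rewrite pr_spair //; last exact: Gok.
    move=> H; apply/eqP; rewrite -subr_eq0; apply/eqP/H.
    by right; apply/List.in_app_iff; right; apply/List.in_app_iff; left; apply: List.in_map.
  move=> h1' h2' [<-|h1G] [<-|h2G]; first exact: pair_refl.
  - exact: new.
  - exact: (pair_sym (new _ h1G)).
  - exact: (cover_pair h1 (Gp _ _ h1G h2G)).
split=> -[_ [f f0 kf]]; split=> //=; exists f => //; first exact: h2.
exact: cover_annih kf.
Qed.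

Lemma jstep_ok s : jinv s ->
  (jsol s <-> (exists2 c, List.In c (jstep s).1 & jcond c) \/
              (exists2 s', List.In s' (jstep s).2 & jsol s')) /\
  (forall s', List.In s' (jstep s).2 -> jinv s').
Proof.
case: s => G [[|A l] [ps q]] inv; rewrite /jstep /=.
  split=> //; rewrite (jstep_end inv); split.
    by case=> /negPf -> cc; left; exists (ps, q) => //; left.
  by case=> [[c]|[]//]; case: ifP => // _ [<-|[]].
case: (boolP (nilp A)) => nA /=.
  have [//| |i1 i2] := @same_gens G (A :: l) l (ps, q) (ps, q) inv; last first.
    split=> [|s' [<-|[]] //]; split=> [h|[[c []]|[s' [<-|[]] h]]].
      by right; exists (G, (l, (ps, q))); [left | apply/i2 => //; case: h].
    by apply/i2 => //; case: h.
  move=> _ _; split=> [B [<- f _|Bl f]|B f Bl kf]; first exact: pr_nil.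
    by apply: kills_in; apply/List.in_app_iff; right.
  by apply: (kf B (0, 0)%N); apply/List.in_app_iff; right; right.
case D : [seq g <- G | divm g.1.2 (lmon A)] => [|g D'] /=; last first.
  have [gG gt] : List.In g G /\ divm g.1.2 (lmon A).
    by apply: (@in_filter_In _ (fun h => divm h.1.2 (lmon A))); rewrite D; left.
  set B := ored g (lmon A) A.
  have [//| |i1 i2] := @same_gens G (A :: l) (B :: l) (ps, q) (ps, q) inv; last first.
    split=> [|s' [<-|[]] //]; split=> [h|[[c []]|[s' [<-|[]] h]]].
      by right; exists (G, (B :: l, (ps, q))); [left | apply/i2 => //; case: h].
    by apply/i2 => //; case: h.
  move=> c Gok; have gO := Gok g gG; have E f := pr_ored f gO gt (lmon_max A).
  split=> [C [<-|Cl] f kf|C f [<-|Cl] kf].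
  - have : pr B f = 0.
      apply: (kills_low (n := (pos (lmon A)).+1) _ _ kf).
        by apply/List.in_app_iff; right; left.
      by apply: sub_all (olt_ored g (lmon A) A) => d /ltnW.
    have -> : pr B f = val g.1.1 * pr A f.
      rewrite E (kf (gop g)) ?mulr0 ?subr0 //.
        by apply/List.in_app_iff; left; apply: List.in_map.
      by rewrite lmon_gop ?subm_add ?ltnSn //; case: gO.
    by move/eqP; rewrite mulf_eq0 (negPf gO.2) => /eqP.
  - by apply: kills_in kf; apply/List.in_app_iff; right; right.
  - rewrite E (kf (gop g)) ?(kf A (0, 0)%N) ?mulr0 ?subr0 //.
      by apply/List.in_app_iff; right; left.
    by apply/List.in_app_iff; left; apply: List.in_map.
  - by apply: (kf C (0, 0)%N); apply/List.in_app_iff; right; right.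
set t := lmon A; set c := ocoef t A.
have [j1 j2] := jstep_new inv.
have [| |i1 i2] := @same_gens G (A :: l) (otail t A :: l) (ps, q) (c :: ps, q) inv;
  last first.
- split=> [|s' [<-|[<-|[]]] //]; split=> [h|].
    right; have [cc _] := h; case: (eqVneq (val c) 0) => [c0|c0].
      exists (G, (otail t A :: l, (c :: ps, q))); first by left.
      by apply/i2 => //; move: cc; rewrite /jcond /= c0 eqxx.
    eexists; first by right; left.
    apply/j2 => //; move: cc; rewrite /jcond /= => /andP[-> q0] /=.
    by rewrite /val pval_mul mulf_neq0.
  case=> [[d []]|[s' [<-|[<-|[]]] h]].
    by apply/i2 => //; case: h.
  by apply/j2 => //; case: h.
- rewrite /jcond /= => /andP[/andP[/eqP c0 _] _] Gok.
  have E f : pr A f = pr (otail t A) f.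
    by rewrite (pr_split f (lmon_max A)) -/t -/c c0 mul0r add0r.
  split=> [C [<-|Cl] f kf|C f [<-|Cl] kf].
  - rewrite E; apply: (kills_low (n := (pos t).+1) _ _ kf).
      by apply/List.in_app_iff; right; left.
    by apply: sub_all (olt_tail t A) => d /ltnW.
  - by apply: kills_in kf; apply/List.in_app_iff; right; right.
  - by rewrite -E; apply: (kf A (0, 0)%N); apply/List.in_app_iff; right; left.
  - by apply: (kf C (0, 0)%N); apply/List.in_app_iff; right; right.
- by rewrite /jcond /= => /andP[/andP[_ ->] ->].
Qed.

Lemma runs_jstep l o : runs jstep l o -> (forall s, List.In s l -> jinv s) ->
  ((exists2 s, List.In s l & jsol s) <-> has jcond o).
Proof.
elim=> [|s {}l {}o _ IH] inv; first by split=> [[]|].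
have [h1 h2] := jstep_ok (inv s (or_introl (erefl _))).
have {}IH : (exists2 s', List.In s' ((jstep s).2 ++ l) & jsol s') <-> has jcond o.
  apply: IH => s' /List.in_app_iff[|s'l]; first exact: h2.
  by apply: inv; right.
rewrite has_cat; split=> [[s' [<-|s'l] hs]|/orP[/hasIn|]].
- case/h1: hs => [/hasIn -> //|[s1 s1l hs1]]; apply/orP; right; apply/IH.
  by exists s1 => //; apply/List.in_app_iff; left.
- by apply/orP; right; apply/IH; exists s' => //; apply/List.in_app_iff; right.
- by move=> h; exists s; [left | apply/h1; left].
- case/IH => s' /List.in_app_iff[s'c hs|s'l hs].
    by exists s; [left | apply/h1; right; exists s'].
  by exists s' => //; right.
Qed.

End JanetSem.

(** * Hurwitz series *)

(* Hurwitz series over [R]: the sequence [f] is the series of the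
   [f n / n! * t ^ n], so that the shift is the derivation [d/dt]. *)
Definition hseries (R : Type) := nat -> R.

Section HurwitzRing.
Variable R : comNzRingType.
Implicit Types f g h : hseries R.

HB.instance Definition _ := gen_eqMixin (hseries R).
HB.instance Definition _ := gen_choiceMixin (hseries R).

Definition hadd f g : hseries R := fun n => f n + g n.
Definition hopp f : hseries R := fun n => - f n.
Definition hzero : hseries R := fun _ => 0.
Definition hone : hseries R := fun n => (n == 0%N)%:R.
Definition hshift f : hseries R := fun n => f n.+1.

(* The shift is a derivation: this determines the product. *)
Fixpoint hmulc (n : nat) f g : R :=
  if n is m.+1 then hmulc m (hshift f) g + hmulc m f (hshift g) else f 0%N * g 0%N.
Definition hmul f g : hseries R := fun n => hmulc n f g.

Fact haddA : associative hadd.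
Proof. by move=> f g h; apply: funext => n; apply: addrA. Qed.
Fact haddC : commutative hadd.
Proof. by move=> f g; apply: funext => n; apply: addrC. Qed.
Fact hadd0 : left_id hzero hadd.
Proof. by move=> f; apply: funext => n; apply: add0r. Qed.
Fact haddN : left_inverse hzero hopp hadd.
Proof. by move=> f; apply: funext => n; apply: addNr. Qed.

HB.instance Definition _ := GRing.isZmodule.Build (hseries R) haddA haddC hadd0 haddN.

Fact hmulC : commutative hmul.
Proof.
move=> f g; apply: funext => n; rewrite /hmul; elim: n f g => [|n IH] f g /=.
  exact: mulrC.
by rewrite addrC IH [in RHS]IH; congr (_ + _); rewrite IH.
Qed.

Fact hmulDl : left_distributive hmul hadd.
Proof.
move=> f g h; apply: funext => n; rewrite /hmul /hadd.
elim: n f g h => [|n IH] f g h /=; first exact: mulrDl.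
have -> : hshift (fun n => f n + g n) = fun n => hshift f n + hshift g n by [].
by rewrite !IH; ring.
Qed.

(** Both products have the same constant term, and the shift, being a derivation, lowers the index
    by one. *)
Fact hmulA : associative hmul.
Proof.
suff H n f g h : hmulc n f (hmul g h) = hmulc n (hmul f g) h.
  by move=> f g h; apply: funext => n; apply: H.
elim: n f g h => [|n IH] f g h; first exact: mulrA.
have sh a b : hshift (hmul a b) = hadd (hmul (hshift a) b) (hmul a (hshift b)) by [].
have Dl a b c : hmulc n (hadd a b) c = hmulc n a c + hmulc n b c.
  by have := congr1 (fun u : hseries R => u n) (hmulDl a b c).
have Dr a b c : hmulc n c (hadd a b) = hmulc n c a + hmulc n c b.
  have C := fun a b => congr1 (fun u : hseries R => u n) (hmulC a b).
  by rewrite -!/(hmul _ _ n) !(C c) /hmul Dl.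
by rewrite /= !sh Dl Dr !IH; ring.
Qed.

Fact hmul1 : left_id hone hmul.
Proof.
move=> f; apply: funext => n; rewrite /hmul.
elim: n f => [|n IH] f /=; first by rewrite mul1r.
rewrite IH; have -> : hshift hone = hzero by apply: funext.
suff -> : hmulc n hzero f = 0 by rewrite add0r.
elim: n {IH} f => [|n IH] f /=; first exact: mul0r.
by rewrite -[X in hmulc n X _ + _]/hzero !IH addr0.
Qed.

Fact hone_neq0 : hone != hzero.
Proof.
apply/eqP => /(congr1 (fun u : hseries R => u 0%N)) /eqP.
by rewrite /hone /hzero eqxx oner_eq0.
Qed.

HB.instance Definition _ := GRing.Zmodule_isComNzRing.Build (hseries R)
  hmulA hmulC hmul1 hmulDl hone_neq0.

Definition hunit : {pred hseries R} := fun f => `[< exists g, g * f = 1 >].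
Definition hinv f : hseries R :=
  if pselect (exists g, g * f = 1) is left e then sval (cid e) else f.

Fact hmulV : {in hunit, left_inverse 1 hinv *%R}.
Proof.
move=> f /asboolP e; rewrite /hinv; case: pselect => // e'.
exact: (svalP (cid e')).
Qed.
Fact hunitP f g : g * f = 1 -> hunit f.
Proof. by move=> e; apply/asboolP; exists g. Qed.
Fact hinv_out : {in [predC hunit], hinv =1 id}.
Proof. by move=> f /asboolP e; rewrite /hinv; case: pselect. Qed.

HB.instance Definition _ := GRing.ComNzRing_hasMulInverse.Build (hseries R)
  hmulV hunitP hinv_out.

Lemma hshift_derivation : derivation hshift.
Proof. by split=> f g; apply: funext => n. Qed.

Lemma hs_natr n : (n%:R : hseries R) = fun k => if k is 0%N then n%:R else 0.
Proof.
elim: n => [|n IH]; first by apply: funext => -[].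
rewrite -addn1 natrD IH; apply: funext => -[|k] /=; first by rewrite natrD.
exact: addr0.
Qed.

Definition taylor (d : R -> R) (a : R) : hseries R := fun n => iter n d a.

Section Taylor.
Variable d : R -> R.
Hypothesis dP : derivation d.

Lemma hshift_taylor a : hshift (taylor d a) = taylor d (d a).
Proof. by apply: funext => n; rewrite /hshift /taylor iterSr. Qed.

Lemma taylorD : {morph taylor d : a b / a + b}.
Proof.
move=> a b; apply: funext => n; rewrite -[RHS]/(taylor d a n + taylor d b n).
by rewrite /taylor; elim: n => //= n ->; rewrite (derivD dP).
Qed.

Lemma taylorM : {morph taylor d : a b / a * b}.
Proof.
move=> a b; apply: funext => n; rewrite -[RHS]/(hmulc n (taylor d a) (taylor d b)).
elim: n a b => //= n IH a b.
rewrite !hshift_taylor -!IH -!/(taylor d _ n) -[LHS]/(taylor d (a * b) n.+1).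
rewrite -[LHS]/(hshift (taylor d (a * b)) n) hshift_taylor (derivM dP) taylorD.
by [].
Qed.

Lemma taylor1 : taylor d 1 = 1.
Proof.
apply: funext => -[|n] //; rewrite -[LHS]/(hshift (taylor d 1) n) hshift_taylor.
rewrite (deriv1 dP) /taylor -[RHS]/(0 : R); elim: n => //= n ->; exact: deriv0 dP.
Qed.

Lemma taylorB : {morph taylor d : a b / a - b}.
Proof.
have t0 : taylor d 0 = 0 by apply: (addrI (taylor d 0)); rewrite -taylorD !addr0.
move=> a b; rewrite taylorD; congr (_ + _); apply: (addrI (taylor d b)).
by rewrite -taylorD !subrr t0.
Qed.

Definition hmap f : hseries R := fun n => d (f n).

Lemma hmap_derivation : derivation hmap.
Proof.
split=> f g; apply: funext => n; first exact: derivD dP _ _.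
rewrite -[LHS]/(d (hmulc n f g)) -[RHS]/(hmulc n (hmap f) g + hmulc n f (hmap g)).
elim: n f g => [|n IH] f g /=; first exact: derivM dP _ _.
by rewrite (derivD dP) !IH -![hshift (hmap _)]/(hmap (hshift _)); ring.
Qed.
End Taylor.
End HurwitzRing.

Section HurwitzDomain.
Variables (R : idomainType) (char0 : forall n, (n.+1)%:R != 0 :> R).
Implicit Types f g : hseries R.

Lemma hmulc_vanish n p q f g : (n < p + q)%N ->
  (forall i, (i < p)%N -> f i = 0) -> (forall i, (i < q)%N -> g i = 0) ->
  hmulc n f g = 0.
Proof.
elim: n p q f g => [|n IH] p q f g npq fp gq /=.
  by case: p npq fp => [npq _|p _ ->]; rewrite ?mul0r // gq ?mulr0.
have fS i : (i < p.-1)%N -> hshift f i = 0 by move=> ip; apply: fp; lia.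
have gS i : (i < q.-1)%N -> hshift g i = 0 by move=> ip; apply: gq; lia.
have h1 : hmulc n (hshift f) g = 0 by apply: IH fS gq; lia.
have h2 : hmulc n f (hshift g) = 0 by apply: IH fp gS; lia.
by rewrite h1 h2 addr0.
Qed.

(** The binomial coefficient reflects the factorials in the normalisation of the series, and its
    induction is Pascal's rule. It is invertible in characteristic 0, whence the absence of zero
    divisors. *)
Lemma hmulc_low p q f g :
  (forall i, (i < p)%N -> f i = 0) -> (forall i, (i < q)%N -> g i = 0) ->
  hmulc (p + q) f g = 'C(p + q, p)%:R * (f p * g q).
Proof.
move: {2}(p + q)%N (erefl (p + q)%N) => k.
elim: k p q f g => [|k IH] p q f g ek fp gq.
  by case: p q ek {fp gq} => [|//] [|//] _; rewrite bin0 mul1r.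
have fS i : (i < p.-1)%N -> hshift f i = 0 by move=> ip; apply: fp; lia.
have gS i : (i < q.-1)%N -> hshift g i = 0 by move=> ip; apply: gq; lia.
rewrite ek /=; case: p q ek fp gq fS gS => [|p] [|q] // ek fp gq fS gS.
- rewrite (@hmulc_vanish k 0 q.+1) ?add0r //; try lia.
  have eq : k = (0 + q)%N by lia.
  by rewrite {1}eq IH // !bin0 !mul1r.
- rewrite addrC (@hmulc_vanish k p.+1 0) ?add0r //; try lia.
  have ep : k = (p + 0)%N by lia.
  by rewrite {1}ep IH // ep !addn0 !binn !mul1r.
have ep : k = (p + q.+1)%N by lia.
have eq : k = (p.+1 + q)%N by lia.
rewrite {1}ep IH // {1}eq IH // -ep -eq binS natrD /hshift; ring.
Qed.

Fact hs_integral f g : f * g = 0 -> (f == 0) || (g == 0).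
Proof.
have low (h : hseries R) : h != 0 -> exists2 p, h p != 0 & forall i, (i < p)%N -> h i = 0.
  move=> h0; have ex : exists n, h n != 0.
    apply: contrapT => H; case/eqP: h0; apply: funext => n; apply/eqP.
    by apply: contrapT => hn; apply: H; exists n; apply/negP.
  exists (ex_minn ex); first by case: ex_minnP.
  case: ex_minnP => m _ min i im; apply/eqP; apply: contraLR im.
  by rewrite -leqNgt; apply: min.
move=> fg; apply/orP; apply: contrapT => /not_orP[/negP/low[p fp fl] /negP/low[q gq gl]].
have := congr1 (fun u : hseries R => u (p + q)%N) fg.
rewrite -[LHS]/(hmulc (p + q) f g) hmulc_low // => /eqP.
rewrite !mulf_eq0 (negPf fp) (negPf gq) !orbF.
have : (0 < 'C(p + q, p))%N by rewrite bin_gt0 leq_addr.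
by case: 'C(_, _) => // n _; rewrite (negPf (char0 n)).
Qed.

End HurwitzDomain.

(* [hseries R] is a domain only in characteristic 0, whence the proof carried
   by the type. *)
Definition hsdom (R : idomainType) (c : forall n, (n.+1)%:R != 0 :> R) := hseries R.
Section Hsdom.
Variables (R : idomainType) (c : forall n, (n.+1)%:R != 0 :> R).
HB.instance Definition _ := GRing.ComUnitRing.on (hsdom c).
Fact hsdom_integral : forall f g : hsdom c, f * g = 0 -> (f == 0) || (g == 0).
Proof. exact: hs_integral c. Qed.
HB.instance Definition _ := GRing.ComUnitRing_isIntegral.Build (hsdom c) hsdom_integral.

Lemma hsdom_char0 n : (n.+1)%:R != 0 :> hsdom c.
Proof.
apply/eqP => /(congr1 (fun u : hseries R => u 0%N)).
rewrite -[LHS]/((n.+1%:R : hseries R) 0%N) hs_natr => /eqP; apply/negP; exact: c.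
Qed.
End Hsdom.

(** * Generated differential fields *)

Section QuotientRule.
Variable K : fieldType.
Implicit Types a b u v : K.

(** The letters [u], [v], [u'], [v'] stand for the derivatives of [a], [b], [a'], [b'], and the last
    hypothesis is the derivative of the cross product. *)
Lemma quotient_wd a b u v a' b' u' v' : b != 0 -> b' != 0 -> a * b' = a' * b ->
  u * b' + a * v' = u' * b + a' * v ->
  (u * b - a * v) / b ^+ 2 = (u' * b' - a' * v') / b' ^+ 2.
Proof.
move=> b0 b'0 e E; have -> : a' = a * b' / b by rewrite e mulfK.
have -> : u' = (u * b' + a * v' - a' * v) / b by rewrite E addrK mulfK.
have -> : a' = a * b' / b by rewrite e mulfK.
by field; rewrite b0 b'0.
Qed.

Lemma quotientD a b u v a' b' u' v' : b != 0 -> b' != 0 ->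
  ((u * b' + a * v' + (u' * b + a' * v)) * (b * b') -
    (a * b' + a' * b) * (v * b' + b * v')) / (b * b') ^+ 2 =
  (u * b - a * v) / b ^+ 2 + (u' * b' - a' * v') / b' ^+ 2.
Proof. by move=> b0 b'0; field; rewrite b0 b'0. Qed.

Lemma quotientM a b u v a' b' u' v' : b != 0 -> b' != 0 ->
  ((u * a' + a * u') * (b * b') - (a * a') * (v * b' + b * v')) / (b * b') ^+ 2 =
  (u * b - a * v) / b ^+ 2 * (a' / b') + a / b * ((u' * b' - a' * v') / b' ^+ 2).
Proof. by move=> b0 b'0; field; rewrite b0 b'0. Qed.

Lemma derivV (d : K -> K) : derivation d -> forall a, a != 0 -> d a^-1 = - d a / a ^+ 2.
Proof.
move=> dP a a0; have := congr1 d (mulfV a0); rewrite (derivM dP) (deriv1 dP) => /eqP.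
by rewrite addrC addr_eq0 => /eqP e; apply: (mulfI a0); rewrite e; field.
Qed.

Lemma deriv_div (d : K -> K) : derivation d -> forall a b, b != 0 ->
  d (a / b) = (d a * b - a * d b) / b ^+ 2.
Proof. by move=> dP a b b0; rewrite (derivM dP) (derivV dP) //; field. Qed.

Lemma deriv_divC (d e : K -> K) : derivation d -> derivation e -> forall a b, b != 0 ->
  d (e a) = e (d a) -> d (e b) = e (d b) -> d (e (a / b)) = e (d (a / b)).
Proof.
move=> dP eP a b b0 Ca Cb; rewrite (deriv_div eP _ b0) (deriv_div dP _ b0).
have b2 : b ^+ 2 != 0 by rewrite expf_neq0.
rewrite (deriv_div dP _ b2) (deriv_div eP _ b2) !expr2.
rewrite !(derivD dP, derivD eP, derivN dP, derivN eP, derivM dP, derivM eP) Ca Cb.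
by field.
Qed.

End QuotientRule.

Section FractionDerivation.
Variables (R : idomainType) (d : R -> R).
Hypothesis dP : derivation d.
Local Notation "x %:F" := (tofrac x).

Lemma tofrac_neq0 (b : R) : b != 0 -> b%:F != 0.
Proof. by rewrite tofrac_eq0. Qed.

Fact frac_repr (x : {fraction R}) : exists ab : R * R, ab.2 != 0 /\ x = ab.1%:F / ab.2%:F.
Proof. by have [a [b h]] := fracE x; exists (a, b). Qed.

Definition fder (x : {fraction R}) : {fraction R} :=
  let ab := sval (cid (frac_repr x)) in
  ((d ab.1)%:F * ab.2%:F - ab.1%:F * (d ab.2)%:F) / ab.2%:F ^+ 2.

Lemma fder_div a b : b != 0 ->
  fder (a%:F / b%:F) = ((d a)%:F * b%:F - a%:F * (d b)%:F) / b%:F ^+ 2.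
Proof.
move=> b0; rewrite /fder; case: cid => -[a' b'] /= [b'0 e].
have F0 := tofrac_neq0 b0; have F'0 := tofrac_neq0 b'0.
have {}e : a * b' = a' * b.
  apply/eqP; rewrite -tofrac_eq !tofracM; apply/eqP.
  have := congr1 (fun x => x * b%:F * b'%:F) e; rewrite divfK // => ->.
  by rewrite mulrAC divfK.
apply: quotient_wd => //; first by rewrite -!tofracM e.
have := congr1 (fun x => (d x)%:F) e.
by rewrite !(derivM dP) !tofracD !tofracM.
Qed.

Lemma fder_tofrac a : fder a%:F = (d a)%:F.
Proof.
rewrite -[a%:F]divr1 -tofrac1 fder_div ?oner_neq0 // (deriv1 dP) tofrac1 tofrac0.
by rewrite mulr0 subr0 expr1n !divr1 mulr1.
Qed.

Lemma fder_derivation : derivation fder.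
Proof.
split=> x y; have [a [b [b0 ->]]] := fracE x; have [a' [b' [b'0 ->]]] := fracE y.
  have F0 := tofrac_neq0 b0; have F'0 := tofrac_neq0 b'0.
  rewrite addf_div // -!tofracM -tofracD !fder_div ?mulf_neq0 //.
  by rewrite (derivD dP) !(derivM dP) !(tofracD, tofracM); apply: quotientD.
have F0 := tofrac_neq0 b0; have F'0 := tofrac_neq0 b'0.
rewrite mulf_div -!tofracM !fder_div ?mulf_neq0 //.
by rewrite !(derivM dP) !(tofracD, tofracM); apply: quotientM.
Qed.

End FractionDerivation.

Lemma fderC (R : idomainType) (d e : R -> R) : derivation d -> derivation e ->
  (forall a, d (e a) = e (d a)) -> forall x, fder d (fder e x) = fder e (fder d x).
Proof.
move=> dP eP C x; have [a [b [b0 ->]]] := fracE x.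
apply: (deriv_divC (fder_derivation dP) (fder_derivation eP)).
- exact: tofrac_neq0.
- by rewrite !fder_tofrac // C.
- by rewrite !fder_tofrac // C.
Qed.

Lemma derivation_der n (H : diffField n) i : derivation (@der n H i).
Proof. by split; [exact: derD | exact: derM]. Qed.

Section Generated.
Variables (n : nat) (H : diffField n) (S : H -> Prop).

Definition generated (a : H) : Prop :=
  forall A : H -> Prop, diff_subfield A -> (forall s, S s -> A s) -> A a.

Lemma generated_subfield : diff_subfield generated.
Proof.
split=> [A|a b ga gb A|a b ga gb A|i a ga A] hA hS; have [h1 h2 h3 h4] := hA => //.
- by apply: h2; [apply: ga | apply: gb].
- by apply: h3; [apply: ga | apply: gb].
- by apply: h4; apply: ga.
Qed.

Lemma generated_in s : S s -> generated s.
Proof. by move=> Ss A _; apply. Qed.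

Definition genp : {pred H} := fun a => `[< generated a >].

Lemma genpP a : reflect (generated a) (a \in genp).
Proof. exact: asboolP. Qed.

Fact genp_divring : divring_closed genp.
Proof.
have [h1 h2 h3 _] := generated_subfield.
split=> [|a b /genpP ga /genpP gb|a b /genpP ga /genpP gb]; apply/genpP => //.
  exact: h2.
exact: h3.
Qed.
HB.instance Definition _ := GRing.isDivringClosed.Build H genp genp_divring.

Record gensub := GenSub { gsval : H; _ : gsval \in genp }.
HB.instance Definition _ := [isSub for gsval].
HB.instance Definition _ := [Choice of gensub by <:].
HB.instance Definition _ := [SubChoice_isSubComUnitRing of gensub by <:].
HB.instance Definition _ := [SubComUnitRing_isSubIntegralDomain of gensub by <:].
HB.instance Definition _ := [SubIntegralDomain_isSubField of gensub by <:].

Fact gder_subproof i (a : gensub) : der i (gsval a) \in genp.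
Proof.
case: a => a /= /genpP ga; apply/genpP.
by have [_ _ _ h] := generated_subfield; apply: h.
Qed.
Definition gder i (a : gensub) : gensub := GenSub (gder_subproof i a).

Fact gderD i : {morph gder i : a b / a + b}.
Proof. by move=> a b; apply: val_inj; exact: derD. Qed.
Fact gderM i a b : gder i (a * b) = gder i a * b + a * gder i b.
Proof. by apply: val_inj; exact: derM. Qed.
Fact gderC i j a : gder i (gder j a) = gder j (gder i a).
Proof. by apply: val_inj; exact: derC. Qed.

Definition gen_field : diffField n := DiffField gderD gderM gderC.
Definition gen_incl : {rmorphism gen_field -> H} := val : {rmorphism gensub -> H}.

Lemma gen_incl_diff : diff_morphism gen_incl.
Proof. by []. Qed.

(** The elements of [H] for which some membership proof satisfies [A] form a differential subfield
    of [H]; membership proofs being irrelevant, minimality of [generated] applies to it. *)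
Lemma gen_ind (A : gen_field -> Prop) : diff_subfield A ->
  (forall s (gs : s \in genp), S s -> A (GenSub gs)) -> forall a, A a.
Proof.
move=> [h1 h2 h3 h4] hS [a ga]; have gen := elimT (genpP a) ga.
suff [ga' h] : exists ga' : a \in genp, A (GenSub ga').
  by rewrite (_ : GenSub ga = GenSub ga') //; apply: val_inj.
have [k1 k2 k3 k4] := generated_subfield.
apply: (gen (fun b => exists gb : b \in genp, A (GenSub gb))).
  split.
  - have g1 : 1 \in genp by apply/genpP.
    by exists g1; suff -> : GenSub g1 = 1 by []; apply: val_inj.
  - move=> b c [gb Ab] [gc Ac].
    have g : b - c \in genp by apply/genpP; apply: k2; apply/genpP.
    exists g; suff -> : GenSub g = GenSub gb - GenSub gc by apply: h2.
    exact: val_inj.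
  - move=> b c [gb Ab] [gc Ac].
    have g : b / c \in genp by apply/genpP; apply: k3; apply/genpP.
    exists g; suff -> : GenSub g = GenSub gb / GenSub gc by exact: (h3 (GenSub gb) (GenSub gc) Ab Ac).
    apply: val_inj; apply: esym.
    exact: (fmorph_div (val : {rmorphism gensub -> H}) (GenSub gb) (GenSub gc)).
  - move=> i b [gb Ab]; exists (gder_subproof i (GenSub gb)); exact: (h4 i (GenSub gb)).
move=> s Ss; have gs : s \in genp by apply/genpP; apply: generated_in.
by exists gs; apply: hS.
Qed.

End Generated.

(** * Solutions in a universal field *)

Section Universal.
Variable F : diffField 2.
Hypothesis char0 : forall n, (n.+1)%:R != 0 :> F.

Definition dir (i : bool) : 'I_2 := if i then iy else ix.

Let R1 : idomainType := hsdom char0.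
Let R2 : idomainType := hsdom (@hsdom_char0 F char0).

Definition emb1 (a : F) : R1 := taylor (der iy) a.
(** Iterated expansion: the outer index counts d_x and the inner one d_y, so the coefficients are
    the values of [jet]. *)
Definition emb (a : F) : R2 := taylor (hmap (der ix) : R1 -> R1) (emb1 a).

Let dy : derivation (@der _ F iy) := derivation_der F iy.
Let dx : derivation (hmap (@der _ F ix) : R1 -> R1) := hmap_derivation (derivation_der F ix).

Lemma embB : {morph emb : a b / a - b}.
Proof. by move=> a b; rewrite /emb /emb1 (taylorB dy) (taylorB dx). Qed.
Lemma embM : {morph emb : a b / a * b}.
Proof. by move=> a b; rewrite /emb /emb1 (taylorM dy) (taylorM dx). Qed.
Lemma emb1E : emb 1 = 1.
Proof. by rewrite /emb /emb1 (taylor1 dy) (taylor1 dx). Qed.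

Fact emb_zmod : zmod_morphism emb. Proof. exact: embB. Qed.
HB.instance Definition _ := GRing.isZmodMorphism.Build F R2 emb emb_zmod.
Fact emb_monoid : monoid_morphism emb. Proof. by split; [exact: emb1E | exact: embM]. Qed.
HB.instance Definition _ := GRing.isMonoidMorphism.Build F R2 emb emb_monoid.

Lemma embE a m n : (emb a : hseries (hseries F)) m n = jet a (m, n).
Proof.
rewrite /emb /taylor /jet /=; elim: m n => [|m IH] n //=.
by rewrite -[LHS]/(der ix ((iter m (hmap (der ix)) (emb1 a) : hseries F) n)) IH.
Qed.

(** The derivations of the series ring shift indices and treat the coefficients in [F] as constants;
    on Taylor expansions they nevertheless restrict to the derivations of [F] ([sder_emb]). *)
Definition sder (i : bool) (f : R2) : R2 := if i then hmap (@hshift F) f else hshift f.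

Arguments sder : simpl never.

Lemma sderE i (f : R2) m n :
  (sder i f : hseries (hseries F)) m n =
  (f : hseries (hseries F)) (bump i (m, n)).1 (bump i (m, n)).2.
Proof. by case: i. Qed.

Lemma sder_derivation i : derivation (sder i).
Proof.
case: i; last exact: (hshift_derivation (R1 : comNzRingType)).
exact: (hmap_derivation (hshift_derivation F)).
Qed.

Lemma jet_der i (a : F) t : jet (der (dir i) a) t = jet a (bump i t).
Proof.
have C j k n (b : F) : iter n (der j) (der k b) = der k (iter n (der j) b).
  by elim: n => //= n ->; rewrite derC.
case: t => m n; rewrite /jet /bump /dir; case: i => /=.
  by rewrite -iterSr.
by rewrite C -iterSr.
Qed.

Lemma sder_emb i a : sder i (emb a) = emb (der (dir i) a).
Proof.
apply: funext => m; apply: funext => n; rewrite sderE !embE jet_der.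
by case: i.
Qed.

Definition H0der (j : 'I_2) : {fraction R2} -> {fraction R2} :=
  fder (sder (j != ix)).

Definition H0 : diffField 2.
Proof.
refine (@DiffField 2 {fraction R2} H0der _ _ _).
- by move=> j; apply: derivD; apply/fder_derivation/sder_derivation.
- by move=> j a b; apply: derivM; apply/fder_derivation/sder_derivation.
- move=> j k a; apply: fderC; try exact: sder_derivation.
  by move=> f; case: (j != ix); case: (k != ix).
Defined.

Lemma dirK i : (dir i != ix) = i.
Proof. by case: i. Qed.

Lemma ord2_dir (j : 'I_2) : j = dir (j != ix).
Proof.
by case: j => -[|[|//]] jP; apply/val_inj.
Qed.

Lemma H0der_tofrac i f : der (dir i) (tofrac f : H0) = tofrac (sder i f).
Proof. by rewrite -[LHS]/(H0der (dir i) (tofrac f)) /H0der (fder_tofrac (sder_derivation _)) dirK. Qed.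

Hypothesis F_universal : universal F.

Section Solve.
Variable f : nat * nat -> F.

Definition fser : R2 := fun m n => f (m, n).
Definition fders (t : nat * nat) : R2 := iter t.1 (sder false) (iter t.2 (sder true) fser).

Lemma fdersE t m n : (fders t : hseries (hseries F)) m n = f (m + t.1, n + t.2)%N.
Proof.
case: t => a b; rewrite /fders /=; elim: a m => [|a IH] m /=.
  elim: b n => [|b IH] n /=; first by rewrite !addn0.
  by rewrite sderE IH addSnnS.
by rewrite sderE IH addSnnS.
Qed.

Lemma fders_bump i t : fders (bump i t) = sder i (fders t).
Proof.
apply: funext => m; apply: funext => n; rewrite sderE !fdersE.
by case: i => /=; rewrite ?addSnnS ?addnS.
Qed.

Variable L : seq (seq (F * (nat * nat))).
Hypothesis f0 : f (0, 0)%N != 0.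
Hypothesis fL : forall A, List.In A L -> \sum_(c <- A) emb c.1 * fders c.2 = 0.

Definition coefs : seq F := flatten [seq map fst A | A <- L].

Let G := gen_field (fun s : F => s \in coefs).
Let S' (y : H0) : Prop := (exists a : G, y = tofrac (emb (gsval a))) \/ y = tofrac fser.
Let H := gen_field S'.

Fact jmap_subproof (a : G) : (tofrac (emb (gsval a)) : H0) \in genp S'.
Proof. by apply/genpP; apply: generated_in; left; exists a. Qed.
Definition jmap (a : G) : H := GenSub (jmap_subproof a).

Fact jmap_zmod : zmod_morphism jmap.
Proof. by move=> a b; apply: val_inj; rewrite /= embB tofracB. Qed.
HB.instance Definition _ := GRing.isZmodMorphism.Build G H jmap jmap_zmod.
Fact jmap_monoid : monoid_morphism jmap.
Proof.
split; first by apply: val_inj; rewrite /= emb1E tofrac1.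
by move=> a b; apply: val_inj; rewrite /= embM tofracM.
Qed.
HB.instance Definition _ := GRing.isMonoidMorphism.Build G H jmap jmap_monoid.

Lemma jmap_diff : diff_morphism jmap.
Proof.
move=> i a; apply: val_inj; rewrite [i]ord2_dir.
rewrite -[RHS]/(der (dir (i != ix)) (tofrac (emb (gsval a)) : H0)) H0der_tofrac.
by rewrite sder_emb.
Qed.

Lemma G_fg : finitely_generated G.
Proof.
exists [seq insubd (0 : G) c | c <- coefs] => A hA hs; apply: gen_ind => // s gs sc.
have -> : GenSub gs = insubd (0 : G) s by apply: val_inj; rewrite val_insubd gs.
by apply/hs/map_f.
Qed.

Lemma H_fg : finitely_generated_over (jmap : {rmorphism G -> H}).
Proof.
have hf : (tofrac fser : H0) \in genp S'.
  by apply/genpP; apply: generated_in; right.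
exists [:: GenSub hf] => A hA hj hs; apply: gen_ind => // s gs [[a e]|e].
  have -> : GenSub gs = jmap a by apply: val_inj.
  exact: hj.
have -> : GenSub gs = GenSub hf by apply: val_inj.
by apply: hs; rewrite mem_head.
Qed.

(** Inside the fractions of the series ring, the series generates a finitely generated extension of
    the differential field [G] of the coefficients, itself finitely generated. Universality sends it
    into [F] over [G], so the image of the series solves the original equations; it is nonzero
    because a field morphism is injective. *)
Lemma universal_solve_series : exists2 h : F, h != 0 &
  forall A, List.In A L -> \sum_(c <- A) c.1 * jet h c.2 = 0.
Proof.
have [k [kd kj]] := F_universal (gen_incl_diff (S := fun s : F => s \in coefs))
  jmap_diff G_fg H_fg.
have hf : (tofrac fser : H0) \in genp S'.
  by apply/genpP; apply: generated_in; right.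
pose w : H := GenSub hf.
have w0 : w != 0.
  apply/eqP => /(congr1 val) /= /eqP; rewrite tofrac_eq0 => /eqP.
  move=> /(congr1 (fun u : hseries (hseries F) => u 0%N 0%N)) /eqP.
  by apply/negP.
exists (k w); first by rewrite fmorph_eq0.
move=> A AL; pose wj (t : nat * nat) : H := iter t.1 (der ix) (iter t.2 (der iy) w).
have jk t : jet (k w) t = k (wj t).
  case: t => a b; rewrite /jet /wj /=.
  elim: a => [|a IH] /=; last by rewrite kd IH.
  by elim: b => [|b IH] //=; rewrite kd IH.
have vS i (u : H) g : val u = tofrac g :> H0 -> val (der (dir i) u) = tofrac (sder i g) :> H0.
  by move=> e; rewrite -H0der_tofrac -e.
have vw t : val (wj t) = tofrac (fders t) :> H0.
  case: t => a b; rewrite /wj /fders /=.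
  elim: a => [|a IH]; last exact: (vS false _ _ IH).
  by elim: b => [|b IH] //; exact: (vS true _ _ IH).
have [cs csE] : exists cs : seq (G * (nat * nat)), [seq (gsval c.1, c.2) | c <- cs] = A.
  have : forall c, c \in A -> c.1 \in coefs.
    move=> c cA; apply/flattenP; exists (map fst A); last exact: map_f.
    by elim: (L) AL => //= B L' IH [->|/IH h]; rewrite inE ?eqxx // h orbT.
  elim: (A) => [|c B IH] cA; first by exists [::].
  have [|cs e] := IH; first by move=> d dB; apply: cA; rewrite inE dB orbT.
  have gc : c.1 \in genp (fun s : F => s \in coefs).
    by apply/genpP; apply: generated_in; apply: cA; rewrite mem_head.
  by exists ((GenSub gc, c.2) :: cs); rewrite /= e; case: (c).
have -> : \sum_(c <- A) c.1 * jet (k w) c.2 = k (\sum_(c <- cs) jmap c.1 * wj c.2).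
  rewrite rmorph_sum -csE big_map; apply: eq_bigr => c _ /=.
  by rewrite rmorphM kj jk.
suff -> : \sum_(c <- cs) jmap c.1 * wj c.2 = 0 by rewrite rmorph0.
have vsum : val (\sum_(c <- cs) jmap c.1 * wj c.2) =
    \sum_(c <- cs) tofrac (emb (gsval c.1)) * tofrac (fders c.2) :> H0.
  elim: (cs) => [|c l IH]; first by rewrite !big_nil.
  by rewrite !big_cons -IH -vw.
apply: val_inj; rewrite vsum -[RHS]tofrac0 -(fL AL) (rmorph_sum (@tofrac R2)) -csE.
by rewrite big_map; apply: eq_bigr => c _; rewrite -tofracM.
Qed.

End Solve.

Section Formal.
Variables (rho : var -> F) (L : seq op) (f : nat * nat -> F).
Hypothesis vP : forall i v, der (dir i) (rho v) = pval rho (dvar i v).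
Hypothesis f0 : f (0, 0)%N != 0.
Let dl i := @der _ F (dir i).
Hypothesis fL : annih rho f L.

Definition eser (A : op) : R2 := \sum_(c <- A) emb (pval rho c.1) * fders f c.2.

Lemma eser_D i A : eser (oD i A) = sder i (eser A).
Proof.
rewrite /eser /oD big_cat !big_map (deriv_sum (sder_derivation i)).
rewrite -[LHS]big_split; apply: eq_bigr => c _ /=.
rewrite (derivM (sder_derivation i)) sder_emb fders_bump.
by rewrite (pval_D _ (derivation_der F (dir i)) (vP i)).
Qed.

(** The coefficient of order [s] in the series of [A] is the value of the form on the derivative of
    [A] of order [s]; killing all derivatives is therefore the same as solving formally. *)
Lemma eser0 A : List.In A L -> eser A = 0.
Proof.
move=> AL; suff E s : (eser (oshift s A) : hseries (hseries F)) 0%N 0%N = 0.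
  have S s : eser (oshift s A) = iter s.1 (sder false) (iter s.2 (sder true) (eser A)).
    case: s => a b; rewrite /oshift /=; elim: a => [|a IH] /=; last by rewrite eser_D IH.
    by elim: b => [|b IH] //=; rewrite eser_D IH.
  apply: funext => m; apply: funext => n; rewrite -[RHS](E (m, n)) S /=.
  have H a b (g : R2) p q : (iter a (sder false) (iter b (sder true) g)
      : hseries (hseries F)) p q = (g : hseries (hseries F)) (p + a)%N (q + b)%N.
    elim: a p => [|a IH] p /=; last by rewrite sderE IH addSnnS.
    elim: b q => [|b IH] q /=; first by rewrite !addn0.
    by rewrite sderE IH addSnnS.
  by rewrite H.
rewrite -[RHS](fL s AL) /eser /pr; elim: (oshift s A) => [|c B IH].
  by rewrite !big_nil.
rewrite !big_cons -IH -[LHS]/((_ : F) + _); congr (_ + _).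
rewrite -[LHS]/((emb (pval rho c.1) : hseries (hseries F)) 0%N 0%N *
   (fders f c.2 : hseries (hseries F)) 0%N 0%N) embE fdersE /jet /=.
by rewrite !add0n -surjective_pairing.
Qed.

Lemma universal_solve : exists2 h : F, h != 0 &
  forall A, List.In A L -> pr rho A (jet h) = 0.
Proof.
have [|h h0 hL] := @universal_solve_series f [seq [seq (pval rho c.1, c.2) | c <- A] | A <- L] f0.
  by move=> A /List.in_map_iff[B [<- BL]]; rewrite big_map; exact: eser0.
exists h => // A AL; rewrite -[RHS](hL _ (List.in_map (fun A : op => [seq (pval rho c.1, c.2) | c <- A]) _ _ AL)).
by rewrite big_map.
Qed.
End Formal.

Lemma hmulc_ext (R : comNzRingType) n (g h h' : nat -> R) :
  (forall q, (q <= n)%N -> h q = h' q) -> hmulc n g h = hmulc n g h'.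
Proof.
elim: n g h h' => [|n IH] g h h' e /=; first by rewrite e.
congr (_ + _); apply: IH => q qn; [exact/e/leqW | exact: e].
Qed.

(** A coefficient of a product involves only coefficients of smaller or equal index, which makes the
    Cauchy recursion below causal. *)
Lemma hmul2_ext m n (g h h' : R2) :
  (forall p q, (p <= m)%N -> (q <= n)%N -> h p q = h' p q) ->
  (g * h : R2) m n = (g * h' : R2) m n.
Proof.
rewrite -[(g * h : R2) m]/(hmulc m g h) -[(g * h' : R2) m]/(hmulc m g h').
elim: m g h h' => [|m IH] g h h' e /=.
  by apply: hmulc_ext => q qn; exact: e.
rewrite -[LHS]/(_ n + _ n) -[RHS]/(_ n + _ n).
by congr (_ + _); apply: IH => p q pm qn; [apply: e; first exact: leqW | exact: e].
Qed.

Section FirstOrder.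
Variables (i : bool) (u v : F).

Definition fo_rhs (g : R2) : R2 := - (emb u * sder (~~ i) g + emb v * g).
Definition coord (t : nat * nat) := if i then t.2 else t.1.

(** Formal Cauchy problem in direction [i]: stage [k] fixes the coefficients of order [k] in that
    direction from those of order [k - 1]. The initial series has all coefficients 1; what counts is
    that its constant term is nonzero. *)
Fixpoint fo_approx k : R2 :=
  if k is k'.+1 then fun m n =>
    if coord (m, n) == k then
      if i then fo_rhs (fo_approx k') m n.-1 else fo_rhs (fo_approx k') m.-1 n
    else fo_approx k' m n
  else fun m n => (coord (m, n) == 0)%N%:R.
Definition fo_sol (t : nat * nat) : F := fo_approx (coord t) t.1 t.2.

Lemma fo_approxE k m n : (coord (m, n) <= k)%N -> fo_approx k m n = fo_sol (m, n).
Proof.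
elim: k => [|k IH]; first by rewrite leqn0 /fo_sol => /eqP ->.
rewrite leq_eqVlt => /orP[/eqP <- //|lt].
by rewrite /= (ltn_eqF lt) IH.
Qed.

Lemma fo_solS t : fo_sol (bump i t) = fo_rhs (fun m n => fo_sol (m, n)) t.1 t.2.
Proof.
case: t => m n; set k := coord (m, n).
have -> : fo_sol (bump i (m, n)) = fo_rhs (fo_approx k) m n.
  by rewrite /fo_sol /k /coord /fo_approx /coord; case: i => /=; rewrite eqxx.
rewrite /fo_rhs -[LHS]/(- (_ m n + _ m n)) -[RHS]/(- (_ m n + _ m n)).
congr (- (_ + _)); apply: hmul2_ext => p q pm qn; rewrite ?sderE.
  by rewrite fo_approxE //; move: pm qn; rewrite /k /coord; case: i => /=; lia.
by rewrite fo_approxE //; move: pm qn; rewrite /k /coord; case: i.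
Qed.

Lemma universal_first_order : exists2 h : F, h != 0 &
  der (dir i) h + u * der (dir (~~ i)) h + v * h = 0.
Proof.
pose L := [:: (1, bump i (0, 0)%N); (u, bump (~~ i) (0, 0)%N); (v, (0, 0)%N)].
have [||h h0 /(_ L)] := @universal_solve_series fo_sol [:: L].
- have c0 : coord (0, 0)%N = 0%N by rewrite /coord; case: i.
  by rewrite /fo_sol c0 /= c0 eqxx oner_neq0.
- move=> A [<-|[]]; rewrite /L !big_cons big_nil addr0 !fders_bump.
  rewrite emb1E mul1r; apply/eqP; rewrite addr_eq0; apply/eqP.
  apply: funext => m; apply: funext => n; rewrite sderE.
  exact: fo_solS (m, n).
move/(_ (or_introl (erefl _))); rewrite /L !big_cons big_nil addr0 mul1r addrA /=.
move=> E; exists h => //; rewrite -[RHS]E /jet /dir; case: (i) => /=; rewrite ?addrA //.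
Qed.
End FirstOrder.
End Universal.

(** * Algebraic extensions of a differential field *)

Lemma commutator_derivation (R : comPzRingType) (d e : R -> R) :
  derivation d -> derivation e -> derivation (fun a => d (e a) - e (d a)).
Proof.
move=> dP eP; split=> a b /=.
  by rewrite (derivD dP) (derivD eP) (derivD dP) (derivD eP); ring.
rewrite (derivM dP) (derivM eP) (derivD dP) (derivD eP) !(derivM dP) !(derivM eP).
by ring.
Qed.

Section AlgebraicExtension.
Variables (n : nat) (k : diffField n).
Hypothesis char0 : forall m, (m.+1)%:R != 0 :> k.
Variables (p : {poly k}) (L : fieldExtType k) (z : L).
Hypotheses (p_irr : irreducible_poly p) (pz : root (map_poly (in_alg L) p) z)
  (Lz : <<1; z>>%VS = fullv).

Definition ev (q : {poly k}) : L := (map_poly (in_alg L) q).[z].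

Lemma evD : {morph ev : q r / q + r}.
Proof. by move=> q r; rewrite /ev rmorphD hornerD. Qed.
Lemma evM : {morph ev : q r / q * r}.
Proof. by move=> q r; rewrite /ev rmorphM hornerM. Qed.
Lemma evC c : ev c%:P = c%:A.
Proof. by rewrite /ev map_polyC hornerC. Qed.
Lemma evX : ev 'X = z.
Proof. by rewrite /ev map_polyX hornerX. Qed.
Lemma ev_p : ev p = 0.
Proof. exact/eqP. Qed.

Lemma ev_surj a : exists q, ev q = a.
Proof.
have : a \in <<1; z>>%VS by rewrite Lz memvf.
move/Fadjoin_polyP=> [q /polyOver1P[r ->] ->]; by exists r.
Qed.

Lemma ev_eq0 q : ev q = 0 -> exists s, q = s * p.
Proof.
move=> q0; have [|cp] := boolP (p %| q); first by move/dvdpP=> [s ->]; exists s.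
have /Bezout_eq1_coprimepP[[u v] /= e] : coprimep p q by rewrite irreducible_poly_coprime.
have /eqP := congr1 ev e; rewrite evD !evM ev_p q0 !mulr0 addr0.
by rewrite -[1]/(1%:P) evC scale1r eq_sym oner_eq0.
Qed.

(** Separability in characteristic 0: the derivative of [p] is nonzero and of smaller degree, so the
    irreducible [p] cannot divide it. *)
Lemma ev_deriv_neq0 : ev p^`() != 0.
Proof.
have [p1 _] := p_irr; have p0 := irredp_neq0 p_irr.
apply/eqP => /ev_eq0[s e].
have sp : (size p^`() < size p)%N by apply: lt_size_deriv.
have : p^`() != 0.
  apply/eqP => /(congr1 (fun q : {poly k} => q`_(size p).-2)).
  rewrite coef_deriv coef0; case: (size p) p1 (lead_coefE p) => [|[|m]] // _ /= e1.
  move/eqP; rewrite -mulr_natr mulf_eq0 (negPf (char0 m)) orbF -e1.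
  by rewrite lead_coef_eq0 (negPf p0).
move=> d0; have s0 : s != 0 by apply: contraNneq d0 => s0; rewrite e s0 mul0r.
move: sp; rewrite e size_mul // ltnNge; case/negP.
by rewrite -(prednK (_ : 0 < size s)%N) ?size_poly_gt0 // leq_addl.
Qed.

Section OneDerivation.
Variable i : 'I_n.
Let dP := derivation_der k i.

Definition dcoef (q : {poly k}) : {poly k} := map_poly (der i) q.
Lemma coef_dcoef q m : (dcoef q)`_m = der i q`_m.
Proof. by rewrite coef_map_id0 // (deriv0 dP). Qed.
Lemma dcoef_derivation : derivation dcoef.
Proof.
split=> q r; apply/polyP => m; rewrite ?(coefD, coefM, coef_dcoef) ?(derivD dP) //.
rewrite (deriv_sum dP) -big_split; apply: eq_bigr => j _.
by rewrite !coef_dcoef (derivM dP).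
Qed.
Lemma dcoefC c : dcoef c%:P = (der i c)%:P.
Proof. by apply/polyP => m; rewrite coef_dcoef !coefC; case: eqP => // _; exact: deriv0 dP. Qed.

(* The value forced on the derivative of [z] by [p(z) = 0]. *)
Definition dz : L := - ev (dcoef p) / ev p^`().
Definition dev (q : {poly k}) : L := ev (dcoef q) + ev q^`() * dz.

Lemma devD : {morph dev : q r / q + r}.
Proof. by move=> q r; rewrite /dev (derivD dcoef_derivation) poly.derivD !evD; ring. Qed.
Lemma devM q r : dev (q * r) = dev q * ev r + ev q * dev r.
Proof.
rewrite /dev (derivM dcoef_derivation) poly.derivM !evD !evM; ring.
Qed.
Lemma dev_p : dev p = 0.
Proof. by rewrite /dev /dz mulrC divfK ?ev_deriv_neq0 // subrr. Qed.
Lemma dev_wd q r : ev q = ev r -> dev q = dev r.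
Proof.
move=> e; have [|s sE] := @ev_eq0 (q - r).
  by have := evD (q - r) r; rewrite subrK e => /eqP; rewrite -subr_eq subrr eq_sym => /eqP.
rewrite -[q](subrK r) devD sE devM dev_p ev_p !mulr0 addr0.
by rewrite add0r.
Qed.

Definition Lder (a : L) : L := dev (sval (cid (ev_surj a))).
Lemma Lder_ev q : Lder (ev q) = dev q.
Proof. by rewrite /Lder; case: cid => r /= /dev_wd. Qed.
Lemma Lder_derivation : derivation Lder.
Proof.
split=> a b; have [q <-] := ev_surj a; have [r <-] := ev_surj b.
  by rewrite -evD !Lder_ev devD.
by rewrite -evM !Lder_ev devM.
Qed.
Lemma Lder_alg c : Lder c%:A = (der i c)%:A.
Proof. by rewrite -evC Lder_ev /dev dcoefC evC derivC -[0]/(0%:P) evC scale0r mul0r addr0. Qed.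
End OneDerivation.

(** The commutator is a derivation [c] that vanishes on [k], so it maps q(z) to q'(z) c(z). For q =
    p this gives p'(z) c(z) = 0, hence c(z) = 0. *)
Lemma LderC i j a : Lder i (Lder j a) = Lder j (Lder i a).
Proof.
have iP := Lder_derivation i; have jP := Lder_derivation j.
have [c [cE cP]] : exists c : L -> L,
    (forall a, c a = Lder i (Lder j a) - Lder j (Lder i a)) /\ derivation c.
  by eexists; split; last exact: (commutator_derivation iP jP).
apply/eqP; rewrite -subr_eq0 -cE; apply/eqP.
have cA b : c b%:A = 0 by rewrite cE !Lder_alg derC subrr.
have H q : c (ev q) = ev q^`() * c z.
  elim/poly_ind: q => [|q b IH].
    by rewrite linear0 -[0]/(0%:P) evC scale0r mul0r (deriv0 cP).
  rewrite poly.derivD derivC addr0 poly.derivM derivX mulr1 !evD !evM evX evC.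
  by rewrite (derivD cP) (derivM cP) cA IH; ring.
have [q <-] := ev_surj a; rewrite H.
have := H p; rewrite ev_p (deriv0 cP) => /esym/eqP.
by rewrite mulf_eq0 (negPf ev_deriv_neq0) /= => /eqP ->; rewrite mulr0.
Qed.

Definition ext_field : diffField n :=
  @DiffField n L Lder (fun i => derivD (Lder_derivation i))
    (fun i => derivM (Lder_derivation i)) LderC.

Lemma ext_incl_diff : diff_morphism (in_alg L : {rmorphism k -> ext_field}).
Proof. by move=> i a; rewrite -[RHS]/(Lder i _) /= Lder_alg. Qed.

Lemma ext_fg : finitely_generated_over (in_alg L : {rmorphism k -> ext_field}).
Proof.
exists [:: z] => A [A1 AB AV _] hk hz a; have [q <-] := ev_surj a.
have A0 : A 0 by rewrite -(subrr 1); apply: AB.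
have AN b : A b -> A (- b) by move=> hb; rewrite -sub0r; apply: AB.
have AD b c : A b -> A c -> A (b + c) by move=> hb hc; rewrite -[c]opprK; apply/AB/AN.
have AM b c : A b -> A c -> A (b * c).
  by move=> hb hc; rewrite -[c]invrK -[c^-1]mul1r; apply/AV/AV.
elim/poly_ind: q => [|q b IH]; first by rewrite -[0]/(0%:P) evC scale0r.
rewrite evD evM evX evC; apply: AD; last exact: hk.
by apply: AM => //; apply: hz; rewrite mem_head.
Qed.

End AlgebraicExtension.

Lemma irreducible_factor (k : fieldType) (p : {poly k}) : (1 < size p)%N ->
  exists2 q, irreducible_poly q & q %| p.
Proof.
elim/ltn_ind: {p}(size p) {-2}p (erefl (size p)) => m IH p sp p1.
have [irr|red] := pselect (irreducible_poly p); first by exists p.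
have p0 : p != 0 by rewrite -size_poly_gt0 (ltn_trans _ p1).
have [q [q1 qp nq]] : exists q : {poly k}, [/\ size q != 1%N, q %| p & ~~ (q %= p)].
  apply: contrapT => H; apply: red; split; first exact: p1.
  move=> q q1 qp; apply: contrapT => /negP nq; apply: H; exists q; split=> //.
have q0 : q != 0 by apply: contraTneq qp => ->; rewrite dvd0p.
have sq : (size q < m)%N.
  rewrite -sp ltn_neqAle dvdp_leq // andbT; apply: contra nq => e.
  by rewrite -dvdp_size_eqp.
have [|r ri rq] := IH (size q) sq q erefl.
  by rewrite ltn_neqAle eq_sym q1 size_poly_gt0.
by exists r => //; apply: dvdp_trans rq qp.
Qed.

(** * Q(x,y) as a differential field *)

Section RationalFunctions.

Let md (i : 'I_2) : {mpoly rat[2]} -> {mpoly rat[2]} := mderiv i.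
Let mdP i : derivation (md i).
Proof. by split=> a b; [exact: mderivD | exact: mderivM]. Qed.

Definition Qfield : diffField 2.
Proof.
refine (@DiffField 2 Qxy (fun i => fder (md i)) _ _ _).
- by move=> i; apply: derivD (fder_derivation (mdP i)).
- by move=> i; apply: derivM (fder_derivation (mdP i)).
- by move=> i j; apply: fderC (mdP i) (mdP j) _ => a; apply: mderiv_comm.
Defined.

Lemma Qfield_fg : finitely_generated Qfield.
Proof.
exists [:: tofrac 'X_ix; tofrac 'X_iy] => A [A1 AB AV _] hX a.
have A0 : A 0 by rewrite -(subrr 1); apply: AB.
have AN b : A b -> A (- b) by move=> hb; rewrite -sub0r; apply: AB.
have AD b c : A b -> A c -> A (b + c) by move=> hb hc; rewrite -[c]opprK; apply/AB/AN.
have AM b c : A b -> A c -> A (b * c).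
  by move=> hb hc; rewrite -[c]invrK -[c^-1]mul1r; apply/AV/AV.
have AX b m : A b -> A (b ^+ m) by move=> hb; elim: m => // m IH; rewrite exprS; apply: AM.
have An (m : nat) : A m%:R by elim: m => // m IH; rewrite -natr1; apply: AD.
have Az (m : int) : A m%:~R by case: m => m; rewrite ?NegzE ?rmorphN; [|apply: AN]; apply: An.
have Ap (p : {mpoly rat[2]}) : A (tofrac p).
  rewrite [p]mpolyE rmorph_sum /=; elim: (msupp p) => [|m s IH]; first by rewrite big_nil.
  rewrite big_cons; apply: AD IH; rewrite -mul_mpolyC monomialE !tofracM !tofracXn.
  apply: (AM); last by apply: (AM); apply: (AX); apply: hX; rewrite !inE eqxx ?orbT.
  have Ac (c : int) : A (tofrac (c%:~R)%:MP) by rewrite !rmorph_int.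
  have -> : tofrac (p@_m)%:MP = tofrac ((numq p@_m)%:~R)%:MP /
      tofrac ((denq p@_m)%:~R)%:MP :> Qxy.
    apply: (canRL (mulfK _)); last by rewrite -rmorphM -mpolyCM numqE.
    by rewrite tofrac_eq0 mpolyC_eq0 intr_eq0 denq_neq0.
  exact: AV.
by have [p [q [_ ->]]] := fracE a; apply: AV.
Qed.

Variables (F : diffField 2) (iota : {rmorphism Qxy -> F}).
Hypotheses (F_dx : extends_partial iota (der ix) ix)
  (F_dy : extends_partial iota (der iy) iy).

Lemma Q_char0 m : (m.+1)%:R != 0 :> Qxy.
Proof.
rewrite -[m.+1%:R](rmorph_nat (@tofrac {mpoly rat[2]})) tofrac_eq0.
rewrite -[m.+1%:R](rmorph_nat (@mpolyC 2 rat)) mpolyC_eq0.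
by rewrite Num.Theory.pnatr_eq0.
Qed.

Lemma iota_diff : diff_morphism (iota : {rmorphism Qfield -> F}).
Proof.
move=> i a; have [p [q [q0 ->]]] := fracE a.
have F0 : iota (tofrac q) != 0 by rewrite fmorph_eq0 tofrac_eq0.
have E r : iota (tofrac (md i r)) = der i (iota (tofrac r)).
  have -> : i = dir (i != ix) by case: i => -[|[|//]] ?; apply: val_inj.
  by case: (i != ix); rewrite /= ?F_dx ?F_dy.
rewrite -[der i _]/(fder (md i) _) (fder_div (mdP i)) // !fmorph_div.
rewrite (deriv_div (derivation_der F i)) // rmorphXn rmorphB !rmorphM.
by rewrite !E.
Qed.

(** Adjoining a root of an irreducible factor is a finitely generated differential extension of
    Q(x,y), which universality embeds into [F] over Q(x,y). *)
Lemma universal_root (p : {poly Qxy}) : universal F -> (1 < size p)%N ->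
  exists f, root (map_poly iota p) f.
Proof.
move=> Fu p1; have [q q_irr qp] := irreducible_factor p1.
have [L _ [z qz Lz]] := irredp_FAdjoin q_irr.
have [k [_ kE]] := Fu Qfield _ _ _ iota_diff (@ext_incl_diff 2 Qfield Q_char0 q L z q_irr qz Lz)
  Qfield_fg (@ext_fg 2 Qfield Q_char0 q L z q_irr qz Lz).
exists (k z); have [r ->] := dvdpP _ _ qp.
rewrite rmorphM rootM /=; apply/orP; right.
have -> : map_poly iota q = map_poly k (map_poly (in_alg L) q).
  by rewrite -map_poly_comp; apply: eq_map_poly => c; rewrite -kE.
by rewrite /root horner_map fmorph_eq0.
Qed.

End RationalFunctions.

(** * Encodings *)

Definition xvar : var := (false, (0, 0)%N).
Definition yvar : var := (false, (1, 0)%N).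

Definition zpol (p : zpoly) : pol :=
  flatten [seq [seq (s, nseq t.2.1 xvar ++ nseq t.2.2 yvar) | s <- int_signs t.1] | t <- p].

(* [dpoly] and [ratfun] without the proof that the denominators do not vanish;
   the encodings are the same. *)
Definition rawfun := (zpoly * zpoly)%type.
Definition rawpoly (I : Type) := seq (rawfun * seq I).
Definition raw (I : Type) (d : dpoly I) : rawpoly I := [seq (val t.1, t.2) | t <- d].

Definition fracpol (I : Type) (j : I -> var) (d : rawpoly I) : pol * pol :=
  foldr (fun t acc => (pmul (pmul (zpol t.1.1) [:: (false, map j t.2)]) acc.2 ++
                       pmul (zpol t.1.2) acc.1, pmul (zpol t.1.2) acc.2))
    ([::], pone) d.

Definition fracop (T : Type) (s : seq ((pol * pol) * T)) : seq (pol * T) * pol :=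
  foldr (fun t acc => ((pmul t.1.1 acc.2, t.2) ::
                         [seq (pmul t.1.2 c.1, c.2) | c <- acc.1],
                       pmul t.1.2 acc.2)) ([::], pone) s.

Definition mono_fun (m : bool * seq var) : rawfun :=
  ([:: ((if m.1 then Negz 0 else Posz 1), (xdeg m.2, ydeg m.2))],
   [:: (Posz 1, (0, 0)%N)]).
Definition rawpol (I : Type) (i : var -> I) (p : pol) : rawpoly I :=
  [seq (mono_fun m, [seq i v | v <- [seq v <- m.2 | v.1]]) | m <- p].

Lemma mono_fun_den m : zpoly_val (mono_fun m).2 != 0.
Proof. by rewrite /zpoly_val big_seq1 /= scale1r !expr0 mulr1 oner_neq0. Qed.
Definition mono_ratfun (m : bool * seq var) : ratfun := 
  exist (fun nd : zpoly * zpoly => is_true (zpoly_val nd.2 != 0)) (mono_fun m) (mono_fun_den m).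
Definition of_pol (I : Type) (i : var -> I) (p : pol) : dpoly I :=
  [seq (mono_ratfun m, [seq i v | v <- [seq v <- m.2 | v.1]]) | m <- p].

Lemma raw_of_pol I (i : var -> I) p : raw (of_pol i p) = rawpol i p.
Proof. by rewrite /raw /of_pol -map_comp. Qed.

Section Valuation.
Variables (K : fieldType) (iota : {rmorphism Qxy -> K}) (jt : nat * nat -> K).

Definition valuation (v : var) : K :=
  if v.1 then jt v.2 else iota (tofrac 'X_(if (0 < v.2.1)%N then iy else ix)).
Local Notation val := (pval valuation).

Lemma val_mono b vs : val [:: (b, vs)] =
  iota (tofrac ((-1) ^+ b *: ('X_ix ^+ xdeg vs * 'X_iy ^+ ydeg vs))) *
  \prod_(v <- [seq v <- vs | v.1]) jt v.2.
Proof.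
have sg : iota (tofrac (((-1) ^+ b : rat)%:MP)) = (-1) ^+ b.
  by case: b; rewrite ?expr1 ?expr0 ?mpolyCN ?mpolyC1 ?tofracN ?tofrac1 ?rmorphN ?rmorph1.
rewrite -mul_mpolyC tofracM (rmorphM iota) sg tofracM (rmorphM iota) !tofracXn !(rmorphXn iota).
rewrite /pval big_seq1 /mval /= -!mulrA; congr (_ * _).
rewrite [LHS](eq_bigr (fun v => if v.1 then jt v.2 else
  if (0 < v.2.1)%N then iota (tofrac 'X_iy) else iota (tofrac 'X_ix))); last first.
  by move=> v _; rewrite /valuation; case: (v.1) => //; case: (0 < v.2.1)%N.
move: (iota (tofrac 'X_ix)) (iota (tofrac 'X_iy)) => X Y {sg}.
elim: vs => [|v vs IH] /=; first by rewrite !big_nil !expr0 !mulr1.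
rewrite big_cons IH; case: v => [[] [[|a] c]] /=.
all: rewrite ?big_cons ?add0n ?add1n ?exprS /=; ring.
Qed.

Lemma val_flatten (T : Type) (s : seq T) (F : T -> pol) :
  val (flatten [seq F t | t <- s]) = \sum_(t <- s) val (F t).
Proof. by rewrite pval_flatten big_map. Qed.

Lemma xydeg_nseq m n : xdeg (nseq m xvar ++ nseq n yvar) = m /\
  ydeg (nseq m xvar ++ nseq n yvar) = n.
Proof. by rewrite /xdeg /ydeg !count_cat !count_nseq /= !mul1n !mul0n addn0. Qed.

Lemma val_zpol p : val (zpol p) = iota (tofrac (zpoly_val p)).
Proof.
rewrite val_flatten /zpoly_val 2!rmorph_sum; apply: eq_bigr => -[c [a b]] _ /=.
have nj m n : [seq v <- nseq m xvar ++ nseq n yvar | v.1] = [::].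
  by elim: m => //=; elim: n.
have E s : val [:: (s, nseq a xvar ++ nseq b yvar)] =
    iota (tofrac ((-1) ^+ s *: ('X_ix ^+ a * 'X_iy ^+ b))).
  by have [ex ey] := xydeg_nseq a b; rewrite val_mono nj big_nil mulr1 ex ey.
have En s n : val [seq (s, nseq a xvar ++ nseq b yvar) | s <- nseq n s] =
    iota (tofrac (((-1) ^+ s *+ n) *: ('X_ix ^+ a * 'X_iy ^+ b))).
  elim: n => [|n IH]; first by rewrite mulr0n scale0r !rmorph0 pval_nil.
  by rewrite mulrS scalerDl !rmorphD /= -IH -E -pval_cat.
case: c => n; first by rewrite En expr0.
by rewrite /int_signs En expr1 NegzE mulrNz mulNrn.
Qed.

Lemma val_frac I (j : I -> var) (g : I -> K) (d : dpoly I) :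
  (forall a, valuation (j a) = g a) ->
  let nd := fracpol j (raw d) in
  val nd.2 != 0 /\ dpoly_val iota g d = val nd.1 / val nd.2.
Proof.
move=> jg; elim: d => [|[r vs] d [IH1 IH2]] /=.
  by rewrite /dpoly_val big_nil pval_nil mul0r pval_one oner_neq0.
have den : iota (tofrac (zpoly_val (\val r).2)) != 0.
  by rewrite fmorph_eq0 tofrac_eq0; exact: (valP r).
split; first by rewrite pval_mul val_zpol mulf_neq0.
rewrite /dpoly_val big_cons -/(dpoly_val iota g d) IH2 pval_cat !pval_mul !val_zpol /=.
have -> : val [:: (false, map j vs)] = \prod_(a <- vs) g a.
  rewrite /pval big_seq1 /mval expr0 mul1r big_map; exact: eq_bigr.
rewrite /ratfun_val fmorph_div.
move: (\prod_(a <- vs) g a) den IH1 => P.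
set A := iota _; set B := iota _; set C := val _; set D := val _.
move: A B C D => A B C D B0 D0; field.
by rewrite B0 D0.
Qed.

Lemma val_of_pol I (i : var -> I) (g : I -> K) p :
  (forall v : var, v.1 -> g (i v) = jt v.2) -> dpoly_val iota g (of_pol i p) = val p.
Proof.
move=> ig; rewrite /dpoly_val /of_pol big_map /pval; apply: eq_bigr => -[b vs] _ /=.
have := val_mono b vs; rewrite /pval big_seq1 => ->; congr (_ * _); last first.
  rewrite big_map !big_filter; apply: eq_bigr => v; exact: ig.
congr (iota _); rewrite /ratfun_val /zpoly_val !big_seq1 /= scale1r !expr0 mulr1 tofrac1 divr1.
by case: b; rewrite /= ?expr1 ?NegzE ?mulrNz.
Qed.

Lemma val_fracop (T : Type) (s : seq ((pol * pol) * T)) :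
  (forall t, List.In t s -> val t.1.2 != 0) ->
  let r := fracop s in val r.2 != 0 /\ forall g : T -> K,
    \sum_(c <- r.1) val c.1 * g c.2 =
    val r.2 * \sum_(t <- s) val t.1.1 / val t.1.2 * g t.2.
Proof.
elim: s => [|t s IH] h /=.
  by rewrite pval_one oner_neq0; split=> // g; rewrite !big_nil mulr0.
have [|IH1 IH2] := IH; first by move=> u us; apply: h; right.
have t0 : val t.1.2 != 0 by apply: h; left.
split=> [|g]; first by rewrite pval_mul mulf_neq0.
rewrite !big_cons big_map !pval_mul mulrDr; congr (_ + _).
  move: (val t.1.1) (val t.1.2) (val (fracop s).2) (g t.2) t0 => a b c e b0.
  by field.
rewrite -mulrA -IH2 mulr_sumr; apply: eq_bigr => c _.
by rewrite pval_mul mulrA.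
Qed.

Definition xymon (a b : nat) : 'X_{1..2} := [multinom (if i == ix then a else b) | i < 2].

Lemma xymonE (R : comNzRingType) a b :
  'X_[R, xymon a b] = 'X_ix ^+ a * 'X_iy ^+ b.
Proof. by rewrite monomialE !mnmE. Qed.

Lemma xymon_eq a b c d : (xymon a b == xymon c d) = (a == c) && (b == d).
Proof.
apply/eqP/andP => [e|[/eqP -> /eqP -> //]].
have := congr1 (fun m : 'X_{1..2} => m ix) e; have := congr1 (fun m : 'X_{1..2} => m iy) e.
by rewrite !mnmE /= => -> ->.
Qed.

(** Without the unknown, the value is the image of an element of Q[x,y] under an injective map, and
    the coefficient of a monomial is the number of its positive occurrences minus that of its
    negative ones. *)
Lemma iszeroP p : rk (lvar p) = 0%N -> iszero p = (val p == 0).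
Proof.
move=> p0; have nj : allv (fun v => ~~ v.1) p.
  by apply: allv_sub (lvar_max p) => -[[] t] //; rewrite p0 /rk.
pose mp : {mpoly rat[2]} := \sum_(m <- p) (-1) ^+ m.1 *: 'X_[xymon (xdeg m.2) (ydeg m.2)].
have -> : val p = iota (tofrac mp).
  rewrite /mp 2!rmorph_sum /pval !big_seq; apply: eq_bigr => m mp' /=.
  have := val_mono m.1 m.2; rewrite -surjective_pairing /pval big_seq1 => ->.
  rewrite xymonE (_ : [seq v <- m.2 | v.1] = [::]) ?big_nil ?mulr1 //.
  by have := allP nj m mp'; elim: m.2 => //= v vs IH /andP[/negPf -> /IH].
rewrite fmorph_eq0 tofrac_eq0.
have coef m : mp@_(xymon (xdeg m) (ydeg m)) =
    (count (fun n => same_xy m n.2 && ~~ n.1) p)%:R -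
    (count (fun n => same_xy m n.2 && n.1) p)%:R.
  rewrite /mp linear_sum /=; elim: (p) => [|n q IH]; first by rewrite big_nil subrr.
  rewrite big_cons IH mcoeffZ mcoeffX eq_sym xymon_eq -/(same_xy m n.2) /=.
  by case: (same_xy m n.2); case: n.1; rewrite /= ?expr0 ?expr1 ?natrD; ring.
apply/allP/eqP => [H|mp0 m mp'].
  apply/mpolyP => u; rewrite mcoeff0.
  have [/hasP[m mp' /eqP ->]|/hasPn no] := boolP (has (fun m => u == xymon (xdeg m.2) (ydeg m.2)) p).
    by rewrite coef (eqP (H m mp')) subrr.
  rewrite /mp linear_sum big_seq big1 //= => m mp'.
  by rewrite mcoeffZ mcoeffX eq_sym (negPf (no m mp')) mulr0.
have := coef m.2; rewrite mp0 mcoeff0 => /esym/eqP.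
by rewrite subr_eq0 Num.Theory.eqr_nat eq_sym.
Qed.

End Valuation.

Local Close Scope ring_scope.

(* Computability of the operations on polynomials and operators *)
#[global] Hint Transparent var pol estate nstate op gen jstate zpoly rawfun rawpoly : comp.

Section Comp.
Context {G : Type} {g : encodable G}.
Lemma c_pneg (p : G -> pol) :
  computable p ->
  computable (fun x => pneg (p x)).
Proof. move=> pP; rewrite /pneg. comp_tac. Qed.
End Comp.
#[global] Hint Resolve c_pneg : comp.

Section Comp.
Context {G : Type} {g : encodable G}.
Lemma c_pmul (p : G -> pol) (q : G -> pol) :
  computable p -> computable q ->
  computable (fun x => pmul (p x) (q x)).
Proof. move=> pP qP; rewrite /pmul. comp_tac. Qed.
End Comp.
#[global] Hint Resolve c_pmul : comp.

Section Comp.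
Context {G : Type} {g : encodable G}.
Lemma c_pmulv (v : G -> var) (e : G -> nat) (p : G -> pol) :
  computable v -> computable e -> computable p ->
  computable (fun x => pmulv (v x) (e x) (p x)).
Proof. move=> vP eP pP; rewrite /pmulv. comp_tac. Qed.
End Comp.
#[global] Hint Resolve c_pmulv : comp.

Section Comp.
Context {G : Type} {g : encodable G}.
Lemma c_pder (dv : G -> var -> pol) (p : G -> pol) :
  computable (fun y : G * var => dv y.1 y.2) -> computable p ->
  computable (fun x => pder (dv x) (p x)).
Proof. move=> dP pP; rewrite /pder /dmon. comp_tac. Qed.
End Comp.
#[global] Hint Resolve c_pder : comp.

Section Comp.
Context {G : Type} {g : encodable G}.
Lemma c_bump (i : G -> bool) (t : G -> nat * nat) :
  computable i -> computable t ->
  computable (fun x => bump (i x) (t x)).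
Proof. move=> iP tP; rewrite /bump. comp_tac. Qed.
End Comp.
#[global] Hint Resolve c_bump : comp.

Section Comp.
Context {G : Type} {g : encodable G}.
Lemma c_pvar (v : G -> var) :
  computable v ->
  computable (fun x => pvar (v x)).
Proof. move=> vP; rewrite /pvar. comp_tac. Qed.
End Comp.
#[global] Hint Resolve c_pvar : comp.

Section Comp.
Context {G : Type} {g : encodable G}.
Lemma c_dvar (i : G -> bool) (v : G -> var) :
  computable i -> computable v ->
  computable (fun x => dvar (i x) (v x)).
Proof. move=> iP vP; rewrite /dvar. comp_tac. Qed.
End Comp.
#[global] Hint Resolve c_dvar : comp.

Section Comp.
Context {G : Type} {g : encodable G}.
Lemma c_pD (i : G -> bool) (p : G -> pol) :
  computable i -> computable p ->
  computable (fun x => pD (i x) (p x)).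
Proof. move=> iP pP; rewrite /pD. comp_tac. Qed.
End Comp.
#[global] Hint Resolve c_pD : comp.

Section Comp.
Context {G : Type} {g : encodable G}.
Lemma c_pos (t : G -> nat * nat) :
  computable t ->
  computable (fun x => pos (t x)).
Proof. move=> tP; rewrite /pos. comp_tac. Qed.
End Comp.
#[global] Hint Resolve c_pos : comp.

Section Comp.
Context {G : Type} {g : encodable G}.
Lemma c_rk (v : G -> var) :
  computable v ->
  computable (fun x => rk (v x)).
Proof. move=> vP; rewrite /rk. comp_tac. Qed.
End Comp.
#[global] Hint Resolve c_rk : comp.

Section Comp.
Context {G : Type} {g : encodable G}.
Lemma c_deg (v : G -> var) (l : G -> seq var) :
  computable v -> computable l ->
  computable (fun x => deg (v x) (l x)).
Proof. move=> vP lP; rewrite /deg. comp_tac. Qed.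
End Comp.
#[global] Hint Resolve c_deg : comp.

Section Comp.
Context {G : Type} {g : encodable G}.
Lemma c_coefp (v : G -> var) (e : G -> nat) (p : G -> pol) :
  computable v -> computable e -> computable p ->
  computable (fun x => coefp (v x) (e x) (p x)).
Proof. move=> vP eP pP; rewrite /coefp. comp_tac. Qed.
End Comp.
#[global] Hint Resolve c_coefp : comp.

Section Comp.
Context {G : Type} {g : encodable G}.
Lemma c_tailp (v : G -> var) (e : G -> nat) (p : G -> pol) :
  computable v -> computable e -> computable p ->
  computable (fun x => tailp (v x) (e x) (p x)).
Proof. move=> vP eP pP; rewrite /tailp. comp_tac. Qed.
End Comp.
#[global] Hint Resolve c_tailp : comp.

Section Comp.
Context {G : Type} {g : encodable G}.
Lemma c_sep (v : G -> var) (p : G -> pol) :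
  computable v -> computable p ->
  computable (fun x => sep (v x) (p x)).
Proof. move=> vP pP; rewrite /sep. comp_tac. Qed.
End Comp.
#[global] Hint Resolve c_sep : comp.

Section Comp.
Context {G : Type} {g : encodable G}.
Lemma c_pDpart (v : G -> var) (i : G -> bool) (p : G -> pol) :
  computable v -> computable i -> computable p ->
  computable (fun x => pDpart (v x) (i x) (p x)).
Proof. move=> vP iP pP; rewrite /pDpart. comp_tac. Qed.
End Comp.
#[global] Hint Resolve c_pDpart : comp.

Section Comp.
Context {G : Type} {g : encodable G}.
Lemma c_euler (v : G -> var) (e : G -> nat) (p : G -> pol) :
  computable v -> computable e -> computable p ->
  computable (fun x => euler (v x) (e x) (p x)).
Proof. move=> vP eP pP; rewrite /euler. comp_tac. Qed.
End Comp.
#[global] Hint Resolve c_euler : comp.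

Section Comp.
Context {G : Type} {g : encodable G}.
Lemma c_lvar (p : G -> pol) :
  computable p ->
  computable (fun x => lvar (p x)).
Proof. move=> pP; rewrite /lvar. comp_tac. Qed.
End Comp.
#[global] Hint Resolve c_lvar : comp.

Section Comp.
Context {G : Type} {g : encodable G}.
Lemma c_pdeg (v : G -> var) (p : G -> pol) :
  computable v -> computable p ->
  computable (fun x => pdeg (v x) (p x)).
Proof. move=> vP pP; rewrite /pdeg. comp_tac. Qed.
End Comp.
#[global] Hint Resolve c_pdeg : comp.

Section Comp.
Context {G : Type} {g : encodable G}.
Lemma c_xdeg (l : G -> seq var) :
  computable l ->
  computable (fun x => xdeg (l x)).
Proof. move=> lP; rewrite /xdeg. comp_tac. Qed.
End Comp.
#[global] Hint Resolve c_xdeg : comp.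

Section Comp.
Context {G : Type} {g : encodable G}.
Lemma c_ydeg (l : G -> seq var) :
  computable l ->
  computable (fun x => ydeg (l x)).
Proof. move=> lP; rewrite /ydeg. comp_tac. Qed.
End Comp.
#[global] Hint Resolve c_ydeg : comp.

Section Comp.
Context {G : Type} {g : encodable G}.
Lemma c_same_xy (l : G -> seq var) (r : G -> seq var) :
  computable l -> computable r ->
  computable (fun x => same_xy (l x) (r x)).
Proof. move=> lP rP; rewrite /same_xy. comp_tac. Qed.
End Comp.
#[global] Hint Resolve c_same_xy : comp.

Section Comp.
Context {G : Type} {g : encodable G}.
Lemma c_iszero (p : G -> pol) :
  computable p ->
  computable (fun x => iszero (p x)).
Proof. move=> pP; rewrite /iszero. comp_tac. Qed.
End Comp.
#[global] Hint Resolve c_iszero : comp.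

Section Comp.
Context {G : Type} {g : encodable G}.
Lemma c_dstep (s : G -> pol) (i : G -> bool) (tw : G -> pol * (nat * nat)) :
  computable s -> computable i -> computable tw ->
  computable (fun x => dstep (s x) (i x) (tw x)).
Proof. move=> sP iP twP; rewrite /dstep. comp_tac. Qed.
End Comp.
#[global] Hint Resolve c_dstep : comp.

Section Comp.
Context {G : Type} {g : encodable G}.
Lemma c_dshift (r : G -> pol) (v : G -> var) (d : G -> nat * nat) :
  computable r -> computable v -> computable d ->
  computable (fun x => dshift (r x) (v x) (d x)).
Proof. move=> rP vP dP; rewrite /dshift. comp_tac. Qed.
End Comp.
#[global] Hint Resolve c_dshift : comp.

Section Comp.
Context {G : Type} {g : encodable G}.
Lemma c_ltp (a : G -> nat * nat) (b : G -> nat * nat) :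
  computable a -> computable b ->
  computable (fun x => ltp (a x) (b x)).
Proof. move=> aP bP; rewrite /ltp. comp_tac. Qed.
End Comp.
#[global] Hint Resolve c_ltp : comp.

Section Comp.
Context {G : Type} {g : encodable G}.
Lemma c_prk (p : G -> pol) :
  computable p ->
  computable (fun x => prk (p x)).
Proof. move=> pP; rewrite /prk. comp_tac. Qed.
End Comp.
#[global] Hint Resolve c_prk : comp.

Section Comp.
Context {G : Type} {g : encodable G}.
Lemma c_reducible (r : G -> pol) (p : G -> pol) :
  computable r -> computable p ->
  computable (fun x => reducible (r x) (p x)).
Proof. move=> rP pP; rewrite /reducible. comp_tac. Qed.
End Comp.
#[global] Hint Resolve c_reducible : comp.

Section Comp.
Context {G : Type} {g : encodable G}.
Lemma c_cancel (s : G -> pol) (c : G -> pol) (t : G -> pol) (t' : G -> pol) (v : G -> var) (e : G -> nat) :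
  computable s -> computable c -> computable t -> computable t' -> computable v -> computable e ->
  computable (fun x => cancel (s x) (c x) (t x) (t' x) (v x) (e x)).
Proof. move=> sP cP tP t'P vP eP; rewrite /cancel. comp_tac. Qed.
End Comp.
#[global] Hint Resolve c_cancel : comp.

Section Comp.
Context {G : Type} {g : encodable G}.
Lemma c_red (r : G -> pol) (p : G -> pol) :
  computable r -> computable p ->
  computable (fun x => red (r x) (p x)).
Proof. move=> rP pP; rewrite /red. cbv zeta. comp_tac. Qed.
End Comp.
#[global] Hint Resolve c_red : comp.

Section Comp.
Context {G : Type} {g : encodable G}.
Lemma c_estep (s : G -> estate) :
  computable s ->
  computable (fun x => estep (s x)).
Proof. move=> sP; rewrite /estep. cbv zeta. comp_tac. Qed.
End Comp.
#[global] Hint Resolve c_estep : comp.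

Section Comp.
Context {G : Type} {g : encodable G}.
Lemma c_pexp (p : G -> pol) (n : G -> nat) :
  computable p -> computable n ->
  computable (fun x => pexp (p x) (n x)).
Proof. move=> pP nP; rewrite /pexp. comp_tac. Qed.
End Comp.
#[global] Hint Resolve c_pexp : comp.

Section Comp.
Context {G : Type} {g : encodable G}.
Lemma c_nstep (s : G -> nstate) :
  computable s ->
  computable (fun x => nstep (s x)).
Proof. move=> sP; rewrite /nstep. cbv zeta. comp_tac. Qed.
End Comp.
#[global] Hint Resolve c_nstep : comp.

Section Comp.
Context {G : Type} {g : encodable G}.
Lemma c_oD (i : G -> bool) (A : G -> op) :
  computable i -> computable A ->
  computable (fun x => oD (i x) (A x)).
Proof. move=> iP AP; rewrite /oD. comp_tac. Qed.
End Comp.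
#[global] Hint Resolve c_oD : comp.

Section Comp.
Context {G : Type} {g : encodable G}.
Lemma c_oshift (s : G -> nat * nat) (A : G -> op) :
  computable s -> computable A ->
  computable (fun x => oshift (s x) (A x)).
Proof. move=> sP AP; rewrite /oshift. comp_tac. Qed.
End Comp.
#[global] Hint Resolve c_oshift : comp.

Section Comp.
Context {G : Type} {g : encodable G}.
Lemma c_oscale (p : G -> pol) (A : G -> op) :
  computable p -> computable A ->
  computable (fun x => oscale (p x) (A x)).
Proof. move=> pP AP; rewrite /oscale. comp_tac. Qed.
End Comp.
#[global] Hint Resolve c_oscale : comp.

Section Comp.
Context {G : Type} {g : encodable G}.
Lemma c_oneg (A : G -> op) :
  computable A ->
  computable (fun x => oneg (A x)).
Proof. move=> AP; rewrite /oneg. comp_tac. Qed.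
End Comp.
#[global] Hint Resolve c_oneg : comp.

Section Comp.
Context {G : Type} {g : encodable G}.
Lemma c_lmon (A : G -> op) :
  computable A ->
  computable (fun x => lmon (A x)).
Proof. move=> AP; rewrite /lmon. comp_tac. Qed.
End Comp.
#[global] Hint Resolve c_lmon : comp.

Section Comp.
Context {G : Type} {g : encodable G}.
Lemma c_ocoef (t : G -> nat * nat) (A : G -> op) :
  computable t -> computable A ->
  computable (fun x => ocoef (t x) (A x)).
Proof. move=> tP AP; rewrite /ocoef. comp_tac. Qed.
End Comp.
#[global] Hint Resolve c_ocoef : comp.

Section Comp.
Context {G : Type} {g : encodable G}.
Lemma c_otail (t : G -> nat * nat) (A : G -> op) :
  computable t -> computable A ->
  computable (fun x => otail (t x) (A x)).
Proof. move=> tP AP; rewrite /otail. comp_tac. Qed.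
End Comp.
#[global] Hint Resolve c_otail : comp.

Section Comp.
Context {G : Type} {g : encodable G}.
Lemma c_divm (t : G -> nat * nat) (u : G -> nat * nat) :
  computable t -> computable u ->
  computable (fun x => divm (t x) (u x)).
Proof. move=> tP uP; rewrite /divm. comp_tac. Qed.
End Comp.
#[global] Hint Resolve c_divm : comp.

Section Comp.
Context {G : Type} {g : encodable G}.
Lemma c_subm (t : G -> nat * nat) (u : G -> nat * nat) :
  computable t -> computable u ->
  computable (fun x => subm (t x) (u x)).
Proof. move=> tP uP; rewrite /subm. comp_tac. Qed.
End Comp.
#[global] Hint Resolve c_subm : comp.

Section Comp.
Context {G : Type} {g : encodable G}.
Lemma c_lcmm (t : G -> nat * nat) (u : G -> nat * nat) :
  computable t -> computable u ->
  computable (fun x => lcmm (t x) (u x)).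
Proof. move=> tP uP; rewrite /lcmm. comp_tac. Qed.
End Comp.
#[global] Hint Resolve c_lcmm : comp.

Section Comp.
Context {G : Type} {g : encodable G}.
Lemma c_gop (h : G -> gen) :
  computable h ->
  computable (fun x => gop (h x)).
Proof. move=> hP; rewrite /gop. comp_tac. Qed.
End Comp.
#[global] Hint Resolve c_gop : comp.

Section Comp.
Context {G : Type} {g : encodable G}.
Lemma c_ored (h : G -> gen) (t : G -> nat * nat) (A : G -> op) :
  computable h -> computable t -> computable A ->
  computable (fun x => ored (h x) (t x) (A x)).
Proof. move=> hP tP AP; rewrite /ored. comp_tac. Qed.
End Comp.
#[global] Hint Resolve c_ored : comp.

Section Comp.
Context {G : Type} {g : encodable G}.
Lemma c_spair (h : G -> gen) (k : G -> gen) :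
  computable h -> computable k ->
  computable (fun x => spair (h x) (k x)).
Proof. move=> hP kP; rewrite /spair. cbv zeta. comp_tac. Qed.
End Comp.
#[global] Hint Resolve c_spair : comp.

Section Comp.
Context {G : Type} {g : encodable G}.
Lemma c_jstep (s : G -> jstate) : computable s -> computable (fun x => jstep (s x)).
Proof.
move=> sP.
(* The head operator and its leading monomial recur many times; a composition names them so that the
   term stays small. *)
refine (c_comp (f := fun x => (s x, (head [::] (s x).2.1, lmon (head [::] (s x).2.1))))
  (h := fun y : jstate * (op * (nat * nat)) => let s := y.1 in let A := y.2.1 in
    let l := behead s.2.1 in let t := y.2.2 in
    let g := ((ocoef t A, t), otail t A) in
    if nilp s.2.1 then
      (if has (fun g => pos g.1.2 == 0) s.1 then [::] else [:: s.2.2], [::])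
    else if nilp A then ([::], [:: (s.1, (l, s.2.2))])
    else if ~~ nilp [seq g <- s.1 | divm g.1.2 t] then
      ([::], [:: (s.1, (ored (head g [seq g <- s.1 | divm g.1.2 t]) t A :: l, s.2.2))])
    else ([::],
      [:: (s.1, (otail t A :: l, (ocoef t A :: s.2.2.1, s.2.2.2)));
          (g :: s.1, ([seq spair g h | h <- s.1] ++ l,
                      (s.2.2.1, pmul s.2.2.2 (ocoef t A))))])) _ _).
  comp_tac.
cbv zeta; comp_tac.
Qed.
End Comp.
#[global] Hint Resolve c_jstep : comp.

Section Comp.
Context {G : Type} {g : encodable G}.
Lemma c_zpol (p : G -> zpoly) :
  computable p ->
  computable (fun x => zpol (p x)).
Proof. move=> pP; rewrite /zpol. comp_tac. Qed.
End Comp.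
#[global] Hint Resolve c_zpol : comp.

Section Comp.
Context {G : Type} {g : encodable G}.
Lemma c_fracpol {I : Type} {e : encodable I} (j : I -> var) (p : G -> rawpoly I) :
  computable j -> computable p -> computable (fun x => fracpol j (p x)).
Proof. move=> jP pP; rewrite /fracpol. comp_tac. Qed.
End Comp.
#[global] Hint Resolve c_fracpol : comp.

Section Comp.
Context {G : Type} {g : encodable G}.
Lemma c_fracop {T : Type} {e : encodable T} (s : G -> seq ((pol * pol) * T)) :
  computable s -> computable (fun x => fracop (s x)).
Proof. move=> sP; rewrite /fracop. comp_tac. Qed.
End Comp.
#[global] Hint Resolve c_fracop : comp.

Section Comp.
Context {G : Type} {g : encodable G}.
Lemma c_mono_fun (m : G -> bool * seq var) :
  computable m ->
  computable (fun x => mono_fun (m x)).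
Proof. move=> mP; rewrite /mono_fun. comp_tac. Qed.
End Comp.
#[global] Hint Resolve c_mono_fun : comp.

Section Comp.
Context {G : Type} {g : encodable G}.
Lemma c_rawpol {I : Type} {e : encodable I} (i : var -> I) (p : G -> pol) :
  computable i -> computable p -> computable (fun x => rawpol i (p x)).
Proof. move=> iP pP; rewrite /rawpol. comp_tac. Qed.
End Comp.
#[global] Hint Resolve c_rawpol : comp.

(** * The two subroutines *)

Local Open Scope ring_scope.

Lemma enc_raw (I : Type) (e : encodable I) (d : dpoly I) :
  enc_dpoly e d = encode (raw d).
Proof. by elim: d => //= t d IH; rewrite /enc_dpoly /= -/(enc_dpoly e d) IH. Qed.

Lemma enc_map (T U : Type) (e : encodable U) (e' : T -> tree) (f : T -> U) (l : seq T) :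
  (forall t, e' t = encode (f t)) -> enc_seq e' l = encode (map f l).
Proof. by move=> ef; elim: l => //= t l IH; rewrite ef IH. Qed.

Definition rawsystem (I : Type) := (seq (rawpoly I) * rawpoly I)%type.
Definition raw_system (I : Type) (d : dsystem I) : rawsystem I := (map (@raw I) d.1, raw d.2).

Lemma enc_raw_system (I : Type) (e : encodable I) (d : dsystem I) :
  enc_dsystem e d = encode (raw_system d).
Proof.
rewrite /enc_dsystem /enc_pair enc_raw (enc_map (e := enc_seq_inst _) (f := @raw I)) //.
exact: enc_raw.
Qed.

Definition jetx (n : nat) : var := (true, (n, 0)%N).

(** The zero polynomial is the initial pivot: it vanishes everywhere and reduces nothing. Keeping
    the numerators only is sound, as the denominators are nonzero elements of Q(x,y). *)
Definition elim_in (s : rawsystem nat) : seq estate :=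
  [:: ([::], ([seq (fracpol jetx p).1 | p <- s.1], (fracpol jetx s.2).1))].
Definition elim_out (l : seq (pol * pol)) : seq (rawpoly nat * rawpoly nat) :=
  [seq (rawpol (fun v => v.2.1) o.1, rawpol (fun v => v.2.1) o.2) | o <- l].

Lemma c_elim_in : computable elim_in.
Proof.
have jP : computable jetx by rewrite /jetx; comp_tac.
rewrite /elim_in; comp_tac.
Qed.
Lemma c_elim_out : computable elim_out.
Proof.
have jP : computable (fun v : var => v.2.1) by comp_tac.
rewrite /elim_out; comp_tac.
Qed.

Lemma c_estep1 : computable estep.
Proof. exact: (c_estep c_id). Qed.
Lemma c_nstep1 : computable nstep.
Proof. exact: (c_nstep c_id). Qed.
Lemma c_jstep1 : computable jstep.
Proof. exact: (c_jstep c_id). Qed.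

Lemma mderiv_var (i j : 'I_2) : ('X_j : {mpoly rat[2]})^`M(i) = (i == j)%:R.
Proof.
rewrite mderivX mnm1E eq_sym; case: eqP => [->|_]; last by rewrite scale0r.
have -> : (U_(j) - U_(j) = 0 :> 'X_{1..2})%MM by apply/mnmP=> k; rewrite mnmBE subnn mnm0E.
by rewrite scale1r mpolyX0.
Qed.

Lemma valuation_var (K : fieldType) (iota : {rmorphism Qxy -> K}) (d : K -> K) (i : bool)
    (jt : nat * nat -> K) : extends_partial iota d (dir i) ->
  forall a, d (valuation iota jt (false, a)) = pval (valuation iota jt) (dvar i (false, a)).
Proof.
move=> Kd [a b]; rewrite /valuation /dvar /= Kd mderiv_var.
by case: i a {Kd} => -[|a] /=; rewrite ?pval_one ?pval_nil ?tofrac0 ?tofrac1 ?rmorph0 ?rmorph1.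
Qed.

Lemma valuation_ord (K : diffField 1) (iota : {rmorphism Qxy -> K}) (z : K) :
  extends_partial iota (der ord0) ix ->
  let rho := valuation iota (fun t => iter t.1 (der ord0) z) in
  forall v, der ord0 (rho v) = pval rho (dvar false v).
Proof.
move=> Kx rho [[] a]; last exact: (@valuation_var _ _ _ false).
by rewrite /dvar /= pval_var.
Qed.

Lemma dir_jet (F : diffField 2) (f : F) i t : der (dir i) (jet f t) = jet f (bump i t).
Proof.
case: i t => [] [a b] //; rewrite /jet /dir /=.
by elim: a => //= a IH; rewrite derC IH.
Qed.

Lemma valuation_jet (F : diffField 2) (iota : {rmorphism Qxy -> F}) (f : F) :
  extends_partial iota (der ix) ix -> extends_partial iota (der iy) iy ->
  forall i v, der (dir i) (valuation iota (jet f) v) = pval (valuation iota (jet f)) (dvar i v).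
Proof.
move=> Fx Fy i [[] a]; last by apply: valuation_var; case: i.
by rewrite /dvar /= pval_var /valuation /= dir_jet.
Qed.

Lemma char0_ext (K : fieldType) (iota : {rmorphism Qxy -> K}) m : (m.+1)%:R != 0 :> K.
Proof. by rewrite -(rmorph_nat iota) fmorph_eq0 Q_char0. Qed.

Lemma val_frac_eq0 (K : fieldType) (iota : {rmorphism Qxy -> K}) (jt : nat * nat -> K)
    (I : Type) (j : I -> var) (g : I -> K) (d : dpoly I) :
  (forall a, valuation iota jt (j a) = g a) ->
  (dpoly_val iota g d == 0) = (pval (valuation iota jt) (fracpol j (raw d)).1 == 0).
Proof.
move=> jg; have [d0 ->] := val_frac d jg.
by rewrite mulf_eq0 invr_eq0 (negPf d0) orbF.
Qed.

Lemma allv_onlyx (d : rawpoly nat) : allv onlyx (fracpol jetx d).1 /\ allv onlyx (fracpol jetx d).2.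
Proof.
have zx p : allv onlyx (zpol p).
  rewrite /allv all_flatten all_map; apply/allP => t _ /=; rewrite all_map.
  by apply/allP => b _ /=; rewrite all_cat !all_nseq !orbT.
elim: d => //= t d [IH1 IH2]; rewrite allv_cat !allv_mul //=.
by rewrite /allv /= andbT; elim: t.2 => //= a l ->.
Qed.

Lemma ordinary_elimination_exists :
  exists E : program, ordinary_elimination (exec no_subroutine E).
Proof.
have [c1 c1P] := c_elim_in; have [c2 c2P] := c_elim_out.
have [c cP] := exec_runs c_estep1.
exists (Seq (Seq c1 c) c2); split; first by apply: exec_functional => s t u v [].
move=> sys; pose l := elim_in (raw_system sys).
have [o lo] := runs_total (fun s (_ : List.In s l) => estep_acc s).
exists [seq (of_pol (fun v : var => v.2.1) x.1, of_pol (fun v : var => v.2.1) x.2) | x <- o].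
split.
  have -> : forall (A : seq (dpoly nat * dpoly nat)),
     enc_seq (enc_pair (enc_dpoly enc_nat) (enc_dpoly enc_nat)) A =
     encode [seq (raw x.1, raw x.2) | x <- A].
    by move=> A; apply: enc_map => x; rewrite /enc_pair !enc_raw.
  rewrite -map_comp (eq_map (g := fun o : pol * pol =>
    (rawpol (fun v : var => v.2.1) o.1, rawpol (fun v : var => v.2.1) o.2))); last first.
    by move=> x /=; rewrite !raw_of_pol.
  apply: exec_seq (c2P _ o); apply: exec_seq (cP _ _ _ lo).
  by rewrite enc_raw_system; apply: c1P.
move=> K iota Kx _ z f.
pose jt (t : nat * nat) := iter t.1 (der ord0) z.
pose rho := valuation iota jt.
(* With [oky] false nothing is asked in the direction y; the zero map only fills the place. *)
pose dl (i : bool) : K -> K := if i then fun=> 0 else der ord0.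
have dlP i : i ==> false -> derivation (dl i) /\ forall v, dl i (rho v) = pval rho (dvar i v).
  by case: i => // _; split; [exact: derivation_der | exact: valuation_ord].
have jg a : rho (jetx a) = f a by [].
have [] := runs_estep dlP (char0_ext iota) (@iszeroP _ iota jt) lo.
  move=> s [<-|[]]; split=> //; rewrite /dirs /=; apply/orP; left.
  rewrite all_map; apply/allP => d _; exact: (allv_onlyx d).1.
rewrite /= orbF /eholds /= pval_nil eqxx /= => E _.
rewrite /dsystem_holds (val_frac_eq0 _ jg) -/rho.
rewrite (eq_all (a2 := fun d => pval rho (fracpol jetx (raw d)).1 == 0)); last first.
  by move=> d; apply: val_frac_eq0.
move: E; rewrite !all_map => ->; rewrite has_map; apply: eq_has => x /=.
by rewrite /oholds /dsystem_holds /= andbT !(@val_of_pol _ iota jt _ _ f).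
Qed.

Definition raw_eq (e : lin_eq) : seq (rawpoly (nat * nat) * (nat * nat)) :=
  [seq (raw t.1, t.2) | t <- e].
Definition jetxy (t : nat * nat) : var := (true, t).
Definition eq_op (e : seq (rawpoly (nat * nat) * (nat * nat))) : op :=
  (fracop [seq (fracpol jetxy t.1, t.2) | t <- e]).1.
Definition janet_in (l : seq (seq (rawpoly (nat * nat) * (nat * nat)))) : seq jstate :=
  [:: ([::], (map eq_op l, ([::], pone)))].
Definition janet_out (l : seq (seq pol * pol)) : seq (rawsystem (nat * nat)) :=
  [seq ([seq rawpol (fun v => v.2) p | p <- o.1], rawpol (fun v => v.2) o.2) | o <- l].

Lemma c_janet_in : computable janet_in.
Proof.
have jP : computable jetxy by rewrite /jetxy; comp_tac.
have eP : computable eq_op by rewrite /eq_op; comp_tac.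
rewrite /janet_in; comp_tac.
Qed.
Lemma c_janet_out : computable janet_out.
Proof.
have jP : computable (fun v : var => v.2) by comp_tac.
rewrite /janet_out; comp_tac.
Qed.

Lemma enc_raw_eq (e : lin_eq) : enc_lin_eq e = encode (raw_eq e).
Proof.
by apply: enc_map => t; rewrite /enc_pair enc_raw.
Qed.

(** A genuine jet has zero twist, so a function that satisfies an equation also satisfies all its
    derivatives. *)
Lemma annih_closed (K : fieldType) (rho : var -> K) (dl : bool -> K -> K)
    (dP : forall i, derivation (dl i))
    (vP : forall i v, dl i (rho v) = pval rho (dvar i v))
    (dC : forall a, dl false (dl true a) = dl true (dl false a)) f L :
  (forall i t, f (bump i t) = dl i (f t)) ->
  (forall A, List.In A L -> pr rho A f = 0) -> annih rho f L.
Proof.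
move=> fP LP A s AL.
have tw0 i B : pr rho B (tw dl i f) = 0.
  by rewrite /pr big1 // => c _; rewrite /tw fP subrr mulr0.
have step i t : pr rho (oshift t A) f = 0 -> pr rho (oshift (bump i t) A) f = 0.
  by rewrite (pr_shiftS dP vP dC) tw0 addr0 => ->; rewrite (deriv0 (dP i)).
case: s => a b; elim: a => [|a IH]; last exact: (step false (a, b)).
elim: b => [|b IH]; last exact: (step true (0%N, b)).
exact: LP.
Qed.

Lemma allP_In (T : Type) (a : T -> bool) (l : seq T) :
  reflect (forall x, List.In x l -> a x) (all a l).
Proof.
apply: (iffP idP).
  by elim: l => //= x l IH /andP[ax /IH al] y [<- //|/al].
by elim: l => //= x l IH H; rewrite H ?IH //; [move=> y yl; apply: H; right|left].
Qed.

Section Janet.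
Variables (F : diffField 2) (iota : {rmorphism Qxy -> F}).
Hypothesis F_universal : universal F.
Hypothesis F_dx : extends_partial iota (der ix) ix.
Hypothesis F_dy : extends_partial iota (der iy) iy.

Lemma eq_opP (f : F) (e : lin_eq) : exists2 c : F, c != 0 & forall h : F,
  pr (valuation iota (jet f)) (eq_op (raw_eq e)) (jet h) = c * lin_eq_val iota f h e.
Proof.
set rho := valuation _ _.
have jg a : rho (jetxy a) = jet f a by [].
have [|D0 E] := @val_fracop F iota (jet f) _ [seq (fracpol jetxy t.1, t.2) | t <- raw_eq e].
  move=> t; rewrite /raw_eq -map_comp => /List.in_map_iff[u [<- _]] /=.
  by have [] := val_frac u.1 jg.
exists (pval rho (fracop [seq (fracpol jetxy t.1, t.2) | t <- raw_eq e]).2) => // h.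
rewrite /pr E; congr (_ * _); rewrite /lin_eq_val /raw_eq -map_comp big_map.
by apply: eq_bigr => t _ /=; have [_ ->] := val_frac t.1 jg.
Qed.

(** The completion decides whether a formal solution with nonzero value at order 0 exists. Forms
    take their values in [F] itself, so a solution [h != 0] yields the form [jet h], whose value at
    order 0 is [h]; conversely [universal_solve] turns a form into a function. *)
Lemma parametric_janet_base_exists :
  exists J : program, parametric_janet_base iota (exec no_subroutine J).
Proof.
have [c1 c1P] := c_janet_in; have [c2 c2P] := c_janet_out.
have [c cP] := exec_runs c_jstep1.
exists (Seq (Seq c1 c) c2); split; first by apply: exec_functional => s t u v [].
move=> sys; pose l := janet_in (map raw_eq sys).
have [o lo] := runs_total (fun s (_ : List.In s l) => jstep_acc s).
pose i (v : var) := v.2.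
exists [seq ([seq of_pol i p | p <- x.1], of_pol i x.2) | x <- o].
split.
  have -> : forall (A : seq (dsystem (nat * nat))),
     enc_seq (enc_dsystem enc_nat2) A = encode (map (@raw_system _) A).
    by move=> A; apply: enc_map => x; exact: (enc_raw_system (enc_pair_inst _ _)).
  rewrite -map_comp (eq_map (g := fun o : seq pol * pol =>
    ([seq rawpol i p | p <- o.1], rawpol i o.2))); last first.
    move=> x /=; rewrite /raw_system /= -map_comp raw_of_pol; congr (_, _).
    by apply: eq_map => p /=; rewrite raw_of_pol.
  apply: exec_seq (c2P _ o); apply: exec_seq (cP _ _ _ lo).
  by rewrite (enc_map _ enc_raw_eq); apply: c1P.
move=> f; pose rho := valuation iota (jet f).
pose dl (j : bool) : F -> F := der (dir j).
have dlP j : derivation (dl j) by exact: derivation_der.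
have vP j v : dl j (rho v) = pval rho (dvar j v) by exact: valuation_jet.
have dC (a : F) : dl false (dl true a) = dl true (dl false a) by exact: derC.
have [] := runs_jstep dlP vP dC lo.
  by move=> s [<-|[]]; split.
have -> : has (jcond rho) o = has (dsystem_holds iota (jet f))
    [seq ([seq of_pol i p | p <- x.1], of_pol i x.2) | x <- o].
  rewrite has_map; apply: eq_has => x /=.
  rewrite /jcond /dsystem_holds /= all_map (val_of_pol _ (jt := jet f)) //; congr (_ && _).
  by apply: eq_all => p /=; rewrite (val_of_pol _ (jt := jet f)).
move=> H1 H2; split=> [[h h0 hs]|/H2[s [<-|[]] [_ [g g0 gs]]]].
  apply: H1; exists ([::], (map eq_op (map raw_eq sys), ([::], pone))); first by left.
  split; first by rewrite /jcond /= pval_one oner_neq0.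
  exists (jet h) => //.
  apply: (annih_closed dlP vP dC) => [i' t|A]; first by rewrite /dl dir_jet.
  rewrite /ops /= => /List.in_map_iff[_ [<- /List.in_map_iff[e [<- esys]]]].
  have [d _ ->] := eq_opP f e.
  by move: hs => /allP_In/(_ e esys)/eqP ->; rewrite mulr0.
have [h h0 hs] := universal_solve (char0_ext iota) F_universal vP g0 gs.
exists h => //; apply/allP_In => e esys.
have [d d0 /(_ h)] := eq_opP f e.
rewrite hs; last by rewrite /ops /=; apply: List.in_map; apply: List.in_map.
by move/esym/eqP; rewrite mulf_eq0 (negPf d0).
Qed.
End Janet.

(** * Algebraic systems over Q(x,y) *)

Lemma rk_lvar_le k p : (rk (lvar p) <= k)%N = allv (fun w => rk w <= k)%N p.
Proof.
apply/idP/idP => [h|]; first by apply: allv_sub (lvar_max p) => v /leq_trans; apply.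
rewrite /lvar; elim: p => //= m p IH /andP[hm {}/IH IH].
elim: m.2 hm => //= v vs IHv /andP[hv /IHv {}IHv].
by case: ltnP.
Qed.

Definition uvar : var := (true, (0, 0)%N).

Lemma rk1_uvar v : rk v = 1%N -> v = uvar.
Proof. exact: (@rk_jet uvar). Qed.

(* Polynomials in x, y and the unknown itself, over Q(x,y). *)
Definition cval (v : var) : Qxy := valuation idfun (fun=> 0) v.
Definition cst (p : pol) : Qxy := pval cval p.
Definition hvar (v : var) : {poly Qxy} := if v.1 then 'X else (cval v)%:P.
(** Faithful only in rank at most 1, since every derivative of the unknown is sent to the same
    indeterminate. *)
Definition hat (p : pol) : {poly Qxy} := pval hvar p.

Lemma iszero_cst p : rk (lvar p) = 0%N -> iszero p = (cst p == 0).
Proof. exact: iszeroP. Qed.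

Lemma coefp_low v p : (rk (lvar p) <= rk v)%N -> forall e, (rk (lvar (coefp v e p)) <= (rk v).-1)%N.
Proof.
rewrite rk_lvar_le => h e; rewrite rk_lvar_le /allv all_map; apply/allP => m.
rewrite mem_filter => /andP[_ mp] /=; rewrite all_filter.
by apply: sub_all (allP h m mp) => w wv; apply/implyP; lia.
Qed.

Lemma rk_coefp p e : (rk (lvar p) <= 1)%N -> rk (lvar (coefp uvar e p)) = 0%N.
Proof. by move=> /(@coefp_low uvar)/(_ e); rewrite leqn0 => /eqP. Qed.

Lemma hat_low p : rk (lvar p) = 0%N -> hat p = (cst p)%:P.
Proof.
move=> p0; have : allv (fun w => rk w <= 0)%N p by rewrite -rk_lvar_le p0.
rewrite /hat /cst => low; rewrite (pval_morph polyC) /pval !big_seq.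
apply: eq_bigr => m /(allP low) mP; congr (_ * _); rewrite !big_seq.
by apply: eq_bigr => -[[] t] /(allP mP).
Qed.

Lemma coef_sign_monomial (R : comNzRingType) b (c : R) k e :
  ((-1) ^+ b * (c%:P * 'X^k))`_e = if k == e then (-1) ^+ b * c else 0.
Proof.
have -> : (-1) ^+ b = ((-1) ^+ b)%:P :> {poly R} by rewrite polyC_exp polyCN.
by rewrite mulrA -polyCM coefCM coefXn eq_sym; case: eqP; rewrite ?mulr1 ?mulr0.
Qed.

Lemma coef_hat p e : (rk (lvar p) <= 1)%N -> (hat p)`_e = cst (coefp uvar e p).
Proof.
rewrite rk_lvar_le => low; rewrite /hat /cst /pval coef_sum big_map big_filter.
rewrite [RHS]big_mkcond !big_seq; apply: eq_bigr => m /(allP low) mP.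
rewrite /mval; have -> : \prod_(v <- m.2) hvar v =
    (\prod_(v <- [seq w <- m.2 | rk w != rk uvar]) cval v)%:P * 'X^(deg uvar m.2).
  rewrite /deg; elim: m.2 mP => [|v vs IH] /=; first by rewrite !big_nil mulr1.
  move=> /andP[v1 /IH {}IH]; rewrite big_cons IH.
  case: (eqVneq (rk v) (rk uvar)) => [/rk1_uvar ->|vu] /=; first by rewrite exprS mulrCA.
  rewrite big_cons polyCM mulrA; case: v v1 vu => [[] t] //=.
  by rewrite /rk /= ltnS leqn0 => /eqP ->.
exact: coef_sign_monomial.
Qed.

Lemma deriv_derivation (R : comNzRingType) : derivation (@deriv R).
Proof. by split; [exact: poly.derivD | exact: poly.derivM]. Qed.

Lemma hat_sep p : (rk (lvar p) <= 1)%N -> hat (sep uvar p) = (hat p)^`().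
Proof.
rewrite rk_lvar_le => low; rewrite /hat pval_sep // (der_pval _ _ (@deriv_derivation _)).
apply: dsem_ext low => v v1; rewrite /hvar; case: eqVneq => [->|vu]; first by rewrite derivX.
case: v v1 vu => [[] t] /=; last by rewrite derivC.
move=> h; case/eqP; apply: rk1_uvar; move: h; rewrite /rk /= ltnS leqn0 => /eqP -> //.
Qed.

Lemma rk_sep k p : (rk (lvar p) <= k)%N -> (rk (lvar (sep uvar p)) <= k)%N.
Proof.
rewrite !rk_lvar_le; apply: allv_der => // v _; by case: ifP.
Qed.

Lemma coefp_nil v e p : (pdeg v p < e)%N -> coefp v e p = [::].
Proof.
move=> lt; rewrite /coefp (eq_in_filter (a2 := pred0)) ?filter_pred0 //.
by move=> m /(allP (pdegP v p)) le; apply/eqP => e'; move: le; rewrite e' leqNgt lt.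
Qed.

Lemma size_hat p : (rk (lvar p) <= 1)%N -> (size (hat p) <= (pdeg uvar p).+1)%N.
Proof.
move=> p1; apply/leq_sizeP => e lt; rewrite coef_hat // coefp_nil //; exact: pval_nil.
Qed.

Lemma lvar1 p : rk (lvar p) = 1%N -> lvar p = uvar. Proof. exact: rk1_uvar. Qed.

Lemma pdeg0 p : (rk (lvar p) <= 1)%N -> (0 < pdeg uvar p)%N = (rk (lvar p) == 1)%N.
Proof.
move=> p1; apply/idP/eqP => [|e]; last by rewrite -(lvar1 e); apply: pdeg_lvar; rewrite e.
case E : (rk (lvar p)) p1 => [|[|//]] // _; rewrite ltnNge => /negP[].
have := leqnn (rk (lvar p)); rewrite {2}E rk_lvar_le /pdeg.
elim: (p) => //= m q IH /andP[mP {}/IH IH]; rewrite geq_max IH andbT leqn0.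
by rewrite -[_ == _]negbK -lt0n -has_count; apply/hasPn => w /(allP mP); case: (rk w).
Qed.

(** The syntactic degree is the true one. The programs see only the former, whereas divisibility
    depends on the latter. *)
Definition tight p := cst (coefp uvar (pdeg uvar p) p) != 0.

Lemma pdeg_sep p : (rk (lvar p) <= 1)%N -> (0 < pdeg uvar p)%N ->
  (pdeg uvar (sep uvar p) < pdeg uvar p)%N.
Proof.
move=> p1 p0; have := p0; rewrite pdeg0 // => /eqP lp.
have s1 := rk_sep p1; case: (posnP (pdeg uvar (sep uvar p))) => [-> //|sp].
have := sp; rewrite pdeg0 // => /eqP ls.
case E : (pdeg uvar p) p0 => [//|e] _.
have E' : pdeg (lvar p) p = e.+1 by rewrite lvar1.
have b := bd_sep E'; rewrite (lvar1 lp) in b.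
by have := bd_ltp (leqnn 1) b; rewrite /ltp /prk (lvar1 ls).
Qed.

Lemma coef_deriv_neq0 (K : fieldType) (char0 : forall n, (n.+1)%:R != 0 :> K)
    (p : {poly K}) d : (0 < d)%N -> p`_d != 0 -> p^`()`_d.-1 != 0.
Proof. by case: d => // d _ pd; rewrite coef_deriv -mulr_natr mulf_neq0. Qed.

(** In characteristic 0 the true degree drops by exactly one; the syntactic degree drops by at least
    one and bounds the true one, so the two still agree. *)
Lemma tight_sep p : (rk (lvar p) <= 1)%N -> (0 < pdeg uvar p)%N -> tight p ->
  tight (sep uvar p).
Proof.
move=> p1 p0; have lt := pdeg_sep p1 p0; have s1 := rk_sep p1.
rewrite /tight -(coef_hat _ s1) -(coef_hat _ p1) (hat_sep p1) => t.
have c0 := coef_deriv_neq0 Q_char0 p0 t.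
suff -> : pdeg uvar (sep uvar p) = (pdeg uvar p).-1 by [].
apply/eqP; rewrite eqn_leq; apply/andP; split; first by rewrite -ltnS prednK.
rewrite leqNgt; apply/negP => lt'; move: c0.
by rewrite -(hat_sep p1) (coef_hat _ s1) (coefp_nil lt') /cst pval_nil eqxx.
Qed.

Lemma tight_size p : (rk (lvar p) <= 1)%N -> tight p -> size (hat p) = (pdeg uvar p).+1.
Proof.
move=> p1; rewrite /tight -(coef_hat _ p1) => t; apply/eqP; rewrite eqn_leq (size_hat p1) /=.
rewrite ltnNge; apply/negP => le; move/eqP: t; apply; exact: nth_default.
Qed.

Lemma tight_iter p m : (rk (lvar p) <= 1)%N -> tight p ->
  let r := iter m (sep uvar) p in rk (lvar r) = 1%N -> tight r.
Proof.
move=> p1 tp /=; have : (rk (lvar (iter m (sep uvar) p)) <= 1)%N.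
  by elim: m => // m; apply: rk_sep.
elim: m => [|m IH]; first exact: (fun _ _ => tp).
set r := iter m _ _ in IH *; rewrite -[iter _ _ _]/(sep uvar r).
have r1 : (rk (lvar r) <= 1)%N by rewrite /r; elim: (m) => // k; apply: rk_sep.
move=> s1 s1'; have : rk (lvar r) = 1%N.
  apply/eqP; rewrite eqn_leq r1 ltnNge; apply/negP => /rk_sep.
  by rewrite s1'.
move=> lr; apply: (tight_sep r1 _ (IH r1 lr)).
by rewrite (pdeg0 r1) lr.
Qed.

Section Eval.
Variables (F : diffField 2) (iota : {rmorphism Qxy -> F}).

Lemma val_hat (f : F) p : (rk (lvar p) <= 1)%N ->
  pval (valuation iota (jet f)) p = (map_poly iota (hat p)).[f].
Proof.
rewrite rk_lvar_le => low.
have -> : (map_poly iota (hat p)).[f] = pval (horner_eval f \o map_poly iota \o hvar) p.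
  rewrite -(pval_morph (horner_eval f \o map_poly iota)) //=.
rewrite /pval !big_seq; apply: eq_bigr => m /(allP low) mP.
congr (_ * _); rewrite !big_seq; apply: eq_bigr => v /(allP mP).
case: v => [[] t] /=; rewrite /hvar /horner_eval /=.
  by rewrite /rk /= ltnS leqn0 => /eqP /(@pos_inj t (0, 0)%N) ->; rewrite map_polyX hornerX.
by rewrite map_polyC hornerC.
Qed.

Lemma val_cst (f : F) p : rk (lvar p) = 0%N ->
  pval (valuation iota (jet f)) p = iota (cst p).
Proof.
by move=> p0; rewrite val_hat ?p0 // hat_low // map_polyC hornerC.
Qed.

Hypothesis F_universal : universal F.
Hypothesis F_dx : extends_partial iota (der ix) ix.
Hypothesis F_dy : extends_partial iota (der iy) iy.

(** Divide [R] by its gcd with [Q], which is nonconstant as long as [R] is: each division lowers the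
    degree and uses up one factor [Q]. *)
Lemma dvdp_pow (R Q : {poly Qxy}) n : R != 0 -> (size R <= n.+1)%N ->
  (forall P, P %| R -> coprimep P Q -> (size P <= 1)%N) -> R %| Q ^+ n.
Proof.
elim: n R => [|n IH] R R0 sR H.
  by rewrite expr0 dvdp1 eqn_leq sR size_poly_gt0.
have [s1|s1] := leqP (size R) 1.
  have : size R = 1%N by apply/eqP; rewrite eqn_leq s1 size_poly_gt0.
  by move/eqP; rewrite -dvdp1 => /dvdp_trans; apply; rewrite dvd1p.
have ncp : ~~ coprimep R Q.
  by apply/negP => cp; have := H R (dvdpp R) cp; rewrite leqNgt s1.
set G := gcdp R Q in ncp; have GR : G %| R := dvdp_gcdl _ _.
have G0 : G != 0 by apply: dvdpN0 GR R0.
have [R' RE] := dvdpP _ _ GR.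
have R'0 : R' != 0 by apply: contraNneq R0; rewrite RE => ->; rewrite mul0r.
have G1 : (1 < size G)%N.
  by move: ncp; rewrite /coprimep -/G ltn_neqAle eq_sym => ->; rewrite size_poly_gt0.
rewrite exprSr RE; apply: dvdp_mul; last exact: dvdp_gcdr.
apply: IH => // [|P PR cP].
  move: sR G1; rewrite {1}RE size_mul //.
  by move: (size R') (size G) => a b; lia.
by apply: H cP; rewrite RE; apply: dvdp_mulr.
Qed.

(** If [R] does not divide the power, some nonconstant factor of [R] is coprime to [Q], and none of
    its roots in [F] is a root of [Q]. *)
Lemma root_avoiding (R Q : {poly Qxy}) : R != 0 -> ~~ (R %| Q ^+ (size R).-1) ->
  exists2 f : F, root (map_poly iota R) f & (map_poly iota Q).[f] != 0.
Proof.
move=> R0 nd; have [P [PR cP P1]] : exists P, [/\ P %| R, coprimep P Q & (1 < size P)%N].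
  apply/not_existsP => H; case/negP: nd; apply: dvdp_pow => // [|P PR cP].
    by rewrite prednK // size_poly_gt0.
  by rewrite leqNgt; apply/negP => P1; apply: (H P).
have [f fP] := universal_root F_dx F_dy F_universal P1.
exists f; first by have [A ->] := dvdpP _ _ PR; rewrite rmorphM rootM fP orbT.
by apply: (coprimep_root _ fP); rewrite coprimep_map.
Qed.
End Eval.

Lemma runs_has (S O : Type) (step : S -> seq O * seq S) (P A : S -> Prop) (B : O -> Prop) :
  (forall s, P s ->
     (A s <-> (exists2 x, List.In x (step s).1 & B x) \/
              (exists2 s', List.In s' (step s).2 & A s')) /\
     forall s', List.In s' (step s).2 -> P s') ->
  forall l o, runs step l o -> (forall s, List.In s l -> P s) ->
  (exists2 s, List.In s l & A s) <-> (exists2 x, List.In x o & B x).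
Proof.
move=> H l o; elim=> [|s {}l {}o _ IH] inv; first by split=> -[].
have [As Ps] := H s (inv s (or_introl (erefl _))).
have {}IH := IH (fun s' => _); have [|IH1 IH2] := IH.
  by move=> s' /List.in_app_iff[/Ps|s'l] //; apply: inv; right.
split=> [[s' [<-|s'l] As']|[x /List.in_app_iff[xs|xo] Bx]].
- have [[x xs Bx]|[s'' s''s As'']] := As.1 As'.
    by exists x => //; apply/List.in_app_iff; left.
  have [|x xo Bx] := IH1; first by exists s'' => //; apply/List.in_app_iff; left.
  by exists x => //; apply/List.in_app_iff; right.
- have [|x xo Bx] := IH1; first by exists s' => //; apply/List.in_app_iff; right.
  by exists x => //; apply/List.in_app_iff; right.
- by exists s; [left | apply/As; left; exists x].
have [|s' /List.in_app_iff[s's|s'l] As'] := IH2; first by exists x.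
  by exists s; [left | apply/As; right; exists s'].
by exists s' => //; right.
Qed.

Definition initp (r : pol) : pol := coefp (lvar r) (pdeg (lvar r) r) r.
Definition nonzero (q : pol) : bool :=
  has (fun m => ~~ iszero (coefp uvar (deg uvar m.2) q)) q.

Lemma hat_neq0 q : (rk (lvar q) <= 1)%N -> (hat q != 0) = nonzero q.
Proof.
move=> q1; apply/idP/hasP => [|[m mq nz]]; last first.
  apply: contraNneq nz => h0; rewrite (iszero_cst (rk_coefp _ q1)) -(coef_hat _ q1).
  by rewrite h0 coef0.
apply: contra_neqP => no; apply/polyP => e; rewrite (coef_hat _ q1) coef0.
have [/hasP[m mq /eqP <-]|/hasPn hq] := boolP (has (fun m => deg uvar m.2 == e) q).
  apply/eqP; rewrite -(iszero_cst (rk_coefp _ q1)); apply/negPn/negP => nz.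
  by apply: no; exists m.
rewrite /coefp (eq_in_filter (a2 := pred0)) ?filter_pred0; first exact: pval_nil.
by move=> m /hq /negPf.
Qed.

Section Norm.
Variables (F : diffField 2) (iota : {rmorphism Qxy -> F}).
Hypothesis F_universal : universal F.
Hypothesis F_dx : extends_partial iota (der ix) ix.
Hypothesis F_dy : extends_partial iota (der iy) iy.

Let vl (f : F) := pval (valuation iota (jet f)).
Let dl (i : bool) := @der _ F (dir i).

Fact der_ok (f : F) i : i ==> true ->
  derivation (dl i) /\ forall v, dl i (valuation iota (jet f) v) = vl f (dvar i v).
Proof. by move=> _; split; [exact: derivation_der | exact: valuation_jet]. Qed.

Fact zero_ok (f : F) p : rk (lvar p) = 0%N -> iszero p = (vl f p == 0).
Proof. exact: iszeroP. Qed.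

Definition solvable (r q : pol) : Prop := exists2 f, vl f r = 0 & vl f q != 0.

(** The third clause lets reduction multiply by the separant without losing solutions. The fourth,
    valid once the power has been taken, records the one implication that nondivisibility does not
    give by itself. *)
Definition ninv (s : nstate) : Prop := let r := s.1.1 in let q := s.1.2 in
  [/\ rk (lvar r) = 1%N, tight r,
      forall f, vl f r = 0 -> vl f q != 0 -> vl f (sep uvar r) != 0 &
      s.2 -> (rk (lvar q) <= 1)%N /\ (~~ (hat r %| hat q) -> solvable r q)].

Lemma val_init f r : rk (lvar r) = 1%N -> tight r -> vl f (initp r) != 0.
Proof.
move=> r1 tr; rewrite /initp (lvar1 r1) /vl (val_cst iota f (rk_coefp _ _)) ?r1 //.
by rewrite fmorph_eq0.
Qed.

Lemma cancel_hat (R : comNzRingType) (I1 I2 A B X : R) d e : (d <= e)%N ->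
  I1 * B - I2 * (X ^+ (e - d) * A) =
  I1 * (I2 * X ^+ e + B) - I2 * X ^+ (e - d) * (I1 * X ^+ d + A).
Proof.
move=> le; have -> : X ^+ e = X ^+ (e - d) * X ^+ d by rewrite -exprD subnK.
by move: (X ^+ _) (X ^+ d) => Y Z; ring.
Qed.

(** On polynomials in the unknown alone, [red] subtracts a multiple of [r] from [q] scaled by the
    initial of [r], a nonzero constant of Q(x,y) by tightness. *)
Lemma dvd_red r q : rk (lvar r) = 1%N -> tight r -> (rk (lvar q) <= 1)%N ->
  reducible r q -> (hat r %| hat (red r q)) = (hat r %| hat q).
Proof.
move=> r1 tr q1 rq; have r1' : (rk (lvar r) <= 1)%N by rewrite r1.
move: rq; rewrite /reducible r1 /= /ltp /prk r1 negb_or -leqNgt => /andP[lq].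
have lq1 : rk (lvar q) = 1%N by apply/eqP; rewrite eqn_leq q1.
rewrite lq1 eqxx /= -leqNgt (lvar1 r1) (lvar1 lq1) => le.
have E : hat (red r q) = hat (coefp uvar (pdeg uvar r) r) * hat q -
    hat (coefp uvar (pdeg uvar q) q) * 'X ^+ (pdeg uvar q - pdeg uvar r) * hat r.
  rewrite /red r1 lq1 eqxx (lvar1 r1) (lvar1 lq1) /hat /cancel pval_cat pval_neg !pval_mul pval_mulv.
  rewrite [X in _ = _ * X - _](@pval_coef_tail _ hvar uvar (pdeg uvar q)) //.
  rewrite [X in _ = _ - _ * X](@pval_coef_tail _ hvar uvar (pdeg uvar r)) //.
  exact: cancel_hat.
have c0 := rk_coefp (pdeg uvar r) r1'.
rewrite (hat_low c0) in E.
by rewrite E (dvdp_subl _ (dvdp_mull _ (dvdpp _))) mul_polyC dvdpZr.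
Qed.

Lemma rk_red r q : (rk (lvar q) <= 1)%N -> reducible r q -> (rk (lvar (red r q)) <= 1)%N.
Proof.
by move=> q1 /red_lt; rewrite /ltp /prk /= => /orP[/ltnW|/andP[/eqP ->]] // /leq_trans; apply.
Qed.

Lemma pval_pexp (R : comNzRingType) (rho : var -> R) q d :
  pval rho (pexp q d) = pval rho q ^+ d.
Proof. by elim: d => [|d IH]; rewrite ?pval_one // exprS -IH -pval_mul. Qed.

Lemma rk_pexp q d : (rk (lvar q) <= 1)%N -> (rk (lvar (pexp q d)) <= 1)%N.
Proof.
by rewrite !rk_lvar_le => q1; elim: d => // d; apply: allv_mul.
Qed.

Lemma solvable_hat r q f : (rk (lvar r) <= 1)%N -> (rk (lvar q) <= 1)%N ->
  root (map_poly iota (hat r)) f -> (map_poly iota (hat q)).[f] != 0 -> solvable r q.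
Proof.
move=> r1 q1 rf qf; exists f; rewrite /vl (val_hat iota f) //; exact/eqP.
Qed.

(** The first phase removes the derivatives of the unknown from [q]. After the second, [q] has
    smaller degree than [r], so that [r] fails to divide it exactly when it is nonzero, which a
    program can test. *)
Lemma nstep_ok s : ninv s ->
  (solvable s.1.1 s.1.2 <-> (exists2 x, List.In x (nstep s).1 & nonzero x.2) \/
     (exists2 s', List.In s' (nstep s).2 & solvable s'.1.1 s'.1.2)) /\
  forall s', List.In s' (nstep s).2 -> ninv s'.
Proof.
case: s => -[r q] b [/= r1 tr sr bq]; rewrite /nstep /=.
have r1' : (rk (lvar r) <= 1)%N by rewrite r1.
case: ifP => rq.
  have vr f : vl f r = 0 -> exists2 c, (vl f (sep uvar r) != 0 -> c != 0) &
      vl f (red r q) = c * vl f q.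
    move=> rf; have dr : dirs true r [:: q] by rewrite /dirs r1 orbT.
    have [c c0 E] := val_red (der_ok f) dr rq rf.
    exists c => // sf; apply: c0; first exact: val_init.
    by rewrite (lvar1 r1).
  have sol : solvable r q <-> solvable r (red r q).
    split=> -[f rf qf]; exists f => //; have [c c0 E] := vr f rf; rewrite E in qf *.
      by rewrite mulf_neq0 // c0 // sr.
    by apply: contraNneq qf => ->; rewrite mulr0.
  split=> [|s' [<-|[]]] /=.
    split=> [/sol h|[[x []]|[s' [<-|[]] /sol h]]] //.
    by right; exists ((r, red r q), b) => //; left.
  split=> // [f rf qf|/bq[q1 nd]].
    apply: sr => //; have [c _ E] := vr f rf.
    by apply: contraNneq qf; rewrite E => ->; rewrite mulr0.
  by split; [exact: rk_red | rewrite dvd_red // => /nd /sol].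
case: ifP => /= [bT|/negbT bF].
  rewrite bT in bq; have [q1 nd] := bq isT; split=> //.
  rewrite -[solvable r q](_ : (hat q != 0 : Prop) = _); last first.
    apply/propext; split=> [q0|[f _]]; last first.
      by apply: contraNneq => q0; rewrite /vl (val_hat iota f q1) q0 rmorph0 horner0.
    apply: nd; apply/negP => /(dvdp_leq q0); rewrite (tight_size r1' tr) leqNgt => /negP[].
    apply: leq_ltn_trans (size_hat q1) _; rewrite ltnS.
    move: rq; rewrite /reducible r1 /= /ltp /prk r1 => /negbFE/orP[|/andP[/eqP lq]].
      rewrite ltnS leqn0 => /eqP /= lq; rewrite (_ : pdeg uvar q = 0)%N ?pdeg0 ?r1 //.
      by apply/eqP; rewrite -leqn0 leqNgt pdeg0 // lq.
    by rewrite /= in lq *; rewrite (lvar1 r1) (lvar1 lq).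
  rewrite (hat_neq0 q1); split=> [nq|[[x [<-|[]]]|[s' []]]] //.
  by left; exists (r, q) => //; left.
set d := pdeg (lvar r) r.
have d0 : (0 < d)%N by rewrite /d (lvar1 r1) pdeg0 ?r1.
have vq f : (vl f (pexp q d) != 0) = (vl f q != 0).
  by rewrite /vl pval_pexp expf_eq0 d0.
split=> [|s' [<-|[]]] /=.
  have sol : solvable r q <-> solvable r (pexp q d).
    by split=> -[f rf qf]; exists f => //; move: qf; rewrite vq.
  split=> [/sol h|[[x []]|[s' [<-|[]] /sol h]]] //.
  by right; exists ((r, pexp q d), true) => //; left.
have q1 : (rk (lvar q) <= 1)%N.
  move: rq; rewrite /reducible r1 /= /ltp /prk r1 => /negbFE/orP[/ltnW|/andP[/eqP /= ->]] //.
split=> // [f rf|_]; first by rewrite vq; exact: sr.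
split=> [|nd]; first exact: rk_pexp.
(* Tightness also makes [d] the true degree of [hat r], the exponent that [root_avoiding]
   expects. *)
have R0 : hat r != 0 by rewrite -size_poly_gt0 (tight_size r1' tr).
have [|f rf qf] := root_avoiding F_universal F_dx F_dy (R := hat r) (Q := hat q) R0.
  rewrite (tight_size r1' tr) /= -(lvar1 r1) -/d.
  by move: nd; rewrite {2}/hat pval_pexp.
by have [g rg qg] := solvable_hat r1' q1 rf qf; exists g => //; rewrite vq.
Qed.

(* The successive derivatives of [p], each with the list of the previous ones. *)
Definition dch (p : pol) m : pol * seq pol :=
  iter m (fun x => (sep uvar x.1, x.1 :: x.2)) (p, [::]).
Definition dchain n (p : pol) : seq (pol * seq pol) :=
  iter n (fun l => let x := head (p, [::]) l in (sep uvar x.1, x.1 :: x.2) :: l) [:: (p, [::])].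

(** The m-th state concerns the roots of [p] of multiplicity exactly m + 1: the derivatives of order
    below m are equations, the m-th is the pivot, and its separant, the next derivative, divides the
    inequation. At such roots the pivot is simple, as reduction of the derivatives of the unknown
    requires. *)
Definition states n p (out : seq (seq pol * pol)) : seq estate :=
  flatten [seq [seq (x.1, (x.2 ++ o.1, pmul o.2 (pmul (initp x.1) (sep (lvar x.1) x.1))))
               | x <- dchain n p & rk (lvar x.1) == 1%N] | o <- out].

Lemma dchain_In n p x : List.In x (dchain n p) <-> exists2 m, (m <= n)%N & x = dch p m.
Proof.
have hd k : head (p, [::]) (dchain k p) = dch p k.
  by elim: k => //= k; rewrite /dch /= => ->.
elim: n => [|n IH]; first by split=> [[<-|[]]|[[|//] _ ->]]; [exists 0%N | left].
rewrite /dchain [iter _ _ _]/= -/(dchain n p) hd; split=> [[<-|/IH[m le ->]]|[m]].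
- by exists n.+1.
- by exists m => //; apply: leqW.
rewrite leq_eqVlt => /orP[/eqP mE|lt] xE; last first.
  by right; apply/IH; exists m; [rewrite -ltnS | exact: xE].
by left; rewrite xE mE.
Qed.

Lemma dch1 p m : (dch p m).1 = iter m (sep uvar) p.
Proof. by elim: m => //= m ->. Qed.
Lemma dch2 (a : pol -> bool) p m : all a (dch p m).2 <-> forall k, (k < m)%N -> a (iter k (sep uvar) p).
Proof.
elim: m => [|m IH]; first by split.
rewrite /dch iterS -/(dch p m) /= dch1; split=> [/andP[am /IH al] k|H].
  by rewrite ltnS leq_eqVlt => /orP[/eqP ->|/al].
by rewrite H //; apply/IH => k km; apply/H/ltnW.
Qed.

Lemma derivn_nroot (K : fieldType) (char0 : forall n, (n.+1)%:R != 0 :> K) (a : K) n (p : {poly K}) :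
  p != 0 -> (size p <= n.+1)%N -> exists2 k, (k <= n)%N & (iter k (@deriv K) p).[a] != 0.
Proof.
elim: n p => [|n IH] p p0 sp.
  exists 0%N => //=; rewrite (size1_polyC sp) hornerC.
  by apply: contraNneq p0 => p0; rewrite (size1_polyC sp) p0.
have [s1|s1] := leqP (size p) 1.
  exists 0%N => //=; rewrite (size1_polyC s1) hornerC.
  by apply: contraNneq p0 => p0; rewrite (size1_polyC s1) p0.
have p'0 : p^`() != 0.
  apply/eqP => /(congr1 (fun q : {poly K} => q`_(size p).-1.-1)); rewrite coef0 => /eqP.
  apply/negP; apply: coef_deriv_neq0 char0 _ _ _ _; first by rewrite -ltnS prednK // ltnW.
  by rewrite -lead_coefE lead_coef_eq0.
have [|k kn ka] := IH _ p'0.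
  by rewrite -ltnS; apply: leq_trans (lt_size_deriv p0) sp.
by exists k.+1 => //; rewrite iterSr.
Qed.

Lemma hat_iter p m : (rk (lvar p) <= 1)%N ->
  (rk (lvar (iter m (sep uvar) p)) <= 1)%N /\ hat (iter m (sep uvar) p) = iter m (@deriv Qxy) (hat p).
Proof.
move=> p1; elim: m => //= m [r1 E]; split; first exact: rk_sep.
by rewrite (hat_sep r1) E.
Qed.

Section Decide.
Variables (n : nat) (p : pol) (out : seq (seq pol * pol)).
Hypothesis p1 : (rk (lvar p) <= 1)%N.
Hypothesis tp : tight p.
Hypothesis sp : (size (hat p) <= n.+1)%N.

Lemma states_In s : List.In s (states n p out) <->
  exists o m, let x := dch p m in [/\ List.In o out, (m <= n)%N, rk (lvar x.1) = 1%N &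
    s = (x.1, (x.2 ++ o.1, pmul o.2 (pmul (initp x.1) (sep (lvar x.1) x.1))))].
Proof.
rewrite /states; elim: out => [|o l IH] /=; first by split=> [|[? [? []]]].
split=> [/List.in_app_iff[/List.in_map_iff[x [<- xin]]|/IH[o' [m [h1 h2 h3 h4]]]]|].
- have [/dchain_In[m mn xE] /eqP x1] := in_filter_In (a := fun x => rk (lvar x.1) == 1%N) xin.
  by exists o, m; rewrite -xE; split=> //; left.
- by exists o', m; split=> //; right.
move=> [o' [m H]]; have {H} [oo mn x1 sE] := H; apply/List.in_app_iff; case: oo => [oE|h].
  left; rewrite oE sE.
  apply: (List.in_map (fun x => (x.1, (x.2 ++ o'.1, pmul o'.2 (pmul (initp x.1) (sep (lvar x.1) x.1)))))).
  by apply: (@filter_In _ (fun x => rk (lvar x.1) == 1%N)); [apply/dchain_In; exists m | apply/eqP].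
by right; apply/IH; exists o', m.
Qed.

Lemma states_inv f s : List.In s (states n p out) -> einv (valuation iota (jet f)) true s.
Proof.
move=> /states_In[o [m [_ _ r1 ->]]]; split; first by rewrite /dirs /= r1 orbT.
move=> _ /=; rewrite !pval_mul !mulf_eq0 !negb_or => /andP[_ /andP[]].
by [].
Qed.

Lemma states_hold f : has (eholds (valuation iota (jet f))) (states n p out) <->
  vl f p = 0 /\ has (jcond (valuation iota (jet f))) out.
Proof.
split=> [/hasIn[s /states_In[o [m [oo mn r1 ->]]]]|[pf /hasIn[o oo /andP[os oq]]]].
  rewrite /eholds /= all_cat !pval_mul !mulf_eq0 !negb_or => /and3P[rf /andP[lo os] /andP[oq _]].
  split; last by apply/hasIn; exists o => //; rewrite /jcond os.
  case: m {mn r1} lo rf => [|m] lo rf; first exact/eqP.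
  by have /dch2/(_ 0%N isT)/eqP := lo.
have [k0 k0n k0f] : exists2 k, (k <= n)%N & vl f (iter k (sep uvar) p) != 0.
  have P0 : map_poly iota (hat p) != 0 by rewrite map_poly_eq0 -size_poly_gt0 (tight_size p1 tp).
  have [|k kn kf] := derivn_nroot (char0_ext iota) f (n := n) P0; first by rewrite size_map_poly.
  exists k => //; have [k1 E] := hat_iter k p1; rewrite /vl (val_hat iota f k1) E.
  suff -> : map_poly iota (iter k (@deriv Qxy) (hat p)) = iter k (@deriv F) (map_poly iota (hat p)) by [].
  by elim: (k) => //= i <-; rewrite deriv_map.
have [k kf kmin] := ex_minnP (ex_intro (fun k => is_true (vl f (iter k (sep uvar) p) != 0)) k0 k0f).
have kn : (k <= n)%N := leq_trans (kmin _ k0f) k0n.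
(* The first nonvanishing derivative has as its order [k] the multiplicity of the root, positive
   since [p] vanishes there; the pivot is the derivative just before it. *)
case: k kf kmin kn => [|m] kf kmin mn; first by rewrite /= pf eqxx in kf.
have [m1 Em] := hat_iter m p1.
have rf k : (k <= m)%N -> vl f (iter k (sep uvar) p) = 0.
  by move=> km; apply/eqP/negPn/negP => /kmin; rewrite ltnNge km.
have r1 : rk (lvar (dch p m).1) = 1%N.
  rewrite dch1; apply/eqP; rewrite eqn_leq m1 lt0n; apply/eqP => r0.
  move: kf; rewrite /= /vl (val_hat iota f (rk_sep m1)) (hat_sep m1) (hat_low r0) derivC.
  by rewrite rmorph0 horner0 eqxx.
have tr : tight (dch p m).1 by rewrite dch1 in r1 *; exact: tight_iter.
apply/hasIn; eexists.
  by apply/states_In; exists o, m; split; [exact: oo | exact: ltnW | exact: r1 | reflexivity].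
rewrite /eholds /= all_cat !pval_mul !mulf_neq0 ?(val_init f r1 tr) // ?andbT.
  rewrite os andbT {1}dch1 -/(vl f _) rf // eqxx /=.
  by apply/dch2 => k km; apply/eqP/rf/ltnW.
by rewrite (lvar1 r1) dch1.
Qed.

(** An output whose pivot has zero initial has no solution, as that initial divides the inequation;
    discarding it leaves only tight pivots. *)
Definition nstates (eo : seq (pol * pol)) : seq nstate :=
  [seq (o, false) | o <- eo & ~~ iszero (initp o.1)].

Lemma nstates_In eo s : List.In s (nstates eo) ->
  exists o, [/\ List.In o eo, ~~ iszero (initp o.1) & s = (o, false)].
Proof.
move=> /List.in_map_iff[o [<- /(in_filter_In (a := fun o => ~~ iszero (initp o.1)))[oo nz]]].
by exists o.
Qed.

Lemma decide eo no : runs estep (states n p out) eo -> runs nstep (nstates eo) no ->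
  (exists2 f, vl f p = 0 & has (jcond (valuation iota (jet f))) out) <->
  has (fun x => nonzero x.2) no.
Proof.
move=> er nr.
(* Pivots stay of rank 1 along the run: one is replaced only by a polynomial of lower rank that
   still involves the unknown. *)
have eo1 o : List.In o eo -> (rk (lvar o.1) <= 1)%N /\ (rk (lvar o.1) = 1%N).
  move=> oo; suff -> : rk (lvar o.1) = 1%N by [].
  apply: (runs_inv (P := fun s => rk (lvar s.1) = 1%N) (Q := fun o => rk (lvar o.1) = 1%N)
    _ er _ oo) => [s sr|s]; last by move=> /states_In[o' [m [_ _ r1 ->]]].
  rewrite /estep; case: ifP => _; first by split=> [o' [<-|[]]|].
  case: ifP => p0; first by split=> [o' []|s']; case: ifP => // _ [<-|[]].
  case: ifP => rd; first by split=> [o' []|s' [<-|[]]].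
  split=> [o' []|s' [<-|[<-|[<-|[]]]]] //=.
  move/negbT: p0; rewrite negbK => p0; apply/eqP; rewrite eqn_leq p0 andbT.
  by move: rd; rewrite /reducible sr /= /ltp /prk sr => /negbFE/orP[/ltnW|/andP[/eqP /= ->]].
have ef f := runs_estep (der_ok f) (char0_ext iota) (zero_ok f) er (@states_inv f).
have ni o : List.In o eo -> ~~ iszero (initp o.1) -> ninv (o, false).
  move=> oo nz; have [o1 o1'] := eo1 o oo.
  have to : tight o.1.
    by rewrite /tight -(iszero_cst (rk_coefp _ o1)) -{1}(lvar1 o1') -{1}(lvar1 o1').
  split=> // f rf qf; have [_ /(_ o oo)] := ef f.
  by rewrite /lead_ok o1' => /(_ isT qf)[_]; rewrite (lvar1 o1').
have [|n1 n2] := runs_has nstep_ok nr.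
  by move=> s /nstates_In[o [oo nz ->]]; exact: ni.
split=> [[f pf hf]|/hasIn/n2[s /nstates_In[o [oo nz ->]] [f rf qf]]].
  have : has (eholds (valuation iota (jet f))) (states n p out) by apply/states_hold.
  have [-> lok] := ef f; move=> /hasIn[o oo /andP[/eqP rf qf]].
  have [o1 o1'] := eo1 o oo.
  apply/hasIn/n1; exists (o, false); last by exists f.
  apply: (List.in_map (fun o => (o, false))).
  apply: (@filter_In _ (fun o => ~~ iszero (initp o.1))) => //.
  have := lok o oo; rewrite /lead_ok o1' => /(_ isT qf)[].
  by rewrite (zero_ok f) // /initp (lvar1 o1') rk_coefp.
exists f; last first.
  by have /states_hold[] : has (eholds (valuation iota (jet f))) (states n p out);
    first by have [-> _] := ef f; apply/hasIn; exists o => //; rewrite /oholds -/(vl f _) rf eqxx.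
by have /states_hold[] : has (eholds (valuation iota (jet f))) (states n p out);
  first by have [-> _] := ef f; apply/hasIn; exists o => //; rewrite /oholds -/(vl f _) rf eqxx.
Qed.
End Decide.

End Norm.

(** * First-order right factors *)

Lemma dir_eq i : (dir (~~ i) == dir i) = false.
Proof. by case: i. Qed.

Lemma dir_cases i (k : 'I_2) : k = dir i \/ k = dir (~~ i).
Proof. by rewrite [k]ord2_dir; case: (k != ix); case: i; [left|right|right|left]. Qed.

(** * Left modules over the ring of operators *)

Section DModule.
Variables (F : diffField 2) (V : lmodType F) (E : 'I_2 -> V -> V).
Hypothesis ED : forall k, {morph E k : a b / a + b}.
Hypothesis EZ : forall k c v, E k (c *: v) = der k c *: v + c *: E k v.
Hypothesis EC : forall k l v, E k (E l v) = E l (E k v).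
Implicit Types (P S L : {mpoly F[2]}) (v : V).

Definition mact (m : 'X_{1..2}) v := iter (m ix) (E ix) (iter (m iy) (E iy) v).
Definition act P v := \sum_(m <- msupp P) P@_m *: mact m v.

Lemma actwE k P v : (msize P <= k)%N ->
  act P v = \sum_(m : 'X_{1..2 < k}) P@_m *: mact m v.
Proof.
pose I : subFinType _ := 'X_{1..2 < k}.
move=> le_pk; rewrite /act (big_mksub I) /=; first last.
  by move=> x /msize_mdeg_lt/leq_trans/(_ le_pk).
  by rewrite msupp_uniq.
by rewrite big_rmcond //= => j /memN_msupp_eq0 ->; rewrite scale0r.
Qed.

Lemma actP v : linear (act^~ v).
Proof.
move=> c P L; pose k := maxn (msize (c *: P + L)) (maxn (msize P) (msize L)).
rewrite !(actwE (k := k)) ?leq_max ?leqnn ?orbT //.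
rewrite scaler_sumr -big_split /=; apply: eq_bigr => m _.
by rewrite mcoeffD mcoeffZ scalerDl scalerA.
Qed.

Lemma actD P L v : act (P + L) v = act P v + act L v.
Proof. by have := actP v 1 P L; rewrite !scale1r. Qed.
Lemma act0 v : act 0 v = 0.
Proof. by rewrite /act msupp0 big_nil. Qed.
Lemma actZ c P v : act (c *: P) v = c *: act P v.
Proof. by have := actP v c P 0; rewrite act0 !addr0. Qed.
Lemma act_sum (I : Type) (r : seq I) (G : I -> {mpoly F[2]}) v :
  act (\sum_(a <- r) G a) v = \sum_(a <- r) act (G a) v.
Proof.
by elim: r => [|a r IH]; rewrite ?big_nil ?act0 // !big_cons actD IH.
Qed.
Lemma actX (m : 'X_{1..2}) v : act 'X_[m] v = mact m v.
Proof. by rewrite /act msuppX big_seq1 mcoeffX eqxx scale1r. Qed.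
Lemma act1 v : act 1 v = v.
Proof. by rewrite -mpolyX0 actX /mact !mnm0E. Qed.

Lemma E0 k : E k 0 = 0.
Proof. by apply: (addrI (E k 0)); rewrite -ED !addr0. Qed.
Lemma E_sum k (I : Type) (r : seq I) (G : I -> V) :
  E k (\sum_(a <- r) G a) = \sum_(a <- r) E k (G a).
Proof.
by elim: r => [|a r IH]; rewrite ?big_nil ?E0 // !big_cons ED IH.
Qed.

Lemma act_0r P : act P 0 = 0.
Proof.
rewrite /act big1 // => m _.
have it n k : iter n (E k) 0 = 0 by elim: n => //= n ->; exact: E0.
by rewrite /mact !it scaler0.
Qed.

Lemma mactU k m v : mact (m + U_(k))%MM v = E k (mact m v).
Proof.
have iterC (l : 'I_2) n w : E k (iter n (E l) w) = iter n (E l) (E k w).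
  by elim: n => //= n IH; rewrite EC IH.
rewrite /mact !mnmDE !mnm1E [k]ord2_dir.
case: (k != ix) (ord2_dir k) => e /=; last by rewrite addn0 addn1.
by rewrite addn0 addn1 /= -/iy; move: (iterC ix (m ix)); rewrite e => ->.
Qed.

Lemma act_opD k P v : act (opD k P) v = E k (act P v).
Proof.
rewrite /opD actD act_sum {1}[P]mpolyE mulr_sumr act_sum -big_split [in RHS]/act E_sum.
apply: eq_bigr => m _ /=.
by rewrite EZ addrC actZ actX -scalerAr -mpolyXD actZ actX mpoly.addmC mactU.
Qed.

Lemma act_iter_opD n k P v : act (iter n (opD k) P) v = iter n (E k) (act P v).
Proof. by elim: n => //= n IH; rewrite act_opD IH. Qed.

(** Semilinear commuting maps [E] amount to a left module structure. Operators acting on themselves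
    ([opM_act]) and the quotient [{poly F}] are the two instances used. *)
Lemma actM S L v : act (opM S L) v = act S (act L v).
Proof.
rewrite /opM act_sum [in RHS]/act; apply: eq_bigr => m _.
by rewrite actZ !act_iter_opD.
Qed.

End DModule.

Section OpModule.
Variable F : diffField 2.
Implicit Types (P Q S L : {mpoly F[2]}).

Lemma der0 k : der k (0 : F) = 0.
Proof. exact: deriv0 (derivation_der F k). Qed.
Lemma der1 k : der k (1 : F) = 0.
Proof. exact: deriv1 (derivation_der F k). Qed.

Definition cder k P : {mpoly F[2]} := \sum_(m <- msupp P) der k P@_m *: 'X_[m].

Lemma cderE k P m : (cder k P)@_m = der k P@_m.
Proof.
rewrite /cder linear_sum /=.
have [mP|mP] := boolP (m \in msupp P); last first.
  rewrite (memN_msupp_eq0 mP) der0 big_seq big1 // => n nP.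
  rewrite mcoeffZ mcoeffX; case: eqP => [e|_]; last by rewrite mulr0.
  by rewrite -e nP in mP.
rewrite (bigD1_seq m) ?msupp_uniq //= mcoeffZ mcoeffX eqxx mulr1 big1 ?addr0 //.
by move=> n nm; rewrite mcoeffZ mcoeffX (negPf nm) mulr0.
Qed.

Lemma cderD k P Q : cder k (P + Q) = cder k P + cder k Q.
Proof. by apply/mpolyP => m; rewrite mcoeffD !cderE mcoeffD derD. Qed.
Lemma cderZ k c P : cder k (c *: P) = der k c *: P + c *: cder k P.
Proof. by apply/mpolyP => m; rewrite mcoeffD !mcoeffZ !cderE mcoeffZ derM. Qed.
Lemma cderX k m : cder k 'X_[m] = 0.
Proof.
by apply/mpolyP => n; rewrite cderE mcoeffX mcoeff0; case: (_ == _); rewrite ?der0 ?der1.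
Qed.
Lemma cderC k l P : cder k (cder l P) = cder l (cder k P).
Proof. by apply/mpolyP => m; rewrite !cderE derC. Qed.

Lemma cderXM k l P : cder k ('X_l * P) = 'X_l * cder k P.
Proof.
rewrite [P]mpolyE; elim: (msupp P) => [|m s IH].
  rewrite big_nil mulr0 (_ : cder k 0 = 0) ?mulr0 //.
  by apply/mpolyP => n; rewrite cderE !mcoeff0 der0.
rewrite big_cons mulrDr !cderD IH mulrDr; congr (_ + _).
by rewrite -scalerAr -mpolyXD !cderZ !cderX !scaler0 !addr0 -scalerAr -mpolyXD.
Qed.

Lemma opD_add k : {morph @opD F k : P Q / P + Q}.
Proof. by move=> P Q; rewrite /opD -!/(cder k _) cderD mulrDr addrACA. Qed.
Lemma opDZ k c P : opD k (c *: P) = der k c *: P + c *: opD k P.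
Proof. by rewrite /opD -!/(cder k _) cderZ -scalerAr scalerDr addrCA. Qed.
Lemma opDC k l P : opD k (opD l P) = opD l (opD k P).
Proof.
rewrite /opD -!/(cder _ _) !cderD !cderXM (cderC k l) !mulrDr.
by rewrite [_ * ('X_l * _)]mulrCA -!addrA; congr (_ + _); rewrite addrCA.
Qed.
Lemma opDX k m : opD k 'X_[m] = 'X_[m + U_(k)] :> {mpoly F[2]}.
Proof. by rewrite /opD -/(cder k _) cderX addr0 -mpolyXD mpoly.addmC. Qed.

Lemma mact1 m : mact (@opD F) m 1 = 'X_[m].
Proof.
have it n k p : iter n (opD k) 'X_[p] = 'X_[p + U_(k) *+ n] :> {mpoly F[2]}.
  elim: n => [|n IH] /=; first by rewrite mulm0n mpoly.addm0.
  by rewrite IH opDX mulmSr mpoly.addmA.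
rewrite /mact -mpolyX0 !it mpoly.add0m; congr 'X_[_]; apply/mnmP => k.
by rewrite mnmDE !mulmnE !mnm1E [k]ord2_dir; case: (k != ix); rewrite /= ?mul0n ?mul1n ?add0n ?addn0.
Qed.

Lemma opM_act S L : opM S L = act (@opD F) S L. Proof. by []. Qed.
Lemma opM1 P : opM P 1 = P.
Proof.
by rewrite [RHS]mpolyE /opM; apply: eq_bigr => m _; rewrite -[iter _ _ _]/(mact _ m 1) mact1.
Qed.
Lemma opM_opD k S L : opM (opD k S) L = opD k (opM S L).
Proof. exact: (act_opD opD_add opDZ opDC). Qed.

End OpModule.

(* [{poly F}] as the quotient of the ring of operators by the left ideal of
   [d_i + u d_j], where [j = ~~ i]: ['X^n] is the class of [d_j ^ n] *)
Section PolyModule.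
Variables (F : diffField 2) (i : bool) (u : F).
Implicit Types (Q : {poly F}).

Definition qder (k : 'I_2) Q : {poly F} := map_poly (der k) Q.

Lemma qderE k Q n : (qder k Q)`_n = der k Q`_n.
Proof. by rewrite coef_map_id0 // der0. Qed.
Lemma qderD k P Q : qder k (P + Q) = qder k P + qder k Q.
Proof. by apply/polyP => n; rewrite coefD !qderE coefD derD. Qed.
Lemma qderZ k c Q : qder k (c *: Q) = der k c *: Q + c *: qder k Q.
Proof. by apply/polyP => n; rewrite coefD !coefZ !qderE coefZ derM. Qed.
Lemma qderXn k n : qder k 'X^n = 0.
Proof.
by apply/polyP => m; rewrite qderE coefXn coef0; case: (_ == _); rewrite ?der0 ?der1.
Qed.

Definition EY Q : {poly F} := qder (dir (~~ i)) Q + Q * 'X.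
(** The class of d_i d_j^n: commuting the two gives d_j^n d_i, which is congruent to d_j^n (-u d_j).
    The map [EX] then extends this by the Leibniz rule. *)
Definition rhoX n : {poly F} := iter n EY (- u *: 'X).
Definition EX Q : {poly F} := qder (dir i) Q + \sum_(n < size Q) Q`_n *: rhoX n.
Definition EM (k : 'I_2) : {poly F} -> {poly F} := if k == dir i then EX else EY.

Lemma EXwE N Q : (size Q <= N)%N ->
  EX Q = qder (dir i) Q + \sum_(n < N) Q`_n *: rhoX n.
Proof.
move=> le; congr (_ + _); rewrite (big_ord_widen _ (fun n => Q`_n *: rhoX n) le).
rewrite big_mkcond; apply: eq_bigr => n _; case: ltnP => // h.
by rewrite nth_default // scale0r.
Qed.

Lemma EYD : {morph EY : P Q / P + Q}.
Proof. by move=> P Q; rewrite /EY qderD mulrDl addrACA. Qed.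
Lemma EYZ c Q : EY (c *: Q) = der (dir (~~ i)) c *: Q + c *: EY Q.
Proof. by rewrite /EY qderZ scalerDr -scalerAl addrA. Qed.
Lemma EXD : {morph EX : P Q / P + Q}.
Proof.
move=> P Q; pose N := maxn (size (P + Q)) (maxn (size P) (size Q)).
rewrite !(@EXwE N) ?leq_max ?leqnn ?orbT // qderD addrACA; congr (_ + _).
by rewrite -big_split; apply: eq_bigr => n _; rewrite coefD scalerDl.
Qed.
Lemma EXZ c Q : EX (c *: Q) = der (dir i) c *: Q + c *: EX Q.
Proof.
rewrite (@EXwE (size Q)) ?size_scale_leq // /EX qderZ scalerDr addrA; congr (_ + _).
by rewrite scaler_sumr; apply: eq_bigr => n _; rewrite coefZ scalerA.
Qed.
Lemma EXn n : EX 'X^n = rhoX n.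
Proof.
rewrite (@EXwE n.+1 _) ?size_polyXn // qderXn add0r big_ord_recr /= coefXn eqxx scale1r.
rewrite big1 ?add0r // => k _.
by rewrite coefXn (ltn_eqF (ltn_ord k)) scale0r.
Qed.
Lemma EYn n : EY 'X^n = 'X^(n.+1).
Proof. by rewrite /EY qderXn add0r exprSr. Qed.

(** By additivity it is enough to look at one term c X^n, where it follows from the commutation of
    the derivations on c and the recursion defining [rhoX]. *)
Lemma EXY Q : EX (EY Q) = EY (EX Q).
Proof.
rewrite -[Q]coefK poly_def; elim: (index_enum _) => [|n s IH].
  have X0 : EX 0 = 0 by apply: (addrI (EX 0)); rewrite -EXD !addr0.
  have Y0 : EY 0 = 0 by apply: (addrI (EY 0)); rewrite -EYD !addr0.
  by rewrite big_nil X0 Y0 X0.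
have CD A B : EX (EY A) = EY (EX A) -> EX (EY B) = EY (EX B) ->
    EX (EY (A + B)) = EY (EX (A + B)).
  by rewrite (EYD A B) (EXD (EY A)) (EXD A B) (EYD (EX A)) => -> ->.
rewrite big_cons; apply: CD => //; set c := Q`_n.
rewrite (EYZ c 'X^n) (EXZ c 'X^n) EXn EYn (EXD (_ *: 'X^n)) !EXZ !EXn.
rewrite (EYD (_ *: 'X^n)) (EYZ _ 'X^n) (EYZ _ (rhoX n)) EYn /= derC.
by rewrite -!addrA; congr (_ + _); rewrite addrCA.
Qed.

Lemma EMD k : {morph EM k : P Q / P + Q}.
Proof. by rewrite /EM; case: ifP => _; [exact: EXD | exact: EYD]. Qed.
Lemma EMZ k c Q : EM k (c *: Q) = der k c *: Q + c *: EM k Q.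
Proof.
rewrite /EM; case: eqVneq => [->|ki]; first exact: EXZ.
by have [e|->] := dir_cases i k; [rewrite e eqxx in ki | exact: EYZ].
Qed.
Lemma EMC k l Q : EM k (EM l Q) = EM l (EM k Q).
Proof. by rewrite /EM; case: ifP => _; case: ifP => _ //; rewrite EXY. Qed.

Definition tops n Q (c : F) := (size Q <= n.+1)%N /\ Q`_n = c.

Lemma tops_EY n Q c : tops n Q c -> tops n.+1 (EY Q) c.
Proof.
case=> sQ cQ; split; last by rewrite /EY coefD coefMX qderE /= cQ nth_default // der0 add0r.
apply: leq_trans (size_polyD _ _) _; rewrite geq_max.
rewrite (leq_trans (size_poly _ _)) ?(leqW sQ) //.
by apply: leq_trans (size_polyMleq _ _) _; rewrite size_polyX addn2.
Qed.
Lemma tops_rho n : tops n.+1 (rhoX n) (- u).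
Proof.
elim: n => [|n IH]; last exact: tops_EY.
split; last by rewrite coefZ coefX mulr1.
by apply: leq_trans (size_scale_leq _ _) _; rewrite size_polyX.
Qed.
Lemma tops_EX n Q c : tops n Q c -> tops n.+1 (EX Q) (- u * c).
Proof.
case=> sQ cQ; rewrite (EXwE sQ); split.
  apply: leq_trans (size_polyD _ _) _; rewrite geq_max.
  rewrite (leq_trans (size_poly _ _)) ?(leqW sQ) //.
  apply: leq_trans (size_sum _ _ _) _; apply/bigmax_leqP => k _.
  apply: leq_trans (size_scale_leq _ _) _.
  by apply: leq_trans (tops_rho k).1 _; rewrite !ltnS leq_ord.
rewrite coefD qderE nth_default // der0 add0r coef_sum big_ord_recr /= big1 => [|k _].
  by rewrite add0r coefZ (tops_rho n).2 cQ mulrC.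
by rewrite coefZ (nth_default 0 (leq_trans (tops_rho k).1 _)) ?mulr0 // ltnS.
Qed.

(** The top coefficient is the symbol evaluated at -u in direction [i] and 1 in the other direction,
    times [h]. *)
Lemma tops_iter a b h :
  tops (a + b) (iter a EX (iter b EY h%:P)) ((- u) ^+ a * h).
Proof.
elim: a => [|a IH] /=; last by rewrite exprS -mulrA; apply: tops_EX.
rewrite mul1r; elim: b => [|b IH]; last exact: tops_EY.
by split; [exact: size_polyC_leq1 | rewrite coefC].
Qed.

(** A section of the quotient map: it supplies the remainders in the division by an operator monic
    in d_i. *)
Definition of_poly Q : {mpoly F[2]} := \sum_(n < size Q) Q`_n *: iter n (opD (dir (~~ i))) 1.

Lemma of_polywE N Q : (size Q <= N)%N ->
  of_poly Q = \sum_(n < N) Q`_n *: iter n (opD (dir (~~ i))) 1.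
Proof.
move=> le; rewrite /of_poly (big_ord_widen _ (fun n => Q`_n *: iter n _ _) le).
rewrite big_mkcond; apply: eq_bigr => n _; case: ltnP => // h.
by rewrite nth_default // scale0r.
Qed.
Lemma of_polyD P Q : of_poly (P + Q) = of_poly P + of_poly Q.
Proof.
pose N := maxn (size (P + Q)) (maxn (size P) (size Q)).
rewrite !(@of_polywE N) ?leq_max ?leqnn ?orbT // -big_split; apply: eq_bigr => n _.
by rewrite coefD scalerDl.
Qed.
Lemma of_polyZ c Q : of_poly (c *: Q) = c *: of_poly Q.
Proof.
rewrite (@of_polywE (size Q)) ?size_scale_leq // scaler_sumr; apply: eq_bigr => n _.
by rewrite coefZ scalerA.
Qed.
Lemma of_polyXn n : of_poly 'X^n = iter n (opD (dir (~~ i))) 1.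
Proof.
rewrite (@of_polywE n.+1) ?size_polyXn // big_ord_recr /= coefXn eqxx scale1r.
rewrite big1 ?add0r // => k _.
by rewrite coefXn (ltn_eqF (ltn_ord k)) scale0r.
Qed.
Lemma of_poly0 : of_poly 0 = 0.
Proof. by rewrite /of_poly size_poly0 big_ord0. Qed.

Lemma of_poly_EY Q : opD (dir (~~ i)) (of_poly Q) = of_poly (EY Q).
Proof.
rewrite -[Q]coefK poly_def; elim: (index_enum _) => [|n s IH].
  have Y0 : EY 0 = 0 by apply: (addrI (EY 0)); rewrite -EYD !addr0.
  rewrite big_nil Y0 of_poly0; exact: (E0 (@opD_add F)).
rewrite big_cons EYD (of_polyD (_ *: _)) (of_polyD (EY _)) opD_add IH; congr (_ + _).
by rewrite EYZ of_polyD !of_polyZ EYn !of_polyXn opDZ.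
Qed.

Section Division.
Variables (v : F) (L : {mpoly F[2]}).
Hypothesis LE : L = opD (dir i) 1 + u *: opD (dir (~~ i)) 1 + v *: 1.

Definition divides_up P := exists S r, P = opM S L + of_poly r.

Lemma div_add (P Q : {mpoly F[2]}) : divides_up P -> divides_up Q -> divides_up (P + Q).
Proof.
move=> [S [r ->]] [S' [r' ->]]; exists (S + S'), (r + r').
by rewrite !opM_act actD of_polyD addrACA.
Qed.
Lemma div_scale c P : divides_up P -> divides_up (c *: P).
Proof.
move=> [S [r ->]]; exists (c *: S), (c *: r).
by rewrite !opM_act actZ of_polyZ scalerDr.
Qed.
Lemma div_of_poly r : divides_up (of_poly r).
Proof. by exists 0, r; rewrite opM_act act0 add0r. Qed.
Lemma div_EY P : divides_up P -> divides_up (opD (dir (~~ i)) P).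
Proof.
move=> [S [r ->]]; exists (opD (dir (~~ i)) S), (EY r).
by rewrite opD_add opM_opD of_poly_EY.
Qed.
Lemma div_sum (I : Type) (s : seq I) (G : I -> {mpoly F[2]}) :
  (forall a, divides_up (G a)) -> divides_up (\sum_(a <- s) G a).
Proof.
move=> H; elim: s => [|a s IH]; last by rewrite big_cons; apply: div_add.
by rewrite big_nil -of_poly0; apply: div_of_poly.
Qed.
Lemma div_EX P : divides_up P -> divides_up (opD (dir i) P).
Proof.
move=> [S [r ->]]; rewrite opD_add -opM_opD; apply: div_add.
  by exists (opD (dir i) S), 0; rewrite of_poly0 addr0.
rewrite /of_poly (E_sum (@opD_add F)); apply: div_sum => n; rewrite opDZ.
apply: div_add; apply: div_scale.
  by rewrite -of_polyXn; apply: div_of_poly.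
(* Write d_i d_j^n as d_j^n d_i and replace d_i by L - u d_j - v: only powers of d_j remain modulo
   L. *)
have -> : opD (dir i) (iter n (opD (dir (~~ i))) 1) =
    iter n (opD (dir (~~ i))) (L + of_poly (- u *: 'X^1 - v *: 'X^0)).
  have -> : L + of_poly (- u *: 'X^1 - v *: 'X^0) = opD (dir i) 1.
    rewrite -scaleNr of_polyD !of_polyZ !of_polyXn LE /= !scaleNr.
    by rewrite addrACA addrK subrr addr0.
  by elim: (n : nat) => //= m IH; rewrite opDC IH.
elim: (n : nat) => [|m IH]; last exact: div_EY.
apply: div_add (div_of_poly _).
by exists 1, 0; rewrite opM_act act1 of_poly0 addr0.
Qed.

Lemma division P : divides_up P.
Proof.
rewrite -[P]opM1 /opM; apply: div_sum => m; apply: div_scale.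
have it k n (Q : {mpoly F[2]}) : divides_up Q -> divides_up (iter n (opD k) Q).
  move=> dQ; elim: n => // n; have [->|->] := dir_cases i k; [exact: div_EX | exact: div_EY].
apply: (it); apply: (it).
by rewrite -[1]/(iter 0 (opD (dir (~~ i))) 1) -of_polyXn; apply: div_of_poly.
Qed.

(** The top coefficient of the result is the leading coefficient of [r] times [h]: a remainder is
    detected by any single nonzero [h]. *)
Lemma act_of_poly r h : h != 0 -> act EM (of_poly r) h%:P = 0 -> r = 0.
Proof.
move=> h0; rewrite /of_poly act_sum => /(congr1 (fun Q : {poly F} => Q`_(size r).-1)).
have [->//|r0] := eqVneq r 0.
rewrite coef0 coef_sum -[in X in X = _ -> _](prednK (n := size r)) ?size_poly_gt0 //.
have aE n : act EM (r`_n *: iter n (opD (dir (~~ i))) 1) h%:P = r`_n *: iter n EY h%:P.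
  rewrite actZ (act_iter_opD EMD EMZ EMC) act1; congr (_ *: _).
  by elim: n => //= n ->; rewrite /EM dir_eq.
rewrite big_ord_recr /= big1 => [|k _].
  rewrite add0r aE coefZ (tops_iter 0 (size r).-1 h).2 mul1r => /eqP.
  by rewrite mulf_eq0 (negPf h0) orbF -lead_coefE lead_coef_eq0 => /eqP.
rewrite aE coefZ (nth_default 0 (leq_trans (tops_iter 0 k h).1 _)) ?mulr0 //.
exact: ltn_ord.
Qed.
End Division.

(** For u = b / a the term in 'X disappears, and the action of L on h reduces to the value L(h) in
    [F]. *)
Lemma act_first_order a b c h (L : {mpoly F[2]}) :
  L = a *: opD (dir i) 1 + b *: opD (dir (~~ i)) 1 + c *: 1 ->
  act EM L h%:P = (a * der (dir i) h + b * der (dir (~~ i)) h + c * h)%:P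
    + ((b - a * u) * h) *: 'X.
Proof.
move=> ->; rewrite !actD !actZ !(act_opD EMD EMZ EMC) !act1 /EM eqxx dir_eq.
have -> : h%:P = h *: 'X^0 by rewrite alg_polyC.
rewrite EXZ EYZ EXn EYn /rhoX /= expr1 alg_polyC !scalerDr !scalerA !polyCD.
rewrite -!mul_polyC !polyCM !polyCB !polyCN !polyCM.
move: (der _ h)%:P (der _ h)%:P a%:P b%:P c%:P h%:P u%:P => A B C D H G U.
by rewrite /=; ring.
Qed.

End PolyModule.

Section Factor.
Variable F : diffField 2.
Hypothesis char0 : forall n, (n.+1)%:R != 0 :> F.
Hypothesis F_universal : universal F.

Lemma mpoly_first_order (L : {mpoly F[2]}) i : (msize L <= 2)%N ->
  L = L@_U_(dir i) *: opD (dir i) 1 + L@_U_(dir (~~ i)) *: opD (dir (~~ i)) 1 + L@_0 *: 1.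
Proof.
move=> sL; have X1 k : opD k 1 = 'X_k :> {mpoly F[2]}.
  by rewrite -mpolyX0 opDX mpoly.add0m.
apply/mpolyP => m; rewrite !X1 !mcoeffD !mcoeffZ !mcoeffX mcoeff1.
case: (posnP (mdeg m)) => [/eqP|m0].
  by rewrite mdeg_eq0 => /eqP ->; rewrite !mnm1_eq0 eqxx !mulr0 !add0r mulr1.
have mz : (m == 0%MM) = false by rewrite -mdeg_eq0 eqn0Ngt m0.
have [/eqP/mdeg1P[k /eqP ->]|m1] := eqVneq (mdeg m) 1%N.
  rewrite !eq_mnm1 mnm1_eq0 mulr0 addr0.
  by have [->|->] := dir_cases i k; rewrite eqxx ?dir_eq ?(eq_sym (dir i)) ?dir_eq mulr0 mulr1 ?addr0 ?add0r.
have ne k : (U_(k) == m)%MM = false by apply/eqP => e; rewrite -e mdeg1 in m1.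
rewrite !ne mz !mulr0 !addr0; apply/memN_msupp_eq0/msize_mdeg_ge.
by apply: leq_trans sL _; lia.
Qed.

(** Given T = S L with d_i in L, take u = b / a and h in the kernel of L: then L kills the class of
    h, hence so does T. Conversely, divide T by an L that kills the class of h; the remainder kills
    it too and is therefore zero. *)
Lemma first_order_factorP (T : {mpoly F[2]}) :
  has_first_order_factor T <->
  exists i u h, h != 0 /\ act (EM i u) T h%:P = 0.
Proof.
split=> [[S [L [L2 ->]]]|[i [u [h [h0 Th]]]]].
  have [i a0] : exists i, L@_U_(dir i) != 0.
    apply/not_existsP => H; have := mpoly_first_order false (eq_leq L2).
    have H' i : L@_U_(dir i) = 0 by apply/eqP/negPn/negP/H.
    rewrite !H' !scale0r !add0r => e; move: L2; rewrite /first_order e.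
    by rewrite alg_mpolyC msizeC; case: (_ != _).
  have := mpoly_first_order i (eq_leq L2).
  set a := L@_U_(dir i) in a0 *; set b := L@__; set c := L@__ => LE.
  have [h h0 E] := universal_first_order char0 F_universal i (b / a) (c / a).
  exists i, (b / a), h; split=> //.
  rewrite (actM (@EMD _ _ _) (@EMZ _ _ _) (@EMC _ _ _)) (act_first_order _ _ LE).
  have -> : a * der (dir i) h + b * der (dir (~~ i)) h + c * h =
      a * (der (dir i) h + b / a * der (dir (~~ i)) h + c / a * h).
    move: (der _ h) (der _ h) a0 => A B; move: a b c {LE E} => a b c a0; field.
    by [].
  rewrite E mulr0 mulrCA divff // mulr1 subrr mul0r scale0r addr0 polyC0.
  exact: (act_0r (@EMD _ _ _)).
(* The coefficient of order 0 that puts [h] in the kernel of L. *)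
pose v := - ((der (dir i) h + u * der (dir (~~ i)) h) / h).
pose L : {mpoly F[2]} := opD (dir i) 1 + u *: opD (dir (~~ i)) 1 + v *: 1.
have [S [r TE]] := division (erefl L) T.
exists S, L; split.
  have X1 k : opD k 1 = 'X_k :> {mpoly F[2]} by rewrite -mpolyX0 opDX mpoly.add0m.
  apply/eqP; rewrite eqn_leq; apply/andP; split.
    rewrite /L !X1; apply: leq_trans (msizeD_le _ _) _; rewrite geq_max.
    rewrite (leq_trans (msizeZ_le _ _)) ?msize1 // andbT.
    apply: leq_trans (msizeD_le _ _) _; rewrite geq_max msizeX mdeg1 /=.
    by rewrite (leq_trans (msizeZ_le _ _)) // msizeX mdeg1.
  suff: (mdeg U_(dir i) < msize L)%N by rewrite mdeg1.
  apply: msize_mdeg_lt; rewrite mcoeff_msupp /L !X1.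
  rewrite !mcoeffD !mcoeffZ !mcoeffX mcoeff1 eqxx mnm1_eq0 eq_mnm1 dir_eq.
  by rewrite !mulr0 !addr0 oner_neq0.
have L0 : act (EM i u) L h%:P = 0.
  rewrite (act_first_order u h (a := 1) (b := u) (c := v)) ?scale1r // !mul1r subrr mul0r scale0r.
  by rewrite addr0 /v mulNr divfK // subrr.
move: Th; rewrite {1}TE actD (actM (@EMD _ _ _) (@EMZ _ _ _) (@EMC _ _ _)) L0.
rewrite (act_0r (@EMD _ _ _)) add0r => /(act_of_poly h0) r0.
by rewrite [LHS]TE r0 of_poly0 addr0.
Qed.
End Factor.

(** * The decision procedure *)

Local Close Scope ring_scope.

Definition clear_dens (T : seq (rawfun * (nat * nat))) : op :=
  (fracop [seq ((zpol t.1.1, zpol t.1.2), t.2) | t <- T]).1.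
(** Drops the monomials whose coefficients sum to zero, so that [odeg] is the true order of the
    operator and the zero operator becomes the empty list. *)
Definition norm (T : seq (rawfun * (nat * nat))) : op :=
  [seq c <- clear_dens T | ~~ iszero (ocoef c.2 (clear_dens T))].

Definition odeg (A : op) : nat := foldr (fun c b => maxn (c.2.1 + c.2.2) b) 0 A.
Definition iexp (i : bool) (t : nat * nat) : nat := if i then t.2 else t.1.

(* Its value at [u] is the coefficient of [h] in the equation of highest degree
   of [sys i A]. *)
Definition lead (i : bool) (A : op) : pol :=
  flatten [seq pmulv uvar (iexp i c.2) (iter (iexp i c.2) pneg c.1)
          | c <- A & c.2.1 + c.2.2 == odeg A].

(* [(c, (t, k))] stands for [c] times the derivative of order [t] of [h] times
   ['X^k]. *)
Definition hop := seq (pol * ((nat * nat) * nat)).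
Definition hder (k : bool) (Q : hop) : hop :=
  flatten [seq [:: (pD k c.1, c.2); (c.1, (bump k c.2.1, c.2.2))] | c <- Q].
Definition hEY (i : bool) (Q : hop) : hop :=
  hder (~~ i) Q ++ [seq (c.1, (c.2.1, c.2.2.+1)) | c <- Q].
Definition rhos (i : bool) (k : nat) : seq (pol * nat) :=
  iter k (fun l => flatten [seq [:: (pD (~~ i) d.1, d.2); (d.1, d.2.+1)] | d <- l])
    [:: (pneg (pvar uvar), 1)].
Definition hEX (i : bool) (Q : hop) : hop :=
  hder i Q ++
  flatten [seq [seq (pmul c.1 d.1, (c.2.1, d.2)) | d <- rhos i c.2.2] | c <- Q].
Definition hE (i k : bool) (Q : hop) : hop := if k (+) i then hEY i Q else hEX i Q.
Definition hact (i : bool) (A : op) : hop :=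
  flatten [seq [seq (pmul c.1 d.1, d.2)
               | d <- iter c.2.1 (hE i false) (iter c.2.2 (hE i true) [:: (pone, ((0, 0), 0))])]
          | c <- A].
(** Each occurring power of 'X gives the equation that its coefficient, linear in [h], vanishes;
    repeated powers only repeat equations. *)
Definition sys (i : bool) (A : op) : seq (seq (pol * (nat * nat))) :=
  let H := hact i A in [seq [seq (d.1, d.2.1) | d <- H & d.2.2 == c.2.2] | c <- H].
Definition sys_raw (i : bool) (A : op) : seq (seq (rawpoly (nat * nat) * (nat * nat))) :=
  [seq [seq (rawpol (fun v => v.2) t.1, t.2) | t <- e] | e <- sys i A].

Definition parse (o : seq (rawsystem (nat * nat))) : seq (seq pol * pol) :=
  [seq ([seq (fracpol jetxy p).1 | p <- d.1], (fracpol jetxy d.2).1) | d <- o].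
Definition branch_states (i : bool) (x : op * seq (rawsystem (nat * nat))) : seq estate :=
  states (odeg x.1) (lead i x.1) (parse x.2).

#[global] Hint Transparent hop rawsystem : comp.

Section Comp.
Context {G : Type} {g : encodable G}.
Lemma c_clear_dens (T : G -> seq (rawfun * (nat * nat))) :
  computable T -> computable (fun x => clear_dens (T x)).
Proof. move=> TP; rewrite /clear_dens; comp_tac. Qed.
End Comp.
#[global] Hint Resolve c_clear_dens : comp.

Section Comp.
Context {G : Type} {g : encodable G}.
Lemma c_norm (T : G -> seq (rawfun * (nat * nat))) :
  computable T -> computable (fun x => norm (T x)).
Proof. move=> TP; rewrite /norm; comp_tac. Qed.
Lemma c_odeg (A : G -> op) : computable A -> computable (fun x => odeg (A x)).
Proof. move=> AP; rewrite /odeg; comp_tac. Qed.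
Lemma c_iexp i (t : G -> nat * nat) : computable t -> computable (fun x => iexp i (t x)).
Proof. move=> tP; rewrite /iexp; comp_tac. Qed.
Lemma c_hder (k : G -> bool) (Q : G -> hop) :
  computable k -> computable Q -> computable (fun x => hder (k x) (Q x)).
Proof. move=> kP QP; rewrite /hder; comp_tac. Qed.
Lemma c_rhos (i : G -> bool) (k : G -> nat) :
  computable i -> computable k -> computable (fun x => rhos (i x) (k x)).
Proof. move=> iP kP; rewrite /rhos; comp_tac. Qed.
Lemma c_initp (r : G -> pol) : computable r -> computable (fun x => initp (r x)).
Proof. move=> rP; rewrite /initp; comp_tac. Qed.
Lemma c_nonzero (q : G -> pol) : computable q -> computable (fun x => nonzero (q x)).
Proof. move=> qP; rewrite /nonzero; comp_tac. Qed.
Lemma c_dchain (n : G -> nat) (p : G -> pol) :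
  computable n -> computable p -> computable (fun x => dchain (n x) (p x)).
Proof. move=> nP pP; rewrite /dchain; comp_tac. Qed.
Lemma c_jetxy (t : G -> nat * nat) : computable t -> computable (fun x => jetxy (t x)).
Proof. move=> tP; rewrite /jetxy; comp_tac. Qed.
End Comp.
#[global] Hint Resolve c_norm c_odeg c_iexp c_hder c_rhos c_initp c_nonzero c_dchain c_jetxy : comp.

Section Comp.
Context {G : Type} {g : encodable G}.
Lemma c_lead i (A : G -> op) : computable A -> computable (fun x => lead i (A x)).
Proof. move=> AP; rewrite /lead; comp_tac. Qed.
Lemma c_hEY (i : G -> bool) (Q : G -> hop) :
  computable i -> computable Q -> computable (fun x => hEY (i x) (Q x)).
Proof. move=> iP QP; rewrite /hEY; comp_tac. Qed.
Lemma c_hEX (i : G -> bool) (Q : G -> hop) :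
  computable i -> computable Q -> computable (fun x => hEX (i x) (Q x)).
Proof. move=> iP QP; rewrite /hEX; comp_tac. Qed.
Lemma c_states (n : G -> nat) (p : G -> pol) (o : G -> seq (seq pol * pol)) :
  computable n -> computable p -> computable o ->
  computable (fun x => states (n x) (p x) (o x)).
Proof. move=> nP pP oP; rewrite /states; comp_tac. Qed.
Lemma c_parse (o : G -> seq (rawsystem (nat * nat))) :
  computable o -> computable (fun x => parse (o x)).
Proof. move=> oP; rewrite /parse; comp_tac. Qed.
End Comp.
#[global] Hint Resolve c_lead c_hEY c_hEX c_states c_parse : comp.

Section Comp.
Context {G : Type} {g : encodable G}.
Lemma c_hE (i k : G -> bool) (Q : G -> hop) :
  computable i -> computable k -> computable Q -> computable (fun x => hE (i x) (k x) (Q x)).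
Proof. move=> iP kP QP; rewrite /hE; comp_tac. Qed.
End Comp.
#[global] Hint Resolve c_hE : comp.

Section Comp.
Context {G : Type} {g : encodable G}.
Lemma c_hact (i : G -> bool) (A : G -> op) :
  computable i -> computable A -> computable (fun x => hact (i x) (A x)).
Proof. move=> iP AP; rewrite /hact; comp_tac. Qed.
End Comp.
#[global] Hint Resolve c_hact : comp.

Lemma c_sys_raw i : computable (sys_raw i).
Proof.
have jP : computable (fun v : var => v.2) by comp_tac.
rewrite /sys_raw /sys; comp_tac.
Qed.
Lemma c_branch_states i : computable (branch_states i).
Proof. rewrite /branch_states; comp_tac. Qed.
Lemma c_nstates : computable nstates.
Proof. rewrite /nstates; comp_tac. Qed.
Lemma c_answer : computable (fun no : seq (pol * pol) => has (fun x => nonzero x.2) no).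
Proof. comp_tac. Qed.

Local Open Scope ring_scope.

Lemma low_clear T : forall c, List.In c (clear_dens T) -> rk (lvar c.1) = 0%N.
Proof.
pose low (p : pol) := allv (fun w => rk w <= 0)%N p.
have zx p : low (zpol p).
  rewrite /low /allv all_flatten all_map; apply/allP => t _ /=; rewrite all_map.
  by apply/allP => b _ /=; rewrite all_cat !all_nseq !orbT.
suff [H _] : (forall c, List.In c (clear_dens T) -> low c.1) /\
    low (fracop [seq ((zpol t.1.1, zpol t.1.2), t.2) | t <- T]).2.
  by move=> c /H; rewrite /low -rk_lvar_le leqn0 => /eqP.
rewrite /clear_dens; elim: T => [|t T [IH1 IH2]] /=; first by split.
split; last exact: allv_mul.
by move=> c [<-|/List.in_map_iff[d [<- /IH1 dl]]] /=; apply: allv_mul.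
Qed.

Lemma norm_In c T : List.In c (norm T) -> List.In c (clear_dens T) /\
  ~~ iszero (ocoef c.2 (clear_dens T)).
Proof. exact: (in_filter_In (a := fun c => ~~ iszero (ocoef c.2 (clear_dens T)))). Qed.

Lemma ocoef_norm t T : ocoef t (norm T) =
  if iszero (ocoef t (clear_dens T)) then [::] else ocoef t (clear_dens T).
Proof.
rewrite {1 3}/ocoef /norm -filter_predI.
case: ifP => [z|/negbT nz]; last first.
  congr (flatten (map _ _)); apply: eq_filter => c /=.
  by case: eqP => //= /pos_inj ->; rewrite nz.
rewrite (eq_filter (a2 := pred0)) ?filter_pred0 // => c /=.
by case: eqP => //= /pos_inj ->; rewrite z.
Qed.

Lemma low_ocoef t A : (forall c, List.In c A -> rk (lvar c.1) = 0%N) -> rk (lvar (ocoef t A)) = 0%N.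
Proof.
move=> low; apply/eqP; rewrite -leqn0 rk_lvar_le /ocoef.
elim: A low => //= c A IH low; have cl := low c (or_introl (erefl _)).
have {}IH := IH (fun d dA => low d (or_intror dA)).
by case: ifP => //= _; rewrite allv_cat IH andbT -rk_lvar_le cl.
Qed.

Lemma pval_ocoef (R : comNzRingType) (rho : var -> R) t A :
  pval rho (ocoef t A) = \sum_(c <- A | c.2 == t) pval rho c.1.
Proof.
rewrite pval_flatten big_map big_filter; apply: eq_bigl => c.
by apply/eqP/eqP => [/pos_inj|->].
Qed.

Section Equations.
Variables (F : diffField 2) (iota : {rmorphism Qxy -> F}).
Hypothesis F_dx : extends_partial iota (der ix) ix.
Hypothesis F_dy : extends_partial iota (der iy) iy.
Variables (f h : F).
Let vl := pval (valuation iota (jet f)).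

Definition op_mpoly (A : op) : {mpoly F[2]} := \sum_(c <- A) vl c.1 *: 'X_[xymon c.2.1 c.2.2].

Lemma coef_op_mpoly A t : (op_mpoly A)@_(xymon t.1 t.2) = vl (ocoef t A).
Proof.
rewrite /vl pval_ocoef /op_mpoly linear_sum [RHS]big_mkcond /=; apply: eq_bigr => c _.
rewrite mcoeffZ mcoeffX xymon_eq -[_ && _]/(c.2 == t).
by case: eqP; rewrite ?mulr1 ?mulr0.
Qed.

Lemma xymonK (m : 'X_{1..2}) : m = xymon (m ix) (m iy).
Proof.
by apply/mnmP => k; rewrite mnmE [k]ord2_dir; case: (k != ix).
Qed.

Lemma op_mpoly_norm T : op_mpoly (norm T) = op_mpoly (clear_dens T).
Proof.
apply/mpolyP => m; rewrite [m]xymonK -[xymon _ _]/(xymon (m ix, m iy).1 (m ix, m iy).2).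
rewrite !coef_op_mpoly ocoef_norm; case: ifP => //.
rewrite (iszeroP iota (jet f)) /vl; last exact: low_ocoef (@low_clear T).
by move/eqP => ->; rewrite pval_nil.
Qed.

Lemma op_mpoly_oper (s : oper) : exists2 D : F, D != 0 &
  op_mpoly (clear_dens [seq (sval t.1, t.2) | t <- s]) = D *: map_mpoly iota (oper_val s).
Proof.
have [|D0 E] := @val_fracop F iota (jet f) _
  [seq ((zpol (sval t.1).1, zpol (sval t.1).2), t.2) | t : ratfun * (nat * nat) <- s].
  move=> t /List.in_map_iff[u [<- _]] /=.
  by rewrite val_zpol fmorph_eq0 tofrac_eq0; exact: (valP u.1).
set A := map _ s in D0 E *.
have -> : clear_dens [seq (sval t.1, t.2) | t <- s] = (fracop A).1.
  by rewrite /clear_dens -map_comp.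
exists (vl (fracop A).2) => //.
apply/mpolyP => m; rewrite mcoeffZ.
have -> : map_mpoly iota (oper_val s) =
    \sum_(t <- s) iota (ratfun_val t.1) *: 'X_[xymon t.2.1 t.2.2].
  rewrite /oper_val rmorph_sum; apply: eq_bigr => t _ /=.
  by rewrite -mul_mpolyC rmorphM /= map_mpolyC mul_mpolyC -xymonE map_mpolyX.
rewrite /op_mpoly !linear_sum /=.
transitivity (\sum_(c <- (fracop A).1) vl c.1 * (xymon c.2.1 c.2.2 == m)%:R).
  by apply: eq_bigr => c _; rewrite mcoeffZ mcoeffX.
rewrite (E (fun t => (xymon t.1 t.2 == m)%:R)) /A big_map; congr (_ * _).
apply: eq_bigr => t _ /=; rewrite mcoeffZ mcoeffX; congr (_ * _).
by rewrite !val_zpol /ratfun_val fmorph_div.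
Qed.

Definition hval (Q : hop) : {poly F} := \sum_(c <- Q) (vl c.1 * jet h c.2.1) *: 'X^(c.2.2).

Lemma hval_cat P Q : hval (P ++ Q) = hval P + hval Q.
Proof. exact: big_cat. Qed.

Lemma vl_D k p : vl (pD k p) = der (dir k) (vl p).
Proof. exact: (pval_D p (derivation_der F (dir k)) (valuation_jet f F_dx F_dy k)). Qed.

Lemma qder0 k : qder k (0 : {poly F}) = 0.
Proof. by apply/polyP => n; rewrite qderE coef0 der0. Qed.

Lemma hval_der k Q : hval (hder k Q) = qder (dir k) (hval Q).
Proof.
elim: Q => [|c Q IH]; first by rewrite /hval !big_nil qder0.
rewrite -[hder k (c :: Q)]/([:: (pD k c.1, c.2); (c.1, (bump k c.2.1, c.2.2))] ++ hder k Q).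
rewrite hval_cat IH.
rewrite [in RHS]/hval big_cons qderD -/(hval Q); congr (_ + _).
rewrite qderZ qderXn scaler0 addr0 derM dir_jet -vl_D /hval !big_cons big_nil addr0 /=.
by rewrite -scalerDl.
Qed.

Section Direction.
Variable i : bool.
Local Notation E := (EM i f).

Lemma hval_EY Q : hval (hEY i Q) = EY i (hval Q).
Proof.
rewrite hval_cat hval_der /EY; congr (_ + _); rewrite /hval big_map mulr_suml.
by apply: eq_bigr => c _; rewrite -scalerAl -exprSr.
Qed.

Lemma rhosE k : \sum_(d <- rhos i k) vl d.1 *: 'X^(d.2) = rhoX i f k :> {poly F}.
Proof.
elim: k => [|k IH].
  by rewrite big_seq1 /vl pval_neg pval_var expr1.
rewrite /rhoX iterS -/(rhoX i f k) -IH /rhos iterS -/(rhos i k).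
elim: (rhos i k) => [|d l IHl] /=.
  by rewrite !big_nil /EY qder0 mul0r addr0.
rewrite !big_cons IHl EYD addrA; congr (_ + _).
by rewrite EYZ EYn vl_D.
Qed.

Lemma hval_EX Q : hval (hEX i Q) = EX i f (hval Q).
Proof.
have E0 : EX i f 0 = 0 by apply: (addrI (EX i f 0)); rewrite -EXD !addr0.
rewrite hval_cat hval_der.
have -> : EX i f (hval Q) = \sum_(c <- Q)
    (der (dir i) (vl c.1 * jet h c.2.1) *: 'X^(c.2.2) +
     (vl c.1 * jet h c.2.1) *: rhoX i f c.2.2).
  rewrite /hval; elim: Q => [|c Q IH]; first by rewrite !big_nil E0.
  by rewrite !big_cons EXD IH EXZ EXn.
rewrite big_split /=; congr (_ + _).
  rewrite /hval; elim: Q => [|c Q IH]; first by rewrite !big_nil qder0.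
  by rewrite !big_cons qderD IH qderZ qderXn scaler0 addr0.
elim: Q => [|c Q IH]; first by rewrite /hval !big_nil.
rewrite [map _ _]/= [flatten _]/= hval_cat IH big_cons; congr (_ + _).
rewrite -rhosE scaler_sumr /hval big_map; apply: eq_bigr => d _ /=.
by rewrite /vl pval_mul scalerA; congr (_ *: _); rewrite mulrAC.
Qed.

Lemma hval_E k Q : hval (hE i k Q) = E (dir k) (hval Q).
Proof.
rewrite /hE /EM; have -> : (dir k == dir i) = ~~ (k (+) i) by case: (k); case: (i).
by case: (k (+) i); rewrite /= ?hval_EY ?hval_EX.
Qed.

Lemma hval_act A : hval (hact i A) = act E (op_mpoly A) h%:P.
Proof.
rewrite /op_mpoly act_sum; elim: A => [|c A IH]; first by rewrite /hval !big_nil.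
rewrite /hact [map _ _]/= [flatten _]/= hval_cat -/(hact i A) IH big_cons; congr (_ + _).
rewrite actZ actX /mact !mnmE /=.
set Q := iter _ _ _; have -> : hval [seq (pmul c.1 d.1, d.2) | d <- Q] = vl c.1 *: hval Q.
  rewrite /hval big_map scaler_sumr; apply: eq_bigr => d _.
  by rewrite /vl pval_mul scalerA mulrA.
congr (_ *: _); rewrite /Q.
have it n k P : hval (iter n (hE i k) P) = iter n (E (dir k)) (hval P).
  by elim: n => //= n IHn; rewrite hval_E IHn.
rewrite !it; congr (iter _ _ (iter _ _ _)).
by rewrite /hval big_seq1 /= /vl pval_one mul1r alg_polyC.
Qed.

Lemma sysP A : (forall e, List.In e (sys i A) ->
    \sum_(t <- e) vl t.1 * jet h t.2 = 0) <-> act E (op_mpoly A) h%:P = 0.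
Proof.
rewrite -hval_act /sys; set H := hact i A.
have C k : (hval H)`_k = \sum_(t <- [seq (d.1, d.2.1) | d : pol * ((nat * nat) * nat) <- H & d.2.2 == k]) vl t.1 * jet h t.2.
  rewrite /hval coef_sum big_map big_filter [RHS]big_mkcond; apply: eq_bigr => d _ /=.
  by rewrite coefZ coefXn eq_sym; case: eqP; rewrite ?mulr1 ?mulr0.
split=> [Z|Z e /List.in_map_iff[c [<- _]]]; last by rewrite -C Z coef0.
apply/polyP => k; rewrite coef0 C.
have [/hasIn[c cH /eqP ck]|/hasPn no] := boolP (has (fun d : pol * ((nat * nat) * nat) => d.2.2 == k) H).
  by apply: Z; rewrite -ck; apply: (List.in_map (fun c => [seq (d.1, d.2.1) | d <- H & d.2.2 == c.2.2])).
rewrite (eq_in_filter (a2 := pred0)) ?filter_pred0 ?big_nil // => d /no /negPf.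
by [].
Qed.

Lemma lead_top A : (act E (op_mpoly A) h%:P)`_(odeg A) = vl (lead i A) * h.
Proof.
rewrite /op_mpoly act_sum coef_sum /vl /lead pval_flatten big_map big_filter.
rewrite [in RHS]big_mkcond mulr_suml [LHS]big_seq [RHS]big_seq; apply: eq_bigr => c cA.
have le : (c.2.1 + c.2.2 <= odeg A)%N.
  rewrite /odeg; elim: A cA => //= d A IH; rewrite inE leq_max.
  by case/orP => [/eqP ->|/IH ->]; rewrite ?leqnn ?orbT.
rewrite actZ actX coefZ /mact !mnmE /=.
have [sz tp] : tops (c.2.1 + c.2.2) (iter c.2.1 (E ix) (iter c.2.2 (E iy) h%:P))
    ((- f) ^+ iexp i c.2 * h).
  rewrite /iexp; case: i; rewrite /EM -/ix -/iy /=; last exact: tops_iter.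
  (* For [i = true] the maps are applied in the opposite order to that of [tops_iter]; they
     commute. *)
  have C a b Q : iter a (EY true) (iter b (EX true f) Q) = iter b (EX true f) (iter a (EY true) Q).
    have C1 b' Q' : EY true (iter b' (EX true f) Q') = iter b' (EX true f) (EY true Q').
      by elim: b' => //= b' <-; rewrite EXY.
    by elim: a => //= a ->; rewrite C1.
  by rewrite C addnC; exact: tops_iter.
case: eqVneq => [e|ne]; last first.
  rewrite nth_default ?mulr0 ?mul0r //; apply: leq_trans sz _.
  by rewrite ltn_neqAle ne le.
rewrite -e tp pval_mulv.
have -> n p : pval (valuation iota (jet f)) (iter n pneg p) = (-1) ^+ n * vl p.
  by elim: n => [|n IH] /=; rewrite ?mul1r // pval_neg IH exprS mulN1r mulNr.
rewrite [(- f) ^+ _]exprNn -[valuation _ _ uvar]/f /vl.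
move: (pval _ _) (f ^+ _) ((-1) ^+ _) => X Y Z; ring.
Qed.

End Direction.
End Equations.

Definition wf (A : op) : Prop := (forall c, List.In c A -> rk (lvar c.1) = 0%N) /\
  forall c, List.In c A -> cst (ocoef c.2 A) != 0.

Lemma norm_wf T : wf (norm T).
Proof.
split=> c /norm_In[cT nz]; first exact: low_clear cT.
rewrite ocoef_norm (negPf nz) -iszero_cst //; exact: low_ocoef (@low_clear T).
Qed.

Section Lead.
Variables (i : bool) (A : op).
Hypothesis Awf : wf A.

Lemma low_lead : (rk (lvar (lead i A)) <= 1)%N.
Proof.
rewrite rk_lvar_le /lead; elim: A (Awf.1) (odeg A) => //= c B IH low n.
have {}IH := IH (fun d dB => low d (or_intror dB)) n.
have cl := low c (or_introl (erefl _)).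
case: ifP => //= _; rewrite allv_cat IH andbT; apply: allv_mulv => //.
have h0 : allv (fun w => rk w <= 1)%N c.1 by rewrite -rk_lvar_le cl.
by elim: (iexp i c.2) => //= k IHk; rewrite allv_neg.
Qed.

Lemma coef_lead e : (hat (lead i A))`_e =
  \sum_(c <- A | (c.2.1 + c.2.2 == odeg A)%N && (iexp i c.2 == e)) (-1) ^+ iexp i c.2 * cst c.1.
Proof.
rewrite /lead /hat pval_flatten big_map big_filter coef_sum big_mkcondr /=.
elim: A (Awf.1) (odeg A) => [|c B IH] low n; first by rewrite !big_nil.
rewrite !big_cons; have {}IH := IH (fun d dB => low d (or_intror dB)) n.
have cl := low c (or_introl (erefl _)).
case: ifP => _ //; rewrite IH; congr (_ + _); rewrite pval_mulv.
have -> k : pval hvar (iter k pneg c.1) = (-1) ^+ k * (cst c.1)%:P.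
  elim: k => [|k IHk] /=; first by rewrite mul1r -hat_low.
  by rewrite pval_neg IHk exprS mulN1r mulNr.
by rewrite -[hvar uvar]/'X [_ ^+ _ * _]mulrC -mulrA coef_sign_monomial.
Qed.

(** Among monomials of top total degree the exponent in direction [i] determines the monomial, so
    different monomials feed different coefficients and none of them cancel. *)
Lemma coef_lead_term c : List.In c A -> (c.2.1 + c.2.2 == odeg A)%N ->
  (hat (lead i A))`_(iexp i c.2) != 0.
Proof.
move=> cA cn; have := Awf.2 c cA; rewrite /cst pval_ocoef.
apply: contraNneq => Z.
suff -> : \sum_(d <- A | d.2 == c.2) pval cval d.1 =
    (-1) ^+ iexp i c.2 * (hat (lead i A))`_(iexp i c.2) by rewrite Z mulr0.
rewrite coef_lead mulr_sumr.
have E : forall d : pol * (nat * nat),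
    ((d.2.1 + d.2.2 == odeg A)%N && (iexp i d.2 == iexp i c.2)) = (d.2 == c.2).
  move=> d; rewrite -(eqP cn) /iexp; case: (i); case: d c {cA cn Z} => [p [a b]] [q [a' b']] /=;
    rewrite xpair_eqE; lia.
rewrite (eq_bigl _ _ E); apply: eq_bigr => d /eqP ->.
by rewrite signrMK.
Qed.

Hypothesis A0 : A <> [::].

Lemma odeg_In : exists2 c, List.In c A & (c.2.1 + c.2.2 == odeg A)%N.
Proof.
clear Awf; elim: A A0 => [//|c B IH] _; case: (eqVneq B [::]) => [->|/eqP /IH[d dB dn]].
  by exists c; [left | rewrite /= maxn0].
rewrite /= /maxn; case: ifP => _; last by exists c => //; left.
by exists d => //; right.
Qed.

Lemma deg_lead m : m \in lead i A ->
  exists c, [/\ List.In c A, (c.2.1 + c.2.2 == odeg A)%N & deg uvar m.2 = iexp i c.2].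
Proof.
rewrite /lead; elim: A (Awf.1) (odeg A) => //= c B IH low n.
have {}IH := IH (fun d dB => low d (or_intror dB)) n.
have cl := low c (or_introl (erefl _)).
case: ifP => [cn|_ /IH[d [dB dn dm]]] /=; last by exists d; split=> //; right.
rewrite mem_cat => /orP[/mapP[m' m'c ->]|/IH[d [dB dn dm]]]; last first.
  by exists d; split=> //; right.
exists c; split=> //; first by left.
have : allv (fun w => rk w <= 0)%N (iter (iexp i c.2) pneg c.1).
  elim: (iexp i c.2) => [|k IHk] /=; first by rewrite -rk_lvar_le cl.
  by rewrite allv_neg.
move=> /allP/(_ _ m'c) m'0; rewrite /deg /= count_cat count_nseq eqxx mul1n.
suff -> : count (fun w => rk w == rk uvar) m'.2 = 0%N by rewrite addn0.
apply/eqP; rewrite -leqn0 leqNgt -has_count; apply/hasPn => w /(allP m'0).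
by rewrite leqn0 => /eqP ->.
Qed.

(** The syntactic degree is reached by a monomial coming from some top-degree term of [A], whose
    coefficient in [lead] is nonzero. *)
Lemma tight_lead : tight (lead i A).
Proof.
rewrite /tight -(coef_hat _ low_lead).
have [c0 c0A c0n] := odeg_In.
have [m ml md] : exists2 m, m \in lead i A & deg uvar m.2 = pdeg uvar (lead i A).
  have : lead i A != [::].
    apply/eqP => l0; have := coef_lead_term c0A c0n; rewrite l0.
    by rewrite /hat pval_nil coef0 eqxx.
  rewrite /pdeg; elim: (lead i A) => //= m p IH _.
  case: (eqVneq p [::]) => [->|/IH[m' mp md]].
    by exists m; rewrite ?mem_head //= maxn0.
  rewrite /maxn; case: ifP => _; last by exists m; rewrite ?mem_head.
  by exists m' => //; rewrite inE mp orbT.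
have [c [cA cn ce]] := deg_lead ml.
rewrite -md ce; exact: coef_lead_term.
Qed.

Lemma size_lead : (size (hat (lead i A)) <= (odeg A).+1)%N.
Proof.
apply/leq_sizeP => e le; rewrite coef_lead big1_seq // => c /andP[/andP[/eqP cn /eqP ce] _].
by move: le cn; rewrite -ce /iexp; case: (i); lia.
Qed.
End Lead.

Section Branch.
Variables (F : diffField 2) (iota : {rmorphism Qxy -> F}).
Hypothesis F_universal : universal F.
Hypothesis F_dx : extends_partial iota (der ix) ix.
Hypothesis F_dy : extends_partial iota (der iy) iy.

Definition branch_true i A : Prop := exists f h : F,
  h != 0 /\ act (EM i f) (op_mpoly iota f A) h%:P = 0.

Definition answers (P : Prop) (c : program) (t : tree) (O : subroutine -> tree -> tree -> Prop) :=
  exists b : bool, exec O c t (enc_bool b) /\ (b <-> P).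

Lemma sys_oracle i A (out : seq (dsystem (nat * nat))) (f : F) :
  ((exists2 h : F, h != 0 & all (fun e => lin_eq_val iota f h e == 0)
      [seq [seq (of_pol (fun v => v.2) t.1, t.2) | t <- e] | e <- sys i A])
    <-> has (dsystem_holds iota (jet f)) out) ->
  has (jcond (valuation iota (jet f))) (parse (map (@raw_system _) out)) <->
  exists h : F, h != 0 /\ act (EM i f) (op_mpoly iota f A) h%:P = 0.
Proof.
have jg a : valuation iota (jet f) (jetxy a) = jet f a by [].
have -> : has (jcond (valuation iota (jet f))) (parse (map (@raw_system _) out)) =
    has (dsystem_holds iota (jet f)) out.
  rewrite /parse -map_comp has_map; apply: eq_has => d.
  rewrite /jcond /dsystem_holds /= (val_frac_eq0 _ jg) all_map /raw_system /= all_map.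
  by congr (_ && _); apply: eq_all => p /=; rewrite (val_frac_eq0 _ jg).
move=> <-.
have E (h : F) e : lin_eq_val iota f h [seq (of_pol (fun v => v.2) t.1, t.2) | t <- e] =
    \sum_(t <- e) pval (valuation iota (jet f)) t.1 * jet h t.2.
  by rewrite /lin_eq_val big_map; apply: eq_bigr => t _; rewrite /= (@val_of_pol _ iota (jet f) _ _ (jet f)).
split=> [[h h0 /allP_In H]|[h [h0 H]]]; exists h => //.
  split=> //; apply/(sysP F_dx F_dy) => e eA; rewrite -E; apply/eqP/H.
  exact: (List.in_map (fun e => [seq (of_pol (fun v => v.2) t.1, t.2) | t <- e])).
apply/allP_In => _ /List.in_map_iff[e [<- eA]]; rewrite E; apply/eqP.
by move: H => /(sysP F_dx F_dy); apply.
Qed.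

Lemma branch_program i : exists2 c, invokes ParametricJanet c &
  forall J E A, parametric_janet_base iota J -> wf A -> A <> [::] ->
  answers (branch_true i A) c (encode A) (subroutines J E).
Proof.
have [c1 c1P] := c_sys_raw i; have [c2 c2P] := c_branch_states i.
have [c3 c3P] := exec_runs c_estep1; have [c4 c4P] := c_nstates.
have [c5 c5P] := exec_runs c_nstep1; have [c6 c6P] := c_answer.
exists (Seq (Defs.Cons Id (Seq c1 (Call ParametricJanet)))
  (Seq c2 (Seq c3 (Seq c4 (Seq c5 c6))))); first by left; right; right.
move=> J E A [_ Jsys] Awf A0.
have [out [Jout H]] := Jsys [seq [seq (of_pol (fun v => v.2) t.1, t.2) | t <- e] | e <- sys i A].
pose o := map (@raw_system (nat * nat)) out.
have [eo er] := runs_total (fun s (_ : List.In s (branch_states i (A, o))) => estep_acc s).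
have [no nr] := runs_total (fun s (_ : List.In s (nstates eo)) => nstep_acc s).
exists (has (fun x => nonzero x.2) no); split.
  apply: exec_seq; last first.
    apply: exec_seq (c2P _ (A, o)) _; apply: exec_seq (c3P _ _ _ er) _.
    apply: exec_seq (c4P _ eo) _; apply: exec_seq (c5P _ _ _ nr) _; exact: c6P.
  apply: exec_cons; first exact: exec_id.
  apply: exec_seq (c1P _ A) _; apply: exec_call; move: Jout => /=.
  rewrite (enc_map (e := enc_seq_inst _) (f := raw_eq) _ enc_raw_eq).
  rewrite (enc_map (e := enc_pair_inst _ _) (f := @raw_system _) _ (fun d => enc_raw_system (enc_pair_inst _ _) d)).
  suff -> : map raw_eq [seq [seq (of_pol (fun v : var => v.2) t.1, t.2) | t <- e] | e <- sys i A] = sys_raw i A by [].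
  rewrite -map_comp; apply: eq_map => e /=; rewrite /raw_eq -map_comp; apply: eq_map => t /=.
  by rewrite raw_of_pol.
have D := decide F_universal F_dx F_dy (low_lead i Awf) (tight_lead i Awf A0) (size_lead i Awf) er nr.
split=> [/D[f pf hf]|[f [h [h0 fh]]]].
  by have [h [h0 fh]] := (sys_oracle (H f)).1 hf; exists f, h.
apply/D; exists f; last by apply/(sys_oracle (H f)); exists h.
(* The coefficient of highest degree is P(f) h; since h is nonzero, f satisfies the algebraic
   equation that [decide] presupposes. *)
have := lead_top iota f h i A; rewrite fh coef0 => /esym/eqP.
by rewrite mulf_eq0 (negPf h0) orbF => /eqP.
Qed.

Lemma enc_oper_raw (s : oper) : enc_oper s = encode [seq (sval t.1, t.2) | t <- s].
Proof. by apply: enc_map. Qed.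

(** A first-order operator involves d_x or d_y, so the answer is the disjunction over the two
    directions. Clearing denominators multiplies T on the left by a nonzero element of [F], which
    does not change what T kills. *)
Lemma decision_program : exists A : program,
  [/\ invokes ParametricJanet A, invokes OrdinaryElimination A &
    forall J E, parametric_janet_base iota J -> ordinary_elimination E ->
      decides (subroutines J E) A (fun T => has_first_order_factor (map_mpoly iota T))].
Proof.
have [b0 b0J b0P] := branch_program false; have [b1 b1J b1P] := branch_program true.
have [cn cnP] : computable norm by apply: (c_norm c_id).
have [co coP] : computable (fun b : bool * bool => b.1 || b.2) by comp_tac.
(* The algebraic systems that remain are settled by division with remainder;
   the answer of the second subroutine to the empty system is discarded. *)
pose main := Seq cn (If Id (Seq (Defs.Cons b0 b1) co) (Defs.Cons Const_leaf Const_leaf)).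
exists (Seq (Seq (Defs.Cons (Seq (Defs.Cons Const_leaf Const_leaf) (Call OrdinaryElimination)) Id) Tl) main).
split; [by right; right; apply: Or32; left; left | by left; left; left; right|].
move=> J E JP EP T s sT; set O := subroutines J E.
pose A := norm [seq (sval t.1, t.2) | t <- s].
(* [Node Leaf Leaf] encodes the system [([::], [::])]. The specification of [E] provides an output
   for every system, so this call halts. *)
have pre t : exec O (Seq (Defs.Cons (Seq (Defs.Cons Const_leaf Const_leaf)
    (Call OrdinaryElimination)) Id) Tl) t t.
  have [o [Eo _]] := EP.2 ([::], [::]).
  apply: (exec_seq (u := Node _ t)); last exact: exec_tl.
  apply: exec_cons; last exact: exec_id.
  apply: exec_seq; first by apply: exec_cons; exact: exec_leaf.
  apply: exec_call; exact: Eo.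
have AT f : exists2 D : F, D != 0 & op_mpoly iota f A = D *: map_mpoly iota T.
  have [D D0 E'] := op_mpoly_oper iota f s.
  by exists D => //; rewrite op_mpoly_norm E' sT.
have nE : exec O cn (enc_oper s) (encode A) by rewrite enc_oper_raw; apply: cnP.
have scale D i f (h : F) : D != 0 -> act (EM i f) (D *: map_mpoly iota T) h%:P = 0 ->
    act (EM i f) (map_mpoly iota T) h%:P = 0.
  by move=> D0; rewrite actZ => /eqP; rewrite scaler_eq0 (negPf D0) => /eqP.
have facP : has_first_order_factor (map_mpoly iota T) <-> branch_true false A \/ branch_true true A.
  rewrite (first_order_factorP (char0_ext iota) F_universal); split.
    move=> [i [f [h [h0 fh]]]]; have [D D0 DE] := AT f.
    have : branch_true i A by exists f, h; rewrite DE actZ fh scaler0.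
    by case: i {fh}; [right | left].
  by move=> [] [f [h [h0 fh]]]; have [D D0 DE] := AT f; rewrite DE in fh;
    [exists false, f, h | exists true, f, h]; split=> //; exact: scale fh.
(* An empty [A] means T = 0, a left multiple of every first-order operator; this case is set apart
   because [lead] would be zero. *)
case: (eqVneq A [::]) => [A0|/eqP A0].
  exists true; split.
    apply: exec_seq (pre _) _; apply: exec_seq nE _; rewrite A0.
    by apply: exec_if_leaf (exec_id _ _) _; apply: exec_cons; exact: exec_leaf.
  split=> // _; apply/facP; left; exists 0, 1; split; first exact: oner_neq0.
  by rewrite /op_mpoly A0 big_nil act0.
have [x0 [e0 x0P]] := b0P J E A JP (norm_wf _) A0.
have [x1 [e1 x1P]] := b1P J E A JP (norm_wf _) A0.
exists (x0 || x1); split; last first.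
  split=> [/orP h|/facP h]; first by apply/facP; case: h => [/x0P|/x1P]; [left | right].
  by apply/orP; case: h => [/x0P|/x1P]; [left | right].
apply: exec_seq (pre _) _; apply: exec_seq nE _.
have [u1 [u2 AN]] : exists u1 u2, encode A = Node u1 u2.
  by case: (A) A0 => // c B _; do 2!eexists.
apply: (@exec_if_node _ _ _ _ _ u1 u2); first by rewrite -AN; exact: exec_id.
apply: exec_seq; first by apply: exec_cons; [exact: e0 | exact: e1].
exact: (coP _ (x0, x1)).
Qed.
End Branch.

Theorem theorem7p2
    (F : diffField 2) (iota : {rmorphism Qxy -> F})
    (F_universal : universal F)
    (F_dx : extends_partial iota (der ix) ix)
    (F_dy : extends_partial iota (der iy) iy) :
  exists A : program,
    [/\ invokes ParametricJanet A,
        invokes OrdinaryElimination A,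
        forall J E : tree -> tree -> Prop,
          parametric_janet_base iota J -> ordinary_elimination E ->
          decides (subroutines J E) A
            (fun T => has_first_order_factor (map_mpoly iota T))
      & (exists J : program, parametric_janet_base iota (exec no_subroutine J))
        /\ (exists E : program, ordinary_elimination (exec no_subroutine E))].
Proof.
have [A [AJ AE AP]] := decision_program F_universal F_dx F_dy.
exists A; split=> //; split; last exact: ordinary_elimination_exists.
exact: parametric_janet_base_exists.
Qed.
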